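(* Let $(\xi^*,\zeta^* )\in\mathcal A^\circ_0(\mathbb F^1)\times\mathcal A^\circ_0(\mathbb F^2)$ be an optimal pair, with $(\hat V^{*,1}_t)$ and $(\hat V^{*,2}_t)$ the associated optional semi-martingales. Define $$Y^1_t=\hat V^{*,1}_t-{}^o\big(f_\cdot(1-\zeta^*_\cdot)\big)^{\mathbb F^1}_t-{}^o\big(h_\cdot\Delta\zeta^*_\cdot\big)^{\mathbb F^1}_t,\qquad Y^2_t=\hat V^{*,2}_t-{}^o\big(g_\cdot(1-\xi^*_\cdot)\big)^{\mathbb F^2}_t-{}^o\big(h_\cdot\Delta\xi^*_\cdot\big)^{\mathbb F^2}_t .$$ Then: (i) $\mathsf P\big(Y^1_t\le0\text{ and }Y^2_t\ge0\text{ for all }t\in[0,T]\big)=1$. (ii) $\mathsf P$-a.s., $$\int_{[0,T]}Y^1_t\,d\xi^*_t=0\quad\text{and}\quad\int_{[0,T]}Y^2_t\,d\zeta^*_t=0,$$ or, equivalently, $$\int_{[0,T]}\mathbf 1_{\{Y^1_t<0\}}\,d\xi^*_t=0\quad\text{and}\quad\int_{[0,T]}\mathbf 1_{\{Y^2_t>0\}}\,d\zeta^*_t=0.$$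
   Context: Let $T\in(0,\infty)$ and let $(\Omega,\mathcal F,\mathsf P)$ be a complete probability space with a right-continuous filtration $\mathbb F=(\mathcal F_t)_{t\in[0,T]}$ completed with $\mathsf P$-null sets, $\mathcal F_T\subsetneq\mathcal F$. Right-continuous filtrations $\mathbb F^i=(\mathcal F^i_t)_{t\in[0,T]}$, $i=1,2$, completed with null sets, satisfy $\mathcal F^1_t\vee\mathcal F^2_t\subseteq\mathcal F_t$. $\mathcal L_b(\mathsf P)$ is the space of càdlàg $\mathcal B([0,T])\times\mathcal F$-measurable $X$ with $\mathsf E[\sup_{0\le t\le T}|X_t|]<\infty$. The payoff processes $f,g,h\in\mathcal L_b(\mathsf P)$ are $\mathbb F$-adapted with $f_t\ge h_t\ge g_t$ for all $t\in[0,T]$ a.s. For a filtration $\mathbb G\subseteq\mathbb F$ and a $\mathbb G$-stopping time $\theta\in[0,T]$: $\mathcal T_\theta(\mathbb G)$ is the set of $\mathbb G$-stopping times with values in $[\theta,T]$; $\mathcal A^\circ_\theta(\mathbb G)$ is the set of $\mathbb G$-adapted càdlàg non-decreasing $\rho$ with $\rho_{\theta-}=0$, $\rho_T=1$ (for $\theta=0$, $\rho_{0-}:=0$, so $d\rho$ may charge $\{0\}$); $\Delta\rho_t=\rho_t-\rho_{t-}$. The $\mathbb G$-randomised stopping time generated by $\rho\in\mathcal A^\circ_\theta(\mathbb G)$ is $\eta=\inf\{t\in[0,T]:\rho_t>Z\}$ with $Z\sim U([0,1])$ independent of $\mathcal F_T$; the class of these is $\mathcal T^R_\theta(\mathbb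 G)$. The randomisation devices $Z$ of the two players are independent. Game: $\mathcal P(\tau,\sigma)=f_\tau\mathbf 1_{\{\tau<\sigma\}}+h_\tau\mathbf 1_{\{\tau=\sigma\}}+g_\sigma\mathbf 1_{\{\sigma<\tau\}}$; Player 1 picks $\tau\in\mathcal T^R_0(\mathbb F^1)$ to minimise, Player 2 picks $\sigma\in\mathcal T^R_0(\mathbb F^2)$ to maximise $\mathsf E[\mathcal P(\tau,\sigma)]$. A pair $(\xi^*,\zeta^* )\in\mathcal A^\circ_0(\mathbb F^1)\times\mathcal A^\circ_0(\mathbb F^2)$ is optimal if it generates a saddle point $(\tau_*,\sigma_* )$: $\mathsf E[\mathcal P(\tau_*,\sigma)]\le\mathsf E[\mathcal P(\tau_*,\sigma_* )]\le\mathsf E[\mathcal P(\tau,\sigma_* )]$ for all $(\tau,\sigma)\in\mathcal T^R_0(\mathbb F^1)\times\mathcal T^R_0(\mathbb F^2)$. $(\hat V^{*,1}_t)$ and $(\hat V^{*,2}_t)$ are the (unique up to indistinguishability) $\mathbb F^1$-optional, respectively $\mathbb F^2$-optional, semi-martingales (not necessarily càdlàg) such that for all $\theta\in\mathcal T_0(\mathbb F^1)$, $\gamma\in\mathcal T_0(\mathbb F^2)$, a.s., $$\hat V^{*,1}_\theta=\operatorname*{ess\,inf}_{\tau\in\mathcal T_\theta(\mathbb F^1)}\mathsf E\Big[f_\tau(1-\zeta^*_\tau)+\int_{[\theta,\tau)}g_u\,d\zeta^*_u+h_\tau\Delta\zeta^*_\tau\Big|\mathcal F^1_\theta\Big],$$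 $$\hat V^{*,2}_\gamma=\operatorname*{ess\,sup}_{\sigma\in\mathcal T_\gamma(\mathbb F^2)}\mathsf E\Big[g_\sigma(1-\xi^*_\sigma)+\int_{[\gamma,\sigma)}f_u\,d\xi^*_u+h_\sigma\Delta\xi^*_\sigma\Big|\mathcal F^2_\gamma\Big]$$ (their existence is a known fact here). ${}^o(X)^{\mathbb G}$ denotes the $\mathbb G$-optional projection of a measurable process $X$ under $\mathsf P$: the unique $\mathbb G$-optional process with ${}^o(X)^{\mathbb G}_\tau=\mathsf E[X_\tau|\mathcal G_\tau]$ a.s. for all $\tau\in\mathcal T_0(\mathbb G)$. *)

(* Defs.v *)
From HB Require Import structures.
From mathcomp Require Import all_boot all_order all_algebra.
From mathcomp Require Import all_classical all_reals all_analysis.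

Set Implicit Arguments.
Unset Strict Implicit.
Unset Printing Implicit Defensive.
Import Order.TTheory GRing.Theory Num.Theory.
Import numFieldNormedType.Exports.

Local Open Scope classical_set_scope.
Local Open Scope ring_scope.

(* A process is a map X : R -> Omega -> R, (t, w) |-> X t w, and a filtration
   is a map G : R -> set (set Omega); only their values at times t in [0, T]
   are ever used. *)

Section paths.
Context {R : realType} (T : R).

Definition cadlag_path (x : R -> R) : Prop :=
  (forall t, 0 <= t < T -> x s @[s --> t^'+] --> x t) /\
  (forall t, 0 < t <= T -> cvg (x s @[s --> t^'-])).

(* Paths of the generating processes: cadlag and non-decreasing on [0, T] with
   x_{0-} = 0 and x_T = 1. Since x_{0-} = 0 by convention, monotonicity at 0-
   amounts to 0 <= x_0. *)
Record gen_path := GenPath {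
  gen_path_fun :> R -> R;
  gen_path_cadlag : cadlag_path gen_path_fun;
  gen_path_nd :
    forall s t, 0 <= s -> s <= t -> t <= T -> gen_path_fun s <= gen_path_fun t;
  gen_path_ge0 : 0 <= gen_path_fun 0;
  gen_path_T : gen_path_fun T = 1
}.

(* Extension to the real line by 0 before time 0 and by 1 after time T. Its
   Stieltjes measure has an atom of mass x_0 at 0, i.e. it is dx with
   x_{0-} = 0, and it is carried by [0, T]. *)
Definition extend (x : gen_path) (t : R) : R :=
  if t < 0 then 0 else if T <= t then 1 else x t.

Lemma extend_nd (x : gen_path) : nondecreasing (extend x).
Proof.
move=> s t st; rewrite /extend.
have x_ge0 u : 0 <= u -> u <= T -> 0 <= x u.
  by move=> u0 uT; apply: le_trans (gen_path_ge0 x) (gen_path_nd x _ u0 uT).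
have x_le1 u : 0 <= u -> u <= T -> x u <= 1.
  by move=> u0 uT; rewrite -(gen_path_T x); exact: gen_path_nd.
case: (ltP s 0) => s0.
  by case: (ltP t 0) => t0 //; case: (leP T t) => tT //; rewrite x_ge0// ltW.
rewrite ltNge (le_trans s0 st)/=.
case: (leP T s) => sT; first by rewrite (le_trans sT st).
case: (leP T t) => tT; first by rewrite x_le1// ltW.
by rewrite gen_path_nd// ltW.
Qed.

Lemma extend_rc (x : gen_path) (t : R) : extend x @ t^'+ --> extend x t.
Proof.
rewrite {2}/extend; case: (ltP t 0) => t0.
  apply: cvg_near_cst; near=> s; rewrite /extend.
  have -> // : s < 0.
  by near: s; exact: nbhs_right_lt.
case: (leP T t) => tT.
  apply: cvg_near_cst; near=> s; rewrite /extend.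
  have ts : t < s by near: s; exact: nbhs_right_gt.
  by rewrite ltNge (le_trans t0 (ltW ts))/= (le_trans tT (ltW ts)).
have xt : x s @[s --> t^'+] --> x t.
  by have [+ _] := gen_path_cadlag x; apply; rewrite t0 tT.
apply: cvg_trans xt; apply: near_eq_cvg; near=> s; rewrite /extend.
have ts : t < s by near: s; exact: nbhs_right_gt.
have sT : s < T by near: s; exact: nbhs_right_lt.
by rewrite ltNge (le_trans t0 (ltW ts))/= leNgt sT.
Unshelve. all: by end_near. Qed.

HB.instance Definition _ (x : gen_path) :=
  isCumulative.Build R _ R (extend x) (@extend_nd x) (@extend_rc x).

Definition stieltjes (x : gen_path) := lebesgue_stieltjes_measure (extend x).

(* x_t - x_{t-}, with x_{0-} = 0. *)
Definition jump (x : gen_path) (t : R) : R :=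
  extend x t - lim (extend x s @[s --> t^'-]).

End paths.

Section processes.
Context {R : realType} (T : R) {d : measure_display} {Omega : measurableType d}
  (P : probability Omega R).
Implicit Types (G : R -> set_system Omega) (S : set_system Omega).

(* Right-continuous filtration of sub-sigma-algebras, completed with the
   P-null sets. *)
Definition filtration G : Prop :=
  [/\ forall t, 0 <= t <= T -> sigma_algebra setT (G t) /\ G t `<=` measurable,
      forall s t, 0 <= s -> s <= t -> t <= T -> G s `<=` G t,
      forall t, 0 <= t < T -> \bigcap_(s in `]t, T]) G s = G t &
      forall t N, 0 <= t <= T -> P.-negligible N -> G t N].

Definition sub_measurable S (X : Omega -> R) : Prop :=
  forall B, measurable B -> S (X @^-1` B).

Definition adapted G (X : R -> Omega -> R) : Prop :=
  forall t, 0 <= t <= T -> sub_measurable (G t) (X t).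

Definition cadlag (X : R -> Omega -> R) : Prop :=
  forall w, cadlag_path T (X ^~ w).

Definition Lb (X : R -> Omega -> R) : Prop :=
  [/\ cadlag X,
      measurable_fun (`[0, T] `*` setT) (fun p : R * Omega => X p.1 p.2) &
      (\int[P]_w ereal_sup [set `|X t w|%:E | t in `[0%R, T]] < +oo)%E].

Definition stopping_time G (tau : Omega -> R) : Prop :=
  (forall w, 0 <= tau w <= T) /\
  (forall t, 0 <= t <= T -> G t [set w | tau w <= t]).

Definition stopping_time_from G (theta tau : Omega -> R) : Prop :=
  stopping_time G tau /\ forall w, theta w <= tau w.

Definition stopped_sigma G (theta : Omega -> R) : set_system Omega :=
  [set A | forall t, 0 <= t <= T -> G t (A `&` [set w | theta w <= t])].

(* Y is a version of E[X | S]. *)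
Definition is_cond_exp S (X Y : Omega -> R) : Prop :=
  [/\ sub_measurable S Y, P.-integrable setT (EFin \o Y) &
      forall A, S A -> (\int[P]_(w in A) (Y w)%:E = \int[P]_(w in A) (X w)%:E)%E].

Definition is_ess_inf (C : set (Omega -> R)) (V : Omega -> R) : Prop :=
  [/\ measurable_fun setT V,
      forall X, C X -> {ae P, forall w, V w <= X w} &
      forall W : Omega -> R, measurable_fun setT W ->
        (forall X, C X -> {ae P, forall w, W w <= X w}) ->
        {ae P, forall w, W w <= V w}].

Definition is_ess_sup (C : set (Omega -> R)) (V : Omega -> R) : Prop :=
  [/\ measurable_fun setT V,
      forall X, C X -> {ae P, forall w, X w <= V w} &
      forall W : Omega -> R, measurable_fun setT W ->
        (forall X, C X -> {ae P, forall w, X w <= W w}) ->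
        {ae P, forall w, V w <= W w}].

(* The optional sigma-algebra is the one on [0, T] x Omega generated by the
   cadlag G-adapted processes. *)
Definition optional_sigma G : set_system (R * Omega) :=
  <<s `[0, T] `*` setT, [set A | exists X B,
     [/\ cadlag X, adapted G X, measurable B &
         A = (`[0, T] `*` setT) `&` [set p | B (X p.1 p.2)]]] >>.

Definition optional G (X : R -> Omega -> R) : Prop :=
  forall B, measurable B ->
    optional_sigma G ((`[0, T] `*` setT) `&` [set p | B (X p.1 p.2)]).

Definition is_optional_projection G (X oX : R -> Omega -> R) : Prop :=
  optional G oX /\
  forall tau, stopping_time G tau ->
    is_cond_exp (stopped_sigma G tau)
      (fun w => X (tau w) w) (fun w => oX (tau w) w).

Definition martingale G (M : R -> Omega -> R) : Prop :=
  [/\ adapted G M,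
      forall t, 0 <= t <= T -> P.-integrable setT (EFin \o M t) &
      forall s t, 0 <= s -> s <= t -> t <= T -> is_cond_exp (G s) (M t) (M s)].

Definition local_martingale G (M : R -> Omega -> R) : Prop :=
  [/\ cadlag M, adapted G M &
      exists tau : nat -> Omega -> R,
        [/\ forall n, stopping_time G (tau n),
            forall n w, tau n w <= tau n.+1 w,
            {ae P, forall w, exists n, tau n w = T} &
            forall n, martingale G (fun t w => M (Num.min t (tau n w)) w)]].

(* V = V_0 + M + A with M a local martingale and A adapted of finite variation.
   A, hence V, need not be cadlag. *)
Definition optional_semimartingale G (V : R -> Omega -> R) : Prop :=
  optional G V /\
  exists M A : R -> Omega -> R,
    [/\ local_martingale G M, adapted G A,
        forall w, bounded_variation 0 T (A ^~ w),
        forall w, M 0 w = 0 /\ A 0 w = 0 &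
        {ae P, forall w, forall t, 0 <= t <= T ->
           V t w = V 0 w + M t w + A t w}].

Definition generating G (rho : Omega -> gen_path T) : Prop :=
  adapted G (fun t w => rho w t).

(* inf {t in [0, T] | rho_t > Z}. The point T is added so that the infimum is T
   and not 0 on the null event {Z >= 1}, where no t satisfies rho_t > Z. *)
Definition rand_time (rho : Omega -> gen_path T) (Z : Omega -> R) : Omega -> R :=
  fun w => inf ([set t | 0 <= t <= T /\ Z w < rho w t] `|` [set T]).

Definition randomised_time G (Z : Omega -> R) (eta : Omega -> R) : Prop :=
  exists2 rho, generating G rho & eta = rand_time rho Z.

Definition uniform01 (Z : {RV P >-> R}) : Prop :=
  forall B, measurable B -> distribution P Z B = uniform_prob (@ltr01 R) B.

(* Z1 and Z2 are uniform on [0, 1], and S, Z1, Z2 are mutually independent. *)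
Definition devices S (Z1 Z2 : {RV P >-> R}) : Prop :=
  [/\ uniform01 Z1, uniform01 Z2 &
      forall A B1 B2, S A -> measurable B1 -> measurable B2 ->
        (P (A `&` Z1 @^-1` B1 `&` Z2 @^-1` B2) =
         P A * P (Z1 @^-1` B1) * P (Z2 @^-1` B2))%E].

Definition game_payoff (f g h : R -> Omega -> R) (tau sigma : Omega -> R)
    (w : Omega) : R :=
  if tau w < sigma w then f (tau w) w
  else if tau w == sigma w then h (tau w) w
  else g (sigma w) w.

(* (xi, zeta) generates a saddle point of the game in which the first player
   minimises over randomised F1-stopping times and the second one maximises
   over randomised F2-stopping times. A deviating player may use any device
   that is independent of F_T and of the device of the opponent. *)
Definition optimal_pair (F F1 F2 : R -> set_system Omega)
    (f g h : R -> Omega -> R) (xi zeta : Omega -> gen_path T) : Prop :=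
  [/\ generating F1 xi, generating F2 zeta &
      exists Z1 Z2 : {RV P >-> R},
        let tau_s := rand_time xi Z1 in
        let sigma_s := rand_time zeta Z2 in
        [/\ devices (F T) Z1 Z2,
            forall (Z : {RV P >-> R}) sigma,
              devices (F T) Z1 Z -> randomised_time F2 Z sigma ->
              ('E_P[game_payoff f g h tau_s sigma] <=
               'E_P[game_payoff f g h tau_s sigma_s])%E &
            forall (Z : {RV P >-> R}) tau,
              devices (F T) Z Z2 -> randomised_time F1 Z tau ->
              ('E_P[game_payoff f g h tau_s sigma_s] <=
               'E_P[game_payoff f g h tau sigma_s])%E]].

Definition stop_payoff (a b h : R -> Omega -> R) (rho : Omega -> gen_path T)
    (theta tau : Omega -> R) (w : Omega) : R :=
  a (tau w) w * (1 - rho w (tau w))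
  + \int[stieltjes (rho w)]_(u in `[theta w, tau w[) b u w
  + h (tau w) w * jump (rho w) (tau w).

(* All versions of the conditional expectations of stop_payoff given G_theta, tau
   ranging over the G-stopping times with values in [theta, T]. *)
Definition cond_payoffs G (a b h : R -> Omega -> R)
    (rho : Omega -> gen_path T) (theta : Omega -> R) : set (Omega -> R) :=
  [set X | exists2 tau, stopping_time_from G theta tau &
     is_cond_exp (stopped_sigma G theta) (stop_payoff a b h rho theta tau) X].

Definition ess_inf_value G (a b h : R -> Omega -> R)
    (rho : Omega -> gen_path T) (V : R -> Omega -> R) : Prop :=
  optional_semimartingale G V /\
  forall theta, stopping_time G theta ->
    is_ess_inf (cond_payoffs G a b h rho theta) (fun w => V (theta w) w).

Definition ess_sup_value G (a b h : R -> Omega -> R)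
    (rho : Omega -> gen_path T) (V : R -> Omega -> R) : Prop :=
  optional_semimartingale G V /\
  forall gamma, stopping_time G gamma ->
    is_ess_sup (cond_payoffs G a b h rho gamma) (fun w => V (gamma w) w).

End processes.

(* Main.v *)
(* Stopping at tau = theta in the definition of V^{*,1} gives Y^1_theta <= 0 a.s.
   for every stopping time theta, and the optional section theorem upgrades this
   to Y^1 <= 0 outside an evanescent set. The section theorem is obtained from a
   measurable selection (a random branch of a Souslin scheme, chosen along
   measurable hulls of projections), an inner approximation of optional sets by
   right-open adapted sets along the graph of the selected time, and a stopping
   time of maximal mean below the debut of that approximation.

   The measure d xi^* is the law, for uniform z, of the quantile times
   tau_z = inf {t : xi^*_t > z}, which are stopping times. The payoff of
   (tau_*, sigma_* ) is the average over z of the payoffs J(tau_z), while J >= v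
   for every stopping time by the saddle property, so J(tau_z) = v for a.e. z. If
   Y^1_{tau_z} < 0 with positive probability, then pasting a better continuation
   on a suitable event of F^1_{tau_z} would give a stopping time with J < v. Hence
   Y^1_{tau_z} = 0 a.s. for a.e. z, and by Fubini Y^1 = 0 d xi^*-a.e.

   Player 2 is Player 1 for the payoffs (-g, -f, -h). *)
Require Import Defs.
From HB Require Import structures.
From mathcomp Require Import all_boot all_order all_algebra.
From mathcomp Require Import all_classical all_reals all_analysis.
From mathcomp Require Import measurable_realfun.
From mathcomp Require Import ring lra.

Import Order.TTheory GRing.Theory Num.Theory.
Import numFieldNormedType.Exports.
Local Open Scope classical_set_scope.
Local Open Scope ring_scope.

Set Implicit Arguments.
Unset Strict Implicit.
Unset Printing Implicit Defensive.

(** * Measurable sections *)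

(** The null set where Y^1 at theta fails to be nonpositive depends on theta, and V^{*,1} is only
    optional, with no path regularity that would reduce all times to countably many; this is why (i)
    calls for a section theorem. Projections to Omega are handled through minimal measurable hulls
    instead of capacities, and a selection over an event of positive probability is enough, since
    the optional section theorem is proved by contradiction. Part (ii) treats the times tau_z one at
    a time and does not rest on (i): the outcome is that the set where Y^1 is nonzero is null for d
    xi^*, and both forms of (ii) follow from it. Devices are independent of F_T only, so whatever is
    integrated against a device must be F_T-measurable in the outcome; payoffs are therefore studied
    on Omega equipped with F_T. The saddle property speaks of randomised times, and a stopping time
    tau enters it through the path t -> 1_{tau <= t}. *)

Section measurable_section.
Context {R : realType} {d : measure_display} {Omega : measurableType d}
  (P : probability Omega R).
Implicit Types (A H : set Omega) (B : set (R * Omega)).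

(** Intersecting near-minimisers of the outer measure attains the infimum. Cutting the result by a
    competing superset [H'] leaves a measurable superset, so no mass can be lost. *)
Lemma measurable_hull A : exists H, [/\ measurable H, A `<=` H &
  forall H', measurable H' -> A `<=` H' -> P (H `\` H') = 0%E].
Proof.
pose E := [set fine (P H) | H in [set H | measurable H /\ A `<=` H]].
have Pfin H : measurable H -> P H \is a fin_num by move=> mH; exact: fin_num_measure.
have hE : has_inf E.
  split; first by exists (fine (P setT)), setT.
  by exists 0 => _ [H [mH _] <-]; rewrite fine_ge0.
have approx n : exists H, [/\ measurable H, A `<=` H &
    fine (P H) < inf E + n.+1%:R^-1].
  have n0 : 0 < n.+1%:R^-1 :> R by rewrite invr_gt0.
  by have [_ [H [mH AH] <-] HE] := inf_adherent n0 hE; exists H.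
have [h hP] := choice approx.
exists (\bigcap_n h n); split.
- by apply: bigcapT_measurable => n; have [] := hP n.
- by move=> w Aw n _; have [_ + _] := hP n; apply.
have mh : measurable (\bigcap_n h n).
  by apply: bigcapT_measurable => n; have [] := hP n.
move=> H' mH' AH'; apply/eqP; rewrite eq_le measure_ge0 andbT.
rewrite -[leLHS]fineK ?Pfin//; last exact: measurableD.
rewrite lee_fin; apply/ler_addgt0Pr => e e0; rewrite add0r.
have [n ne] : exists n, n.+1%:R^-1 < e.
  by exists (Num.truncn e^-1); rewrite invf_plt ?posrE// truncnS_gt.
have [mn An nE] := hP n.
have le1 : fine (P (\bigcap_n h n)) <= fine (P (h n)).
  rewrite fine_le ?Pfin// le_measure ?inE//.
  by move=> w; apply.
have inf_le : inf E <= fine (P (\bigcap_n h n `&` H')).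
  apply: ge_inf; first by case: hE.
  exists (\bigcap_n h n `&` H') => //; split; first exact: measurableI.
  by move=> w Aw; split; [move=> k _; have [_ + _] := hP k; apply|exact: AH'].
have -> : P (\bigcap_n h n `\` H') =
    (P (\bigcap_n h n) - P (\bigcap_n h n `&` H'))%E.
  by apply: measureD => //; rewrite ltey_eq Pfin.
rewrite fineB ?Pfin//; last exact: measurableI.
rewrite lerBlDr; apply: le_trans le1 _; apply: ltW; apply: lt_le_trans nE _.
by rewrite addrC lerD// ltW.
Qed.

(** Time intervals are compact, so that pairwise intersecting ones have a common point, the supremum
    of their left endpoints. *)
Definition rect : Type := (R * R * set Omega)%type.

Definition in_rect (r : rect) (p : R * Omega) : Prop :=
  r.1.1 <= p.1 <= r.1.2 /\ r.2 p.2.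

Definition agree N (s s' : nat -> nat) := forall i, (i < N)%N -> s i = s' i.

(* [K] is the continuous version of a Souslin scheme: the [n]-th rectangle is
   determined by finitely many terms of the branch. *)
Definition souslin_scheme (K : nat -> (nat -> nat) -> rect) : Prop :=
  (forall n s, measurable (K n s).2) /\
  (forall n s, exists N, forall s', agree N s s' -> K n s' = K n s).

Definition souslin_of (K : nat -> (nat -> nat) -> rect) : set (R * Omega) :=
  [set p | exists s, forall n, in_rect (K n s) p].

Definition souslin B := exists2 K, souslin_scheme K & B = souslin_of K.

Lemma souslin_rect (a b : R) H : measurable H ->
  souslin (`[a, b] `*` H).
Proof.
move=> mH; exists (fun _ _ => (a, b, H)).
  by split => // n s; exists 0%N.
apply/seteqP; split => -[t w] /=; rewrite in_itv/=.
  by move=> [abt Hw]; exists (fun=> 0%N).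
by move=> [_ /(_ 0%N)[]].
Qed.

(** The first term of a branch chooses [i]; the remaining terms are a branch of the [i]-th
    scheme. *)
Lemma souslin_bigcup (B : (set (R * Omega))^nat) :
  (forall i, souslin (B i)) -> souslin (\bigcup_i B i).
Proof.
move=> /(_ _)/cid2 sB; pose K i := sval (sB i).
have KP i : souslin_scheme (K i) /\ B i = souslin_of (K i).
  by rewrite /K; case: (sB i).
exists (fun n s => K (s 0%N) n (fun j => s j.+1)).
  split=> n s; first by have [[+ _] _] := KP (s 0%N); exact.
  have [[_ /(_ n (fun j => s j.+1))[N NP]] _] := KP (s 0%N).
  exists N.+1 => s' ss'; rewrite -(ss' 0%N)//.
  by apply: NP => i iN; exact: ss'.
apply/seteqP; split=> p.
  move=> [i _]; rewrite (KP i).2 => -[s sp].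
  by exists (fun n => if n is j.+1 then s j else i).
by move=> [s sp]; exists (s 0%N) => //; rewrite (KP _).2; exists (fun j => s j.+1).
Qed.

(** The default makes numbers that decode to nothing repeat the condition of the pair (0, 0). *)
Let unpair n : nat * nat := odflt (0%N, 0%N) (unpickle n).

Let unpairK p : unpair (pickle p) = p.
Proof. by rewrite /unpair pickleK. Qed.

(** One sequence codes a branch for every [i]; the rectangle at the code of [(i, m)] is the [m]-th
    one of the [i]-th scheme. *)
Lemma souslin_bigcap (B : (set (R * Omega))^nat) :
  (forall i, souslin (B i)) -> souslin (\bigcap_i B i).
Proof.
move=> /(_ _)/cid2 sB; pose K i := sval (sB i).
have KP i : souslin_scheme (K i) /\ B i = souslin_of (K i).
  by rewrite /K; case: (sB i).
pose br (s : nat -> nat) (i j : nat) := s (pickle (i, j)).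
exists (fun n s => K (unpair n).1 (unpair n).2 (br s (unpair n).1)).
  split=> n s; first by have [[+ _] _] := KP (unpair n).1; exact.
  case: (unpair n) => i m /=; have [[_ /(_ m (br s i))[N NP]] _] := KP i.
  (* This bound exceeds the positions at which [s] stores the first [N] terms of its [i]-th
     branch. *)
  exists (\max_(j < N) (pickle (i, nat_of_ord j)).+1)%N => s' ss'.
  apply: NP => j jN; apply: ss'.
  exact: (@leq_bigmax _ (fun j : 'I_N => (pickle (i, nat_of_ord j)).+1)
    (Ordinal jN)).
apply/seteqP; split=> p.
  move=> Bp.
  have /choice[s sP] : forall i, exists s, forall n, in_rect (K i n s) p.
    by move=> i; have := Bp i Logic.I; rewrite (KP i).2.
  exists (fun n => s (unpair n).1 (unpair n).2) => n.
  case: (unpair n) => i m /=.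
  rewrite (_ : br _ _ = s i)//; apply/funext => j; by rewrite /br unpairK.
move=> [s sp] i _; rewrite (KP i).2; exists (br s i) => n.
by have := sp (pickle (i, n)); rewrite unpairK.
Qed.

Lemma souslinU B B' : souslin B -> souslin B' -> souslin (B `|` B').
Proof.
move=> sB sB'; rewrite -bigcup2E.
have s0 : souslin set0.
  by rewrite -(setX0 _ (`[0, 0]%classic : set R)); exact: souslin_rect.
by apply: souslin_bigcup => -[|[|i]].
Qed.

Lemma souslinI B B' : souslin B -> souslin B' -> souslin (B `&` B').
Proof.
move=> sB sB'; rewrite (_ : B `&` B' = \bigcap_i (if i is 0%N then B else B')).
  by apply: souslin_bigcap => -[|i].
apply/seteqP; split=> p; first by move=> [Bp B'p] [|i].
by move=> Bp; split; [exact: (Bp 0%N)|exact: (Bp 1%N)].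
Qed.

Lemma souslin_strip H : measurable H -> souslin (setT `*` H).
Proof.
move=> mH; rewrite (_ : _ `*` H = \bigcup_n (`[- n%:R, n%:R] `*` H)).
  by apply: souslin_bigcup => n; exact: souslin_rect.
apply/seteqP; split=> -[t w] /=; last by move=> [n _ [_ Hw]].
move=> [_ Hw]; exists (Num.truncn `|t|).+1 => //=; split=> //.
by rewrite in_itv/= -ler_norml ltW// truncnS_gt.
Qed.

Lemma souslin_ray (x : R) :
  souslin (`[x, +oo[ `*` setT) /\ souslin ((~` `[x, +oo[) `*` setT).
Proof.
split.
  rewrite (_ : _ `*` _ = \bigcup_n (`[x, x + n%:R] `*` setT)).
    by apply: souslin_bigcup => n; exact: souslin_rect.
  apply/seteqP; split=> -[t w] /=; rewrite in_itv/= andbT; last first.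
    by move=> [n _ /= [+ _]]; rewrite in_itv/= => /andP[].
  move=> [xt _]; exists (Num.truncn (t - x)).+1 => //=; split=> //.
  by rewrite in_itv/= xt -lerBlDl ltW// truncnS_gt.
rewrite setCitvr (_ : _ `*` _ =
  \bigcup_n (`[x - n.+1%:R, x - n.+1%:R^-1] `*` setT)).
  by apply: souslin_bigcup => n; exact: souslin_rect.
apply/seteqP; split=> -[t w] /=; rewrite in_itv/=; last first.
  move=> [n _ /= [+ _]]; rewrite in_itv/= => /andP[_ tx]; split => //.
  by apply: le_lt_trans tx _; rewrite gtrBl invr_gt0.
move=> [tx _]; have xt0 : 0 < x - t by rewrite subr_gt0.
(* [n.+1] must exceed both [x - t] and its inverse. *)
exists (Num.truncn (x - t) + Num.truncn (x - t)^-1)%N => //=; split => //.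
rewrite in_itv/=; apply/andP; split.
  rewrite lerBlDl -lerBlDr ltW//; apply: lt_le_trans (truncnS_gt _) _.
  by rewrite ler_nat ltnS leq_addr.
rewrite lerBrDl -lerBrDr -[leRHS]invrK lef_pV2 ?posrE ?invr_gt0//.
apply: ltW; apply: lt_le_trans (truncnS_gt _) _.
by rewrite ler_nat ltnS leq_addl.
Qed.

Lemma measurable_souslin B : measurable B -> souslin B.
Proof.
(* Souslin sets are not stable under complements; those whose complement is Souslin too form a
   sigma-algebra. *)
suff : measurable `<=` [set B | souslin B /\ souslin (~` B)].
  by move=> /(_ B) mB /mB[].
have s0 : souslin set0.
  by rewrite -(setX0 _ (`[0, 0]%classic : set R)); exact: souslin_rect.
have sT : souslin setT by rewrite -setXTT; exact: souslin_strip.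
have sA : (@measurable _ (measurableTypeR R)) `<=`
    [set A | souslin (A `*` setT) /\ souslin ((~` A) `*` setT)].
  rewrite RGenCInfty.measurableE; apply: smallest_sub.
    split=> /=.
    - by rewrite set0X setC0 setXTT.
    - by move=> A [sA sCA]; rewrite setTD setCK.
    - move=> A sA; rewrite setX_bigcupl; split.
        by apply: souslin_bigcup => i; exact: (sA i).1.
      rewrite setC_bigcup (_ : _ `*` _ = \bigcap_i ((~` A i) `*` setT)).
        by apply: souslin_bigcap => i; exact: (sA i).2.
      apply/seteqP; split=> -[t w] /=; first by move=> [At _] i _; split; [exact: At|].
      by move=> At; split=> // i _; have [] := At i Logic.I.
  by move=> _ [x ->]; exact: souslin_ray.
rewrite measurable_prod_measurableType; apply: smallest_sub.
  split=> /=; first by rewrite setC0.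
  - by move=> A [sA' sCA]; rewrite setTD setCK.
  - move=> A sA'; split; first by apply: souslin_bigcup => i; exact: (sA' i).1.
    by rewrite setC_bigcup; apply: souslin_bigcap => i; exact: (sA' i).2.
move=> _ [A mA [H mH <-]] /=; have [sA1 sA2] := sA _ mA; split.
  rewrite (_ : A `*` H = (A `*` setT) `&` (setT `*` H)).
    by apply: souslinI => //; exact: souslin_strip.
  by apply/seteqP; split=> -[t w] /=; [move=> []|move=> [[? _] [_ ?]]].
rewrite (_ : ~` _ = (~` A `*` setT) `|` (setT `*` ~` H)).
  by apply: souslinU => //; apply: souslin_strip; exact: measurableC.
apply/seteqP; split=> -[t w] /=.
  by move=> /not_andP[]; [left|right].
by move=> [[At _]|[_ Hw]] [].
Qed.

(** The default 0 is never reached on the event [good] below, where the selection takes place. *)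
Definition first_nat (Q : nat -> Prop) : nat :=
  if pselect (exists n, `[< Q n >]) is left h then ex_minn h else 0%N.

Lemma first_natP (Q : nat -> Prop) : (exists n, Q n) -> Q (first_nat Q).
Proof.
move=> [n Qn]; rewrite /first_nat; case: pselect => [h|[]]; last first.
  by exists n; apply/asboolP.
by case: ex_minnP => m /asboolP.
Qed.

Lemma measurable_first_nat (A : nat -> set Omega) k :
  (forall i, measurable (A i)) ->
  measurable [set w | first_nat (fun i => A i w) = k].
Proof.
move=> mA; rewrite (_ : [set w | _] =
  (A k `&` \bigcap_(j in [set j | (j < k)%N]) ~` A j) `|`
  (if k == 0%N then ~` \bigcup_i A i else set0)).
  apply: measurableU.
    apply: measurableI => //; apply: bigcap_measurableType => j _.
    exact: measurableC.
  by case: ifP => // _; apply/measurableC/bigcupT_measurable.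
apply/seteqP; split => w /=; rewrite /first_nat; case: pselect => [h|nh].
- case: ex_minnP => m /asboolP Am mmin <-; left; split => // j /= jm Aj.
  by have := mmin j; rewrite leqNgt jm => /(_ (asboolT Aj)).
- by move=> <-; right => -[i _ Ai]; apply: nh; exists i; apply/asboolP.
- case=> [[Ak kmin]|]; last first.
    case: ifP => // _ nA; case: nA; have [i /asboolP Ai] := h.
    by exists i.
  case: ex_minnP => m /asboolP Am mmin; apply/eqP; rewrite eqn_leq.
  rewrite mmin ?andTb; last exact/asboolP.
  by rewrite leqNgt; apply/negP => mk; exact: (kmin m mk).
- case=> [[Ak _]|]; last by case: eqP.
  by case: nh; exists k; apply/asboolP.
Qed.

(** * Selection along a random branch of a Souslin scheme *)

Section selection.
Variable K : nat -> (nat -> nat) -> rect.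
Hypothesis KS : souslin_scheme K.

Let proj B : set Omega := [set w | exists t, B (t, w)].

Let through (s : seq nat) : set (R * Omega) :=
  [set p | exists2 b, mkseq b (size s) = s & forall n, in_rect (K n b) p].

(** The [n]-th rectangle is then common to all branches extending [s], and [s] padded with zeros is
    one of them. *)
Let determined n (s : seq nat) :=
  forall b, mkseq b (size s) = s -> K n b = K n (nth 0%N s).

Let base (s : seq nat) : set Omega :=
  \bigcap_n [set w | determined n s -> (K n (nth 0%N s)).2 w].

Let measurable_base s : measurable (base s).
Proof.
apply: bigcapT_measurable => n; have [detn|ndetn] := pselect (determined n s).
  rewrite (_ : [set w | _] = (K n (nth 0%N s)).2); first exact: KS.1.
  by apply/seteqP; split => [w /= h|w h _] //; exact: h.
rewrite (_ : [set w | _] = setT); first exact: measurableT.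
by apply/seteqP; split => w _ //= /ndetn.
Qed.

(* A hull of the projection of [through s], cut down to [base s] so that its
   points lie in all the rectangles which [s] already determines. *)
Let tree_spec s H := [/\ measurable H, proj (through s) `<=` H, H `<=` base s,
  H !=set0 -> through s !=set0 &
  forall H', measurable H' -> proj (through s) `<=` H' -> P (H `\` H') = 0%E].

Let tree_exists s : exists H, tree_spec s H.
Proof.
(* The hull must be empty when nothing passes through [s]: an outcome in [tree s] has to certify
   that some pair of a time and an outcome does. *)
have [ts|/set0P/negP/negPn/eqP ts0] := pselect (through s !=set0); last first.
  exists set0; split => //; last by move=> H' _ _; rewrite set0D measure0.
    by rewrite ts0 => w [].
  by move=> [].
have [H [mH sH minH]] := measurable_hull (proj (through s)).
exists (H `&` base s); split => //.
- exact: measurableI.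
- move=> w Aw; split; first exact: sH.
  move=> n _ detn; have [t [b bs bK]] := Aw; rewrite -(detn b bs).
  exact: (bK n).2.
- move=> H' mH' AH'; apply: (subset_measure0 _ _ _ (minH H' mH' AH')).
  + by apply: measurableD => //; exact: measurableI.
  + exact: measurableD.
  + by move=> w [[Hw _] nw].
Qed.

Let tree s := sval (cid (tree_exists s)).

Let treeP s : tree_spec s (tree s).
Proof. by rewrite /tree; case: cid. Qed.

(** Greedy descent: each node is followed by its least child whose hull contains [w]. *)
Fixpoint branch (w : Omega) (n : nat) : seq nat :=
  if n is m.+1 then
    rcons (branch w m) (first_nat (fun i => tree (rcons (branch w m) i) w))
  else [::].

Let size_branch w n : size (branch w n) = n.
Proof. by elim: n => //= n IH; rewrite size_rcons IH. Qed.

Let measurable_branch n s : measurable [set w | branch w n = s].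
Proof.
elim: n s => [|n IH] s /=.
  have [->|s0] := eqVneq s [::].
    by rewrite (_ : [set _ | _] = setT)//; apply/seteqP; split.
  rewrite (_ : [set _ | _] = set0)//.
  by apply/seteqP; split => //= w sE; rewrite -sE eqxx in s0.
case/lastP: s => [|s i].
  rewrite (_ : [set _ | _] = set0)//; apply/seteqP; split => //= w.
  by move=> /(congr1 size); rewrite size_rcons.
rewrite (_ : [set _ | _] = [set w | branch w n = s] `&`
    [set w | first_nat (fun i => tree (rcons s i) w) = i]).
  apply: measurableI => //; apply: (@measurable_first_nat (fun i => tree (rcons s i))).
  by move=> j; have [] := treeP (rcons s j).
apply/seteqP; split => w /=.
  by move=> /rcons_inj[-> ->].
by move=> [-> ->].
Qed.

Let limb (w : Omega) (n : nat) : nat := last 0%N (branch w n.+1).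

Let mkseq_limb w n : mkseq (limb w) n = branch w n.
Proof.
elim: n => // n IH; rewrite mkseqS IH /= /limb /=; congr rcons.
by rewrite last_rcons.
Qed.

Let agree_mkseq N b b' : mkseq b N = mkseq b' N -> agree N b b'.
Proof.
by move=> bb i iN; rewrite -(nth_mkseq 0%N b iN) bb nth_mkseq.
Qed.

(** By continuity of the scheme a finite prefix of the branch fixes the endpoint; there are
    countably many prefixes, each followed on a measurable event. *)
Let measurable_lo k : measurable_fun setT (fun w => (K k (limb w)).1.1).
Proof.
move=> _ Y mY; rewrite setTI.
pose C (s : seq nat) := forall b, mkseq b (size s) = s -> Y (K k b).1.1.
rewrite (_ : _ @^-1` Y = \bigcup_n \bigcup_m
    [set w | exists s, [/\ unpickle m = Some s, C s & branch w n = s]]).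
  apply: bigcupT_measurable => n; apply: bigcupT_measurable => m.
  case: (unpickle m : option (seq nat)) => [s|]; last first.
    by rewrite (_ : [set _ | _] = set0)//; apply/seteqP; split=> // w [s []].
  have [Cs|nCs] := pselect (C s); last first.
    rewrite (_ : [set _ | _] = set0)//; apply/seteqP; split=> // w [s' [[ss']]].
    by rewrite -ss'.
  rewrite (_ : [set _ | _] = [set w | branch w n = s])//.
  apply/seteqP; split => [w [s' [[<-]]]//|w bs]; by exists s.
apply/seteqP; split => w /=.
  move=> Yw; have [N NP] := KS.2 k (limb w).
  exists N => //; exists (pickle (branch w N)) => //; exists (branch w N).
  split => //; first by rewrite pickleK.
  move=> b; rewrite size_branch -mkseq_limb => bE.
  by rewrite NP// => i iN; apply/esym/(agree_mkseq bE).
move=> [n _ [m _ [s [_ Cs bs]]]]; apply: Cs.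
by rewrite -bs size_branch mkseq_limb.
Qed.

(* Hulls being minimal, off a null set every node above [w] has a child. *)
Let bad := \bigcup_n (tree (odflt [::] (unpickle n)) `\`
   \bigcup_i tree (rcons (odflt [::] (unpickle n)) i)).

Let measurable_bad : measurable bad.
Proof.
apply: bigcupT_measurable => n; apply: measurableD.
  by case: (treeP (odflt [::] (unpickle n))).
by apply: bigcupT_measurable => i; case: (treeP (rcons (odflt [::] (unpickle n)) i)).
Qed.

Let bad0 : P bad = 0%E.
Proof.
apply/negligibleP => //; apply: negligible_bigcup => n.
set s := odflt _ _; apply/negligibleP.
  apply: measurableD; first by case: (treeP s).
  by apply: bigcupT_measurable => i; case: (treeP (rcons s i)).
have [_ _ _ _] := treeP s; apply.
  by apply: bigcupT_measurable => i; case: (treeP (rcons s i)).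
move=> w [t [b bs bK]]; exists (b (size s)) => //.
have [_ + _ _ _] := treeP (rcons s (b (size s))); apply.
by exists t, b => //; rewrite size_rcons mkseqS bs.
Qed.

Let good := tree [::] `\` bad.

Let good_branch w n : good w -> tree (branch w n) w.
Proof.
move=> [tw nb]; elim: n => //= n IH.
apply: (@first_natP (fun i => tree (rcons (branch w n) i) w)).
apply: contrapT => nex; apply: nb.
exists (pickle (branch w n)) => //; rewrite pickleK/=; split => // -[i _ ti].
by apply: nex; exists i.
Qed.

Let good_determined w n : good w -> exists N, forall M, (N <= M)%N ->
  determined n (branch w M) /\ K n (nth 0%N (branch w M)) = K n (limb w).
Proof.
move=> gw; have [N NP] := KS.2 n (limb w); exists N => M NM.
have E : K n (nth 0%N (branch w M)) = K n (limb w).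
  apply: NP => i iN; rewrite -mkseq_limb nth_mkseq//.
  exact: leq_trans NM.
split=> // b; rewrite size_branch -mkseq_limb => bE.
rewrite mkseq_limb E; apply: NP => i iN; apply/esym/(agree_mkseq bE).
exact: leq_trans NM.
Qed.

Let good_base w n : good w -> (K n (limb w)).2 w.
Proof.
move=> gw; have [N NP] := good_determined n gw.
have [detN <-] := NP N (leqnn N).
by have [_ _ sub _ _] := treeP (branch w N); apply: (sub w (good_branch N gw) n).
Qed.

(** At a node long enough to fix both rectangles, [through] is non-empty. Its point may lie over an
    outcome other than [w], but its time is in both intervals, and at a fixed node the intervals do
    not depend on the outcome. *)
Let good_lohi w k l : good w -> (K k (limb w)).1.1 <= (K l (limb w)).1.2.
Proof.
move=> gw; have [N NP] := good_determined k gw.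
have [M MP] := good_determined l gw.
have [detN <-] := NP (maxn N M) (leq_maxl _ _).
have [detM <-] := MP (maxn N M) (leq_maxr _ _).
have [_ _ _ + _] := treeP (branch w (maxn N M)).
have hne : tree (branch w (maxn N M)) !=set0 by exists w; exact: good_branch.
move=> /(_ hne)[p [b bs bK]]; rewrite -(detN b bs) -(detM b bs).
have [/andP[+ _] _] := bK k; have [/andP[_ +] _] := bK l.
by move=> ? ?; apply: le_trans; eassumption.
Qed.

Lemma souslin_selection : ~ P.-negligible (proj (souslin_of K)) ->
  exists s : Omega -> R, measurable_fun setT s /\ exists H,
    [/\ measurable H, P H != 0%E & forall w, H w -> souslin_of K (s w, w)].
Proof.
move=> nneg.
have [mt pt _ _ _] := treeP [::].
have mgood : measurable good by apply: measurableD.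
(* By [good_lohi] this supremum lies in every interval of the branch; the value 0 off [good] keeps
   the family bounded. *)
pose s w := sup (range (fun k => if `[< good w >] then (K k (limb w)).1.1 else 0)).
exists s; split.
  have -> : s = (fun w =>
      sups (fun k => if `[< good w >] then (K k (limb w)).1.1 else 0) 0).
    apply/funext => w; rewrite /s /sups /sdrop; congr sup.
    by apply/seteqP; split => [_ [k _ <-]|_ [k _ <-]]; exists k.
  apply: (@measurable_fun_sups _ _ _ _
    (fun k w => if `[< good w >] then (K k (limb w)).1.1 else 0)).
    move=> w _; have [gw|ngw] := asboolP (good w); last first.
      by exists 0 => _ [k _ <-].
    by exists (K 0%N (limb w)).1.2 => _ [k _ <-]; exact: good_lohi.
  move=> k; apply: measurable_fun_ifT; [|exact: measurable_lo|exact: measurable_cst].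
  apply: (@measurable_fun_bool _ _ _ _ true) => //=.
  rewrite setTI (_ : _ @^-1` _ = good)//.
  by apply/seteqP; split => w /= /asboolP.
exists good; split => //.
  (* The bad set is null, so a null [good] would make the hull at the root null, and that hull
     contains the projection. *)
  have -> : P good = P (tree [::]).
    have tb0 : P (tree [::] `&` bad) = 0%E.
      by apply: (subset_measure0 _ _ _ bad0) => //; exact: measurableI.
    rewrite measureD//; last by rewrite ltey_eq fin_num_measure.
    by rewrite [X in (_ - X)%E](_ : _ = 0%E) ?sube0.
  apply/eqP => t0; apply: nneg; exists (tree [::]); split => //.
  move=> w [t [b bK]]; apply: pt; exists t, b => //.
move=> w gw; exists (limb w) => n; split => /=; last exact: good_base.
rewrite /s asboolT//; apply/andP; split.
  apply: ub_le_sup; last by exists n.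
  by exists (K 0%N (limb w)).1.2 => _ [k _ <-]; exact: good_lohi.
apply: ge_sup; first by exists (K 0%N (limb w)).1.1, 0%N.
by move=> _ [k _ <-]; exact: good_lohi.
Qed.

End selection.

Lemma measurable_section B : measurable B ->
  ~ P.-negligible [set w | exists t, B (t, w)] ->
  exists s : Omega -> R, measurable_fun setT s /\ exists H,
    [/\ measurable H, P H != 0%E & forall w, H w -> B (s w, w)].
Proof.
by move=> /measurable_souslin[K KS ->]; exact: souslin_selection.
Qed.

End measurable_section.

(** * Optional sections *)

Section sigma_algebras.
Context {Omega : pointedType}.
Implicit Types (S : set_system Omega) (A B : set Omega).

(* Lets the closure lemmas for measurable sets be used for [S]. *)
Lemma sigma_algebraE S : sigma_algebra setT S ->
  S = @measurable _ (g_sigma_algebraType S).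
Proof. by move=> hS; rewrite -[LHS](sigma_algebra_id hS). Qed.

End sigma_algebras.

Section sub_sigma_algebras.
Context {R : realType} {d : measure_display} {Omega : measurableType d}.
Implicit Types (S : set_system Omega).

Lemma sub_measurableE S (X : Omega -> R) : sigma_algebra setT S ->
  sub_measurable S X <->
  measurable_fun setT (X : g_sigma_algebraType S -> R).
Proof.
move=> hS; rewrite /sub_measurable {1}(sigma_algebraE hS); split=> mX.
  by move=> _ B mB; rewrite setTI; exact: mX.
by move=> B mB; rewrite -[X in measurable X]setTI; exact: mX.
Qed.

Lemma sub_measurable_fun S (X : Omega -> R) : S `<=` measurable ->
  sub_measurable S X -> measurable_fun setT X.
Proof. by move=> hS mX _ B mB; rewrite setTI; apply: hS; exact: mX. Qed.

End sub_sigma_algebras.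

Section clamp.
Context {R : realType} (T : R) (hT : 0 < T).

(** Nothing is assumed of a process off [0, T]; clamping the time yields total measurable maps. *)
Definition clamp (t : R) : R := Num.max 0 (Num.min t T).

Lemma clamp_itv t : 0 <= clamp t <= T.
Proof.
by rewrite /clamp le_max lexx/= ge_max ltW//= ge_min lexx orbT.
Qed.

Lemma clampK t : 0 <= t <= T -> clamp t = t.
Proof. by move=> /andP[t0 tT]; rewrite /clamp min_l// max_r. Qed.

Lemma measurable_clamp : measurable_fun setT clamp.
Proof.
apply: measurable_maxr; first exact: measurable_cst.
by apply: measurable_minr; [exact: measurable_id|exact: measurable_cst].
Qed.

End clamp.

(** * Cadlag processes evaluated at random times *)

Section cadlag.
Context {R : realType} (T : R) (hT : 0 < T).

(** The time is discretised from the right: the discretised value is a countable gluing of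
    fixed-time values, and right-continuity gives the limit. Through [p] the time may live on
    another space, such as a product, and Omega may carry a smaller sigma-algebra. *)
Lemma measurable_cadlag {d dE} {Omega : measurableType d}
    {E : measurableType dE} (X : R -> Omega -> R) (tau : E -> R)
    (p : E -> Omega) :
  cadlag T X ->
  (forall t, 0 <= t <= T -> measurable_fun setT (X t \o p)) ->
  measurable_fun setT tau -> (forall e, 0 <= tau e <= T) ->
  measurable_fun setT (fun e => X (tau e) (p e)).
Proof.
move=> cX mX mtau tauT.
(* The shift to [k.+1] puts the grid time strictly after [tau] when [tau < T], as a right limit
   requires; the cap makes it exact at [T]. *)
pose grid n k : R := Num.min (k.+1%:R / n.+1%:R) T.
pose idx n e := Num.truncn (tau e * n.+1%:R).
pose dtau n e := grid n (idx n e).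
have gridT n k : 0 <= grid n k <= T.
  by rewrite /grid le_min divr_ge0// ltW//= ge_min lexx orbT.
have dtau_ge n e : tau e <= dtau n e.
  rewrite /dtau /grid le_min; have /andP[t0 ->] := tauT e; rewrite andbT.
  by rewrite ler_pdivlMr// ltW// truncnS_gt.
have dtau_gt n e : tau e < T -> tau e < dtau n e.
  move=> tT; rewrite /dtau /grid lt_min tT andbT.
  by rewrite ltr_pdivlMr// truncnS_gt.
have dtau_le n e : dtau n e <= tau e + n.+1%:R^-1.
  rewrite /dtau /grid ge_min; apply/orP; left.
  rewrite ler_pdivrMr// mulrDl mulVf ?pnatr_eq0// -natr1 lerD2r.
  have /andP[t0 _] := tauT e.
  by rewrite truncn_le mulr_ge0.
have cdtau e : dtau n e @[n --> \oo] --> tau e.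
  have H : tau e + n.+1%:R^-1 @[n --> \oo] --> tau e.
    rewrite -[X in _ --> X]addr0; apply: cvgD; first exact: cvg_cst.
    exact: cvg_harmonic.
  apply: (squeeze_cvgr _ (cvg_cst (tau e)) H).
  by near=> n; rewrite dtau_ge dtau_le.
apply: (@measurable_fun_cvg _ _ _ _ (fun n e => X (dtau n e) (p e))).
  move=> n _ B mB; rewrite setTI.
  rewrite (_ : _ @^-1` B = \bigcup_k ([set e | idx n e = k] `&`
     (X (grid n k) \o p) @^-1` B)).
    apply: bigcupT_measurable => k; apply: measurableI; last first.
      by rewrite -[X in measurable X]setTI; exact: mX.
    rewrite (_ : [set e | _] = [set e | (k%:R <= tau e * n.+1%:R < k.+1%:R)%R]).
      have mt : measurable_fun setT (fun e => tau e * n.+1%:R).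
        by apply: measurable_funM => //; exact: measurable_cst.
      rewrite (_ : [set e | _] = (fun e => tau e * n.+1%:R) @^-1`
          `[k%:R, k.+1%:R[).
        by rewrite -[X in measurable X]setTI; exact: mt.
      by apply/seteqP; split => e /=; rewrite in_itv.
    apply/seteqP; split => e /=; have /andP[t0 _] := tauT e;
      rewrite /idx.
      by move=> /eqP; rewrite truncn_eq ?mulr_ge0.
    by move=> ?; apply/eqP; rewrite truncn_eq ?mulr_ge0.
  by apply/seteqP; split => e /=; [exists (idx n e)|move=> [k _ [<-]]].
move=> e _; have /andP[t0] := tauT e; rewrite le_eqVlt => /orP[/eqP tT|tT].
  rewrite (_ : (fun n => _) = cst (X (tau e) (p e))); first exact: cvg_cst.
  apply/funext => n; congr (X _ _); apply/eqP; rewrite eq_le dtau_ge andbT tT.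
  by have /andP[] := gridT n (idx n e).
have [+ _] := cX (p e) => /(_ (tau e)); rewrite t0 tT => /(_ isT).
move/cvg_at_rightP; apply; split => // n; exact: dtau_gt.
Unshelve. all: by end_near. Qed.

Lemma cadlag_pathN (x : R -> R) : cadlag_path T x ->
  cadlag_path T (fun t => - x t).
Proof.
move=> [xr xl]; split => t tT; first by apply: cvgN; exact: xr.
by apply: is_cvgN; exact: xl.
Qed.

End cadlag.

Section optional_section.
Context {R : realType} (T : R) (hT : 0 < T) {d : measure_display}
  {Omega : measurableType d} (P : probability Omega R).
Variable G : R -> set_system Omega.
Hypothesis hG : filtration T P G.
Implicit Types (tau : Omega -> R) (U B : set (R * Omega)).

Lemma filtration_sigma t : 0 <= t <= T -> sigma_algebra setT (G t).
Proof. by case: hG => + _ _ _ => /[apply] -[]. Qed.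

Lemma filtration_sub t : 0 <= t <= T -> G t `<=` measurable.
Proof. by case: hG => + _ _ _ => /[apply] -[]. Qed.

Lemma filtration_le s t A : 0 <= s -> s <= t -> t <= T -> G s A -> G t A.
Proof. by case: hG => _ + _ _ => H s0 st tT; exact: (H s t s0 st tT). Qed.

(** By right-continuity of the filtration it is enough to work at each [s > t], where {tau <= t} is
    a countable intersection of events {tau < u} with t < u <= s. *)
Lemma stopping_time_lt tau : (forall w, 0 <= tau w <= T) ->
  (forall t, 0 <= t <= T -> G t [set w | tau w < t]) -> stopping_time T G tau.
Proof.
move=> tauT tauG; split=> // t /andP[t0]; rewrite le_eqVlt => /orP[/eqP tT|tT].
  have TT : 0 <= T <= T by rewrite lexx ltW.
  rewrite tT (_ : [set w | _] = setT); last first.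
    by apply/seteqP; split => // w _ /=; have /andP[] := tauT w.
  by rewrite (sigma_algebraE (filtration_sigma TT)); exact: measurableT.
have [_ _ + _] := hG => <-; last by rewrite t0.
move=> s /=; rewrite in_itv/= => /andP[ts sT].
pose u n : R := t + (s - t) / n.+1%:R.
have u_le n : t <= u n <= s.
  rewrite /u lerDl divr_ge0 ?subr_ge0 ?(ltW ts)//= -lerBrDl.
  by rewrite ler_pdivrMr// ler_peMr ?subr_ge0 ?(ltW ts)// ler1n.
have -> : [set w | tau w <= t] = \bigcap_n [set w | tau w < u n].
  apply/seteqP; split => w /=.
    move=> wt n _ /=; apply: le_lt_trans wt _.
    by rewrite /u ltrDl divr_gt0// subr_gt0.
  move=> H; apply/ler_addgt0Pr => e e0.
  have s0 : 0 < s - t by rewrite subr_gt0.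
  have := H (Num.truncn ((s - t) / e)) Logic.I => /= /ltW /le_trans; apply.
  rewrite /u lerD2l ler_pdivrMr// mulrC -ler_pdivrMr// ltW//.
  exact: truncnS_gt.
have s0T : 0 <= s <= T by rewrite sT (le_trans t0 (ltW ts)).
rewrite (sigma_algebraE (filtration_sigma s0T)).
apply: bigcapT_measurable => n.
rewrite -(sigma_algebraE (filtration_sigma s0T)).
have /andP[tu us] := u_le n.
apply: (@filtration_le (u n)) => //; first exact: le_trans tu.
by apply: tauG; rewrite (le_trans t0 tu) (le_trans us sT).
Qed.

Lemma stopping_time_cst : stopping_time T G (cst 0).
Proof.
split=> [w|t tT]; first by rewrite lexx ltW.
have /andP[t0 _] := tT.
rewrite (_ : [set w | _] = setT); last by apply/seteqP; split.
by rewrite (sigma_algebraE (filtration_sigma tT)); exact: measurableT.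
Qed.

Lemma stopping_time_sub_measurable tau : stopping_time T G tau ->
  sub_measurable (G T) tau.
Proof.
have TT : 0 <= T <= T by rewrite lexx ltW.
have sGT := filtration_sigma TT.
move=> [tauT tauG]; apply/(sub_measurableE _ sGT) => mT.
apply: (measurability _ (RGenInftyO.measurableE R)) => //.
move=> _ [_ [x ->] <-]; rewrite setTI.
have [x0|x0] := leP x 0.
  rewrite (_ : _ @^-1` _ = set0)//; apply/seteqP; split => // w /=.
  rewrite in_itv/= => /lt_le_trans /(_ x0).
  by have /andP[/le_lt_trans + _] := tauT w => /[apply]; rewrite ltxx.
(* Truncating at 0, and at [T] below, keeps the thresholds among the times where the filtration is
   given. *)
pose y n := Num.max 0 (x - n.+1%:R^-1).
rewrite (_ : _ @^-1` _ = \bigcup_n [set w | tau w <= Num.min T (y n)]).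
  apply: bigcupT_measurable => n.
  have yT : 0 <= Num.min T (y n) <= T.
    by rewrite le_min ltW//= ge_min lexx le_max lexx.
  rewrite -(sigma_algebraE sGT); have /andP[y0 yleT] := yT.
  exact: (filtration_le y0 yleT _ (tauG _ yT)).
apply/seteqP; split => w /=; have /andP[t0 tT] := tauT w; rewrite in_itv/=.
  move=> tx; exists (Num.truncn (x - tau w)^-1) => //=.
  rewrite le_min tT/= /y le_max; apply/orP; right.
  rewrite lerBrDl -lerBrDr invf_ple ?posrE ?subr_gt0//.
  by rewrite ltW// truncnS_gt.
move=> [n _] /=; rewrite le_min => /andP[_] /le_lt_trans; apply.
by rewrite /y gt_max x0 gtrBl invr_gt0 ltr0n.
Qed.

Lemma stopping_time_measurable tau : stopping_time T G tau ->
  measurable_fun setT tau.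
Proof.
have TT : 0 <= T <= T by rewrite lexx ltW.
by move=> /stopping_time_sub_measurable; exact: sub_measurable_fun (filtration_sub TT).
Qed.

Lemma stopping_time_sup (tau : nat -> Omega -> R) :
  (forall n, stopping_time T G (tau n)) ->
  stopping_time T G (fun w => sup (range (fun n => tau n w))).
Proof.
move=> st; have ub w : has_ubound (range (fun n => tau n w)).
  by exists T => _ [n _ <-]; have [/(_ w)/andP[]] := st n.
have supP w t : sup (range (fun n => tau n w)) <= t <-> forall n, tau n w <= t.
  split=> [H n|H]; first by apply: le_trans H; apply: ub_le_sup => //; exists n.
  apply: ge_sup; first by exists (tau 0%N w), 0%N.
  by move=> _ [n _ <-].
split=> [w|t tT].
  apply/andP; split.
    have [/(_ w)/andP[t0 _] _] := st 0%N; apply: (le_trans t0).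
    by apply: ub_le_sup => //; exists 0%N.
  by apply/supP => n; have [/(_ w)/andP[]] := st n.
rewrite (_ : [set w | _] = \bigcap_n [set w | tau n w <= t]).
  rewrite (sigma_algebraE (filtration_sigma tT)); apply: bigcapT_measurable => n.
  rewrite -(sigma_algebraE (filtration_sigma tT)).
  by have [_ +] := st n; exact.
apply/seteqP; split=> w /= H; first by move=> n _; exact: (supP w t).1.
by apply/supP => n; exact: H.
Qed.

Definition right_open U := forall t w, 0 <= t < T -> U (t, w) ->
  \forall s \near t^'+, U (s, w).

(** The time [p.1] is itself allowed as a witness, so [U] is included. Only limits from the right
    occur, because an infimum of entry times is approached from the right. *)
Definition right_closure U : set (R * Omega) := [set p | forall e, 0 < e ->
  exists u, [/\ p.1 <= u, u < p.1 + e & U (u, p.2)]].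

(** The added point [T] is the value taken when [U] is not met from [tau] on. *)
Definition debut U tau w : R :=
  inf ([set t | tau w <= t <= T /\ U (t, w)] `|` [set T]).

Lemma debut_has_inf U tau w : 0 <= tau w <= T ->
  has_inf ([set t | tau w <= t <= T /\ U (t, w)] `|` [set T]).
Proof.
move=> /andP[t0 tT]; split; first by exists T; right.
by exists (tau w) => t [[/andP[]]//|->].
Qed.

Lemma debut_ge U tau w : 0 <= tau w <= T -> tau w <= debut U tau w.
Proof.
move=> tT; apply: lb_le_inf; first by exists T; right.
by move=> t [[/andP[]]//|->]; case/andP: tT.
Qed.

Lemma debut_le U tau w t : 0 <= tau w <= T -> tau w <= t <= T -> U (t, w) ->
  debut U tau w <= t.
Proof.
move=> /(debut_has_inf U)[_ lb] tt Ut; apply: ge_inf => //.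
by left.
Qed.

(** By right-openness an entry before [t] is witnessed at a rational time before [t]. *)
Lemma debut_stopping U tau : right_open U ->
  (forall t, 0 <= t <= T -> G t [set w | U (t, w)]) ->
  stopping_time T G tau -> stopping_time T G (debut U tau).
Proof.
move=> Uo UG [tauT tauG]; apply: stopping_time_lt => [w|t tT].
  apply/andP; split.
    by have /andP[t0 _] := tauT w; apply: le_trans t0 (debut_ge _ (tauT w)).
  have [_ lb] := debut_has_inf U (tauT w).
  by apply: ge_inf => //; right.
have /andP[t0 tT'] := tT.
rewrite (_ : [set w | _] = \bigcup_(q : rat)
    (if 0 <= (ratr q : R) < t then
       [set w | tau w <= ratr q] `&` [set w | U (ratr q, w)] else set0)).
  rewrite (sigma_algebraE (filtration_sigma tT)).
  apply: bigcupT_measurable_rat => q.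
  case: ifPn => // /andP[q0 qt]; have qT : 0 <= (ratr q : R) <= T.
    by rewrite q0 (le_trans (ltW qt)).
  apply: measurableI; rewrite -(sigma_algebraE (filtration_sigma tT));
    apply: (filtration_le q0 (ltW qt) tT').
  - exact: tauG.
  - exact: UG.
apply/seteqP; split => w /=.
  have [Ene lb] := debut_has_inf U (tauT w).
  move=> /(inf_lt Ene)[u [[/andP[tu uT] Uu]|/= -> /lt_le_trans/(_ tT')]];
    last by rewrite ltxx.
  move=> ut; have /andP[tw0 _] := tauT w.
  have u0T : 0 <= u < T by rewrite (le_trans tw0 tu) (lt_le_trans ut).
  have : \forall s \near u^'+, U (s, w) /\ s < t.
    apply: filterI; first exact: Uo.
    exact: nbhs_right_lt.
  move=> [e /= e0 eU].
  have : u < Num.min (u + e) t by rewrite lt_min ut ltrDl e0.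
  move=> /rat_in_itvoo[q]; rewrite in_itv/= lt_min => /andP[uq /andP[qe qt]].
  have /andP[u0 _] := u0T.
  exists q => //; rewrite (le_trans u0 (ltW uq)) qt/=; split.
    by apply: le_trans tu _; exact: ltW.
  apply: (eU (ratr q) _ _).1 => //=.
  by rewrite ltr_norml ltrBrDr ltrBlDr; apply/andP; split;
    rewrite ?ltrBlDl// -?ltrBlDl ?(lt_trans qe)//; lra.
move=> [q _]; case: ifPn => // /andP[q0 qt] [/= tq Uq].
apply: le_lt_trans (qt); apply: debut_le => //.
by rewrite tq (le_trans _ tT')// ltW.
Qed.

(** When [tau] is [T] the debut equals [tau] by default, hence the assumption that [U] is met from
    [tau] on. *)
Lemma debut_right_closure U tau w : 0 <= tau w <= T ->
  (exists2 t, tau w <= t <= T & U (t, w)) -> debut U tau w = tau w ->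
  right_closure U (tau w, w).
Proof.
move=> tauT [t tt Ut] dE e e0 /=.
have [tauTe|tauTe] := leP T (tau w).
  exists t; have /andP[tt1 tt2] := tt; split => //.
  by apply: le_lt_trans tt2 _; rewrite (le_lt_trans tauTe)// ltrDl.
have lt0 : debut U tau w < Num.min (tau w + e) T.
  by rewrite dE lt_min ltrDl e0.
have [Ene _] := debut_has_inf U tauT.
have [u [[/andP[tu uT] Uu]|/= ->]] := inf_lt Ene lt0; rewrite lt_min.
  by move=> /andP[ue _]; exists u.
by rewrite ltxx andbF.
Qed.

(** * Inner approximation of optional sets along the graph of a random time *)

Section inner_regularity.
Variable s : Omega -> R.
Hypothesis ms : measurable_fun setT s.

Let at_s B : set Omega := [set w | B (s w, w)].

Let admissible U := [/\ right_open U,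
  forall t, 0 <= t <= T -> G t [set w | U (t, w)] & measurable (at_s U)].

(* Inner regularity on the graph of [s]; right closures replace closures since
   debuts of right open sets are stopping times. *)
Let inner B := measurable (at_s B) /\ forall e : R, 0 < e ->
  exists U : nat -> set (R * Omega), [/\ forall n, admissible (U n),
    forall n, U n.+1 `<=` U n,
    forall p, 0 <= p.1 <= T -> (forall n, right_closure (U n) p) -> B p &
    (P (at_s B `\` \bigcap_n at_s (U n)) <= e%:E)%E].

Let admissibleU U U' : admissible U -> admissible U' -> admissible (U `|` U').
Proof.
move=> [Uo Ua Um] [Vo Va Vm]; split.
- move=> t w tT [Ut|Vt].
    by apply: filterS (Uo _ _ tT Ut) => u; left.
  by apply: filterS (Vo _ _ tT Vt) => u; right.
- move=> t tT; rewrite (sigma_algebraE (filtration_sigma tT)).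
  apply: measurableU; rewrite -(sigma_algebraE (filtration_sigma tT)).
    exact: Ua.
  exact: Va.
- exact: measurableU.
Qed.

Let admissibleI U U' : admissible U -> admissible U' -> admissible (U `&` U').
Proof.
move=> [Uo Ua Um] [Vo Va Vm]; split.
- by move=> t w tT [Ut Vt]; apply: filterI; [exact: Uo|exact: Vo].
- move=> t tT; rewrite (sigma_algebraE (filtration_sigma tT)).
  apply: measurableI; rewrite -(sigma_algebraE (filtration_sigma tT)).
    exact: Ua.
  exact: Va.
- exact: measurableI.
Qed.

Let admissible_bigcap N (U : nat -> set (R * Omega)) :
  (forall n, admissible (U n)) ->
  admissible (\bigcap_(n in [set n | (n <= N)%N]) U n).
Proof.
move=> aU; elim: N => [|N IH].
  rewrite (_ : \bigcap_(n in _) _ = U 0%N)//; apply/seteqP; split => p /=.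
    by apply.
  by move=> Up n /=; rewrite leqn0 => /eqP ->.
rewrite (_ : \bigcap_(n in _) _ =
    (\bigcap_(n in [set n | (n <= N)%N]) U n) `&` U N.+1).
  exact: admissibleI.
apply/seteqP; split => p /=.
  by move=> Up; split; [move=> n nN; apply: Up; exact: leqW|apply: Up => /=].
move=> [Up UN] n /=; rewrite leq_eqVlt => /orP[/eqP -> //|nN].
exact: Up.
Qed.

Let right_closureS U U' : U `<=` U' -> right_closure U `<=` right_closure U'.
Proof.
move=> UU' p Up e e0; have [u [pu ue Uu]] := Up e e0.
by exists u; split => //; exact: UU'.
Qed.

(** This is special to finite unions, which is why [inner_bigcup] begins by truncating the union. *)
Let right_closureU U U' p : right_closure (U `|` U') p ->
  right_closure U p \/ right_closure U' p.
Proof.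
move=> UU'; apply: contrapT => /not_orP[].
move=> /existsNP[e /not_implyP[e0 nU]] /existsNP[e' /not_implyP[e'0 nU']].
have ee0 : 0 < Num.min e e' by rewrite lt_min e0.
have [u [pu + [Uu|Uu]]] := UU' _ ee0; rewrite -ltrBlDl lt_min => /andP[ue ue'].
  by apply: nU; exists u; rewrite -ltrBlDl.
by apply: nU'; exists u; rewrite -ltrBlDl.
Qed.

Let noninc_le (U : nat -> set (R * Omega)) m n :
  (forall n, U n.+1 `<=` U n) -> (m <= n)%N -> U n `<=` U m.
Proof.
move=> dU /subnK <-; elim: (n - m)%N => // k IH.
by rewrite addSn; apply: subset_trans IH; exact: dU.
Qed.

Let measurable_diff B (U : nat -> set (R * Omega)) :
  measurable (at_s B) -> (forall n, admissible (U n)) ->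
  measurable (at_s B `\` \bigcap_n at_s (U n)).
Proof.
move=> mB aU; apply: measurableD => //; apply: bigcapT_measurable => n.
by have [] := aU n.
Qed.

Let le_measureP (A A' : set Omega) : measurable A -> measurable A' ->
  A `<=` A' -> (P A <= P A')%E.
Proof. by move=> mA mA' AA'; apply: le_measure; rewrite ?inE. Qed.

(** The [i]-th approximation may lose e / 2^(i+1). The diagonal set at stage [n] involves the first
    [n + 1] families only, because right-open sets are stable under finite intersections. *)
Let inner_bigcap (B : nat -> set (R * Omega)) :
  (forall i, inner (B i)) -> inner (\bigcap_i B i).
Proof.
move=> iB; have mB i : measurable (at_s (B i)) by have [] := iB i.
have mcap : measurable (at_s (\bigcap_i B i)) by exact: bigcapT_measurable.
split=> // e e0.
have ei0 i : 0 < e / (2 ^ i.+1)%:R by rewrite divr_gt0// ltr0n expn_gt0.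
have /choice[U UP] : forall i, exists U : nat -> set (R * Omega),
    [/\ forall n, admissible (U n), forall n, U n.+1 `<=` U n,
    forall p, 0 <= p.1 <= T -> (forall n, right_closure (U n) p) -> B i p &
    (P (at_s (B i) `\` \bigcap_n at_s (U n)) <= (e / (2 ^ i.+1)%:R)%:E)%E].
  by move=> i; have [_ +] := iB i; exact.
exists (fun n => \bigcap_(i in [set i | (i <= n)%N]) U i n); split.
- by move=> n; apply: admissible_bigcap => i; have [+ _ _ _] := UP i; exact.
- move=> n p Up i /= ni; have [_ dU _ _] := UP i.
  by apply: dU; apply: Up => /=; exact: leqW.
- move=> p pT Up i _; have [_ dU + _] := UP i; apply => // n.
  apply: (@right_closureS (U i (maxn i n))).
    by apply: noninc_le => //; exact: leq_maxr.
  apply: (@right_closureS _ _ _ _ (Up (maxn i n))).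
  by move=> q; apply => /=; exact: leq_maxl.
- apply: (@le_trans _ _ (\sum_(i <oo) (e / (2 ^ i.+1)%:R)%:E)%E); last first.
    by apply: epsilon_trick0; exact: ltW.
  apply: (@le_trans _ _
      (\sum_(i <oo) P (at_s (B i) `\` \bigcap_n at_s (U i n)))%E); last first.
    by apply: lee_nneseries => // i _; have [] := UP i.
  apply: measure_sigma_subadditive.
  + by move=> i; apply: measurable_diff => //; have [] := UP i.
  + apply: measurable_diff => // n; apply: admissible_bigcap => i.
    by have [+ _ _ _] := UP i; exact.
  + move=> w [Bw nU]; apply: contrapT => nex; apply: nU => n _ i /= ni.
    apply: contrapT => nUw; apply: nex; exists i => //; split.
      exact: Bw.
    by move=> /(_ n Logic.I).
Qed.

(** Since the families decrease, a point in the right closures of all the unions that misses one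
    closure of [U] must lie in every closure of [V]. *)
Let innerU B B' : inner B -> inner B' -> inner (B `|` B').
Proof.
move=> [mB iB] [mB' iB']; split; first exact: measurableU.
move=> e e0; have e20 : 0 < e / 2 by rewrite divr_gt0.
have [U [aU dU UB PU]] := iB _ e20; have [V [aV dV VB PV]] := iB' _ e20.
exists (fun n => U n `|` V n); split.
- by move=> n; exact: admissibleU.
- by move=> n; apply: setUSS.
- move=> p pT UV.
  have [UAll|/existsNP[m nUm]] := pselect (forall n, right_closure (U n) p).
    by left; exact: UB.
  right; apply: VB => // n.
  have [Um|Vm] := right_closureU (UV (maxn m n)).
    exfalso; apply: nUm; apply: right_closureS Um.
    by apply: noninc_le => //; exact: leq_maxl.
  by apply: right_closureS Vm; apply: noninc_le => //; exact: leq_maxr.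
- have -> : e%:E = ((e / 2)%:E + (e / 2)%:E)%E by rewrite -EFinD -splitr.
  apply: le_trans (leeD PU PV).
  apply: le_trans (measureU2 _ _ _); [|exact: measurable_diff..].
  apply: le_measureP.
  + apply: measurable_diff; first exact: measurableU.
    by move=> n; exact: admissibleU.
  + by apply: measurableU; exact: measurable_diff.
  + move=> w [[Bw|Bw] nUV]; [left|right]; split=> // UVw; apply: nUV => n _.
      by left; exact: UVw.
    by right; exact: UVw.
Qed.

(** By continuity of [P] a finite subunion loses at most [e / 2] along the graph; the other half is
    spent on approximating that subunion. *)
Let inner_bigcup (B : nat -> set (R * Omega)) :
  (forall i, inner (B i)) -> inner (\bigcup_i B i).
Proof.
move=> iB; have mB i : measurable (at_s (B i)) by have [] := iB i.
have mcup : measurable (at_s (\bigcup_i B i)) by exact: bigcupT_measurable.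
pose C N := \bigcup_(i in [set i | (i <= N)%N]) B i.
have iC N : inner (C N).
  elim: N => [|N IH].
    rewrite (_ : C _ = B 0%N)//; apply/seteqP; split => p /=.
      by move=> [i /=]; rewrite leqn0 => /eqP ->.
    by move=> ?; exists 0%N.
  rewrite (_ : C _ = C N `|` B N.+1); first exact: innerU.
  apply/seteqP; split => p /=.
    move=> [i /=]; rewrite leq_eqVlt => /orP[/eqP ->|iN] Bi; [by right|left].
    by exists i.
  by move=> [[i /= iN] Bi|BN]; [exists i => //=; exact: leqW|exists N.+1 => /=].
have mC N : measurable (at_s (C N)) by have [] := iC N.
split=> // e e0; have e20 : 0 < e / 2 by rewrite divr_gt0.
have [N PN] : exists N,
    (P (at_s (\bigcup_i B i) `\` at_s (C N)) <= (e / 2)%:E)%E.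
  have mD N : measurable (at_s (\bigcup_i B i) `\` at_s (C N)).
    exact: measurableD.
  have := @nonincreasing_cvg_mu _ _ _ P
    (fun N => at_s (\bigcup_i B i) `\` at_s (C N)).
  have cap0 : \bigcap_N (at_s (\bigcup_i B i) `\` at_s (C N)) = set0.
    apply/seteqP; split => // w Dw; have [[i _ Bi] _] := Dw 0%N Logic.I.
    have [_ nC] := Dw i Logic.I; apply: nC; exists i => //=.
  rewrite cap0 measure0 => H.
  have {}H : P \o (fun N => at_s (\bigcup_i B i) `\` at_s (C N)) @ \oo --> 0%E.
    apply: H => //; first by rewrite ltey_eq fin_num_measure.
    apply/nonincreasing_seqP => n; apply/subsetPset => w [Bw nC]; split => //.
    by move=> [i /= iN Bi]; apply: nC; exists i => //=; exact: leqW.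
  have /= [N _ NP] : \forall N \near \oo,
      (P (at_s (\bigcup_i B i) `\` at_s (C N)) < (e / 2)%:E)%E.
    apply: (H [set x | x < (e / 2)%:E]%E); apply: open_nbhs_nbhs.
    by split; [exact: open_ereal_lt_ereal|rewrite /= lte_fin].
  by exists N; apply/ltW/NP => /=.
have [_ /(_ _ e20)[U [aU dU UC PU]]] := iC N.
exists U; split => //.
  by move=> p pT Up; have [i _ Bi] := UC p pT Up; exists i.
have -> : e%:E = ((e / 2)%:E + (e / 2)%:E)%E by rewrite -EFinD -splitr.
apply: le_trans (leeD PN PU).
apply: le_trans (measureU2 _ _ _); [|exact: measurableD|exact: measurable_diff].
apply: le_measureP; first exact: measurable_diff.
  by apply: measurableU; [exact: measurableD|exact: measurable_diff].
move=> w [Bw nU]; have [Cw|nCw] := pselect (at_s (C N) w); [right|left] => //.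
Qed.

Let measurable_at_s (X : R -> Omega -> R) : cadlag T X -> adapted T G X ->
  measurable_fun setT (fun w => X (clamp T (s w)) w).
Proof.
move=> cX aX; apply: (@measurable_cadlag _ _ hT _ _ _ _ _ _ id cX).
- move=> t tT; apply: sub_measurable_fun (filtration_sub tT) _; exact: aX.
- exact: (measurableT_comp (measurable_clamp T) ms).
- by move=> w; exact: clamp_itv.
Qed.

(** The sets {X > x - 1/(n+1)} are right-open by right-continuity and contain the given set, so
    nothing is lost. Right-continuity also keeps X >= x - 1/(n+1) on their right closures. *)
Let inner_ge (X : R -> Omega -> R) x : cadlag T X -> adapted T G X ->
  inner [set p | 0 <= p.1 <= T /\ x <= X p.1 p.2].
Proof.
move=> cX aX.
have mset (Y : set R) : measurable Y ->
    measurable (at_s [set p | 0 <= p.1 <= T /\ Y (X p.1 p.2)]).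
  move=> mY; rewrite (_ : at_s _ = s @^-1` `[0, T] `&`
      (fun w => X (clamp T (s w)) w) @^-1` Y).
    apply: measurableI; rewrite -[X in measurable X]setTI; first exact: ms.
    exact: measurable_at_s.
  apply/seteqP; split => w; rewrite /at_s /= in_itv/= => -[sT];
    by rewrite clampK.
split=> [|e e0].
  by apply: (mset [set y | x <= y]); rewrite -set_itvcy; exact: measurable_itv.
exists (fun n => [set p | 0 <= p.1 <= T /\ x - n.+1%:R^-1 < X p.1 p.2]); split.
- move=> n; split.
  + move=> t w /andP[t0 tT] [_ xX] /=.
    have Xr : X u w @[u --> t^'+] --> X t w.
      by have [+ _] := cX w; apply; rewrite t0.
    near=> u; split; last by near: u; exact: (cvgr_gt _ Xr).
    apply/andP; split; first by apply: le_trans t0 _; near: u; exact: nbhs_right_ge.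
    by near: u; exact: nbhs_right_le.
  + move=> t tT /=; rewrite (_ : [set w | _] = X t @^-1` `]x - n.+1%:R^-1, +oo[).
      by apply: aX => //; exact: measurable_itv.
    apply/seteqP; split => w /=; rewrite in_itv/= andbT; first by move=> [].
    by move=> ?; split.
  + apply: (mset [set y | x - n.+1%:R^-1 < y]); rewrite -set_itvoy.
    exact: measurable_itv.
- move=> n [t w] /= [tT xX]; split => //; apply: le_lt_trans xX.
  by rewrite lerD2l lerN2 lef_pV2 ?posrE// ler_nat.
- move=> [t w] /= tT xX; split => //.
  apply/ler_addgt0Pr => e1 e10.
  pose n := Num.truncn e1^-1.
  have ne1 : n.+1%:R^-1 <= e1.
    by rewrite invf_ple ?posrE// ltW// truncnS_gt.
  suff : x - n.+1%:R^-1 <= X t w.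
    by rewrite lerBlDr => /le_trans; apply; rewrite lerD2l.
  (* At [T] the approximating sets have no later point, so the witness [u] is [T] itself. *)
  have /andP[t0] := tT; rewrite le_eqVlt => /orP[/eqP teT|ltT].
    have [u [/= tu _ [/andP[_ uT] xX']]] := xX n 1 ltr01.
    suff -> : t = u by exact: ltW.
    by apply/eqP; rewrite eq_le tu teT.
  rewrite leNgt; apply/negP => Xlt.
  have Xr : X u w @[u --> t^'+] --> X t w.
    by have [+ _] := cX w; apply; rewrite t0.
  have [e2 /= e20 e2P] := cvgr_lt _ Xr _ Xlt.
  have [u [/= tu ue [uT xX']]] := xX n e2 e20.
  move: tu; rewrite le_eqVlt => /orP[/eqP tu|tu].
    by move: xX'; rewrite -tu ltNge (ltW Xlt).
  have := e2P u _ tu; rewrite /= ltr0_norm ?subr_lt0// opprB ltrBlDl.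
  by move=> /(_ ue); rewrite ltNge (ltW xX').
- rewrite (_ : _ `\` _ = set0) ?measure0 ?lee_fin ?ltW//.
  apply/seteqP; split => // w [[sT xX]] /=; apply => n _ /=; split => //.
  by apply: lt_le_trans xX; rewrite gtrBl invr_gt0.
Unshelve. all: by end_near. Qed.

Let Dom : set (R * Omega) := `[0, T] `*` setT.

Let inner_sigma B : optional_sigma T G B -> inner B.
Proof.
suff : optional_sigma T G `<=`
    [set B | [/\ B `<=` Dom, inner B & inner (Dom `\` B)]].
  by move=> /(_ B) H /H[].
have iD : inner Dom.
  split.
    rewrite (_ : at_s _ = s @^-1` `[0, T]).
      by rewrite -[X in measurable X]setTI; exact: ms.
    by apply/seteqP; split => w; rewrite /at_s /Dom/=; [move=> []|move=> ?; split].
  move=> e e0; exists (fun=> setT); split.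
  - move=> n; split.
    + by move=> t w _ _; near=> u.
    + move=> t tT; rewrite (sigma_algebraE (filtration_sigma tT)).
      by rewrite (_ : [set w | _] = setT).
    + by rewrite (_ : at_s _ = setT).
  - by [].
  - by move=> [t w] /= tT _; split => //=; rewrite in_itv.
  - rewrite (_ : _ `\` _ = set0) ?measure0 ?lee_fin ?ltW//.
    by apply/seteqP; split => // w [_] /=; apply => n _.
have i0 : inner set0.
  split; first by rewrite (_ : at_s _ = set0).
  move=> e e0; exists (fun=> set0); split.
  - move=> n; split; first by [].
      move=> t tT; rewrite (sigma_algebraE (filtration_sigma tT)).
      by rewrite (_ : [set w | _] = set0).
    by rewrite (_ : at_s _ = set0).
  - by move=> n p.
  - by move=> p _ /(_ 0%N 1 ltr01)[u []].
  - rewrite (_ : _ `\` _ = set0) ?measure0 ?lee_fin ?ltW//.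
    by apply/seteqP; split => // w [].
have sM (X : R -> Omega -> R) : cadlag T X -> adapted T G X ->
  (@measurable _ (measurableTypeR R)) `<=` [set B |
    inner (Dom `&` [set p | B (X p.1 p.2)]) /\
    inner (Dom `&` [set p | ~ B (X p.1 p.2)])].
  move=> cX aX; rewrite RGenCInfty.measurableE; apply: smallest_sub.
    split => /=.
    - split; first by rewrite (_ : _ `&` _ = set0)//; apply/seteqP; split => p [].
      by rewrite (_ : _ `&` _ = Dom)//; apply/seteqP; split => p; [case|move=> Dp; split].
    - move=> A [iA iCA]; split.
        have := iCA; congr inner; apply/seteqP.
        by split => p [Dp] /=; [move=> nA; split|move=> [_ nA]; split].
      have := iA; congr inner; apply/seteqP; split => p [Dp] /=.
        by move=> ?; split => // -[].
      by move=> H; split => //; apply: contrapT => ?; apply: H.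
    - move=> A iA; split.
        have := inner_bigcup (fun i => (iA i).1); congr inner.
        apply/seteqP; split => p.
          by move=> [i _ [Dp Ap]]; split => //; exists i.
        by move=> [Dp [i _ Ap]]; exists i.
      have := inner_bigcap (fun i => (iA i).2); congr inner.
      apply/seteqP; split => p.
        move=> H; split; first by have [] := H 0%N Logic.I.
        by move=> [i _ Ai]; have [_] := H i Logic.I; apply.
      by move=> [Dp nA] i _; split => // Ai; apply: nA; exists i.
  move=> _ [x ->]; split.
    have := inner_ge x cX aX; congr inner; apply/seteqP.
    split => p; rewrite /Dom/= !in_itv/= andbT; first by case.
    by move=> [[]].
  have cNX : cadlag T (fun t w => - X t w) by move=> w; exact: cadlag_pathN.
  have aNX : adapted T G (fun t w => - X t w).
    move=> t tT; apply/(sub_measurableE _ (filtration_sigma tT)).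
    have /(sub_measurableE _ (filtration_sigma tT)) mX := aX t tT.
    exact: measurable_funN mX.
  (* {X < x} is the union over [n] of the sets {-X >= -x + 1/(n+1)}. *)
  have := inner_bigcup (fun n => inner_ge (- x + n.+1%:R^-1) cNX aNX).
  congr inner; apply/seteqP; split => p; rewrite /Dom/= !in_itv/= andbT.
    move=> [n _ [pT]]; rewrite lerNr opprD opprK => Xx; split => //.
    apply/negP; rewrite -ltNge; apply: le_lt_trans Xx _.
    by rewrite gtrBl invr_gt0.
  move=> [[pT _] /negP]; rewrite -ltNge => Xx.
  exists (Num.truncn (x - X p.1 p.2)^-1) => //; split => //=.
  rewrite lerNr opprD opprK lerBrDl -lerBrDr invf_ple ?posrE ?subr_gt0//.
  by rewrite ltW// truncnS_gt.
apply: smallest_sub.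
  split => /=.
  - by split => //; rewrite setD0.
  - move=> A [AD iA iDA]; split; [exact: subDsetl|exact: iDA|].
    by rewrite setDD (setIidr AD).
  - move=> A iA; split.
    + by apply: bigcup_sub => i _; have [] := iA i.
    + by apply: inner_bigcup => i; have [] := iA i.
    + have : inner (\bigcap_i (Dom `\` A i)).
        by apply: inner_bigcap => i; have [] := iA i.
      congr inner; apply/seteqP; split => p.
        move=> H; split; first by have [] := H 0%N Logic.I.
        by move=> [i _ Ai]; have [_] := H i Logic.I; apply.
      by move=> [Dp nA] i _; split => // Ai; apply: nA; exists i.
move=> _ [X [A [cX aX mA ->]]]; have [iA iCA] := sM X cX aX A mA; split => //.
have := iCA; congr inner; apply/seteqP; split => p [Dp] nA; split => //.
  by move=> [].
by move=> Ap; apply: nA.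
Unshelve. all: by end_near. Qed.

Lemma optional_inner B (e : R) : optional_sigma T G B -> 0 < e ->
  measurable [set w | B (s w, w)] /\
  exists U : nat -> set (R * Omega), [/\ forall n, right_open (U n),
    forall n t, 0 <= t <= T -> G t [set w | U n (t, w)],
    measurable (\bigcap_n [set w | U n (s w, w)]),
    forall p, 0 <= p.1 <= T -> (forall n, right_closure (U n) p) -> B p &
    (P ([set w | B (s w, w)] `\` \bigcap_n [set w | U n (s w, w)]) <= e%:E)%E].
Proof.
move=> /inner_sigma[mB /[apply]-[U [aU _ UB PU]]]; split => //.
exists U; split => //.
- by move=> n; have [] := aU n.
- by move=> n; have [] := aU n.
- by apply: bigcapT_measurable => n; have [] := aU n.
Qed.

End inner_regularity.

Lemma optional_sigma_sub : optional_sigma T G `<=` measurable.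
Proof.
apply: smallest_sub.
  split=> [|A mA|A mA]; first exact: measurable0.
    by apply: measurableD => //; apply: measurableX.
  exact: bigcupT_measurable.
move=> _ [X [B [cX aX mB ->]]].
have mX : measurable_fun setT (fun p : R * Omega => X (clamp T p.1) p.2).
  apply: (measurable_cadlag hT cX) => [t tT||p].
  - apply: measurableT_comp; last exact: measurable_snd.
    exact: (sub_measurable_fun (filtration_sub tT) (aX t tT)).
  - exact: (measurableT_comp (measurable_clamp T) measurable_fst).
  - exact: clamp_itv.
rewrite (_ : _ `&` _ = (`[0, T] `*` setT) `&`
    (fun p : R * Omega => X (clamp T p.1) p.2) @^-1` B).
  apply: measurableI; first exact: measurableX.
  by rewrite -[X in measurable X]setTI; exact: mX.
apply/seteqP; split => -[t w] [[tT _] BX]; split => //; move: BX => /=;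
  by rewrite clampK//; move: tT; rewrite /= in_itv.
Qed.

Lemma optional_section B : optional_sigma T G B ->
  (forall tau, stopping_time T G tau ->
     P.-negligible [set w | B (tau w, w)]) ->
  P.-negligible [set w | exists t, B (t, w)].
Proof.
move=> oB nB; apply: contrapT => pB.
have BD : B `<=` `[0, T] `*` setT.
  suff : optional_sigma T G `<=` [set B | B `<=` `[0, T] `*` setT] by exact.
  apply: smallest_sub; last by move=> _ [X [C [_ _ _ ->]]] p [].
  split=> [//|A _|A AD]; first exact: subDsetl.
  by move=> p [i _ /AD].
have [s [ms [H [mH PH HB]]]] := measurable_section (optional_sigma_sub oB) pB.
have PH0 : 0 < fine (P H).
  by rewrite fine_gt0// lt0e PH measure_ge0/= ltey_eq fin_num_measure.
(* Losing at most half of P(H) leaves positive probability on the graph of [s]. *)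
have e0 : 0 < fine (P H) / 2 by rewrite divr_gt0.
have [mBs [U [Uo UG mU UB PU]]] := optional_inner ms oB e0.
pose Bs := [set w | B (s w, w)]; pose A := \bigcap_n [set w | U n (s w, w)].
have PA : P (Bs `&` A) != 0%E.
  apply/eqP => PA0; suff : (P H <= (fine (P H) / 2)%:E)%E.
    rewrite -[leLHS]fineK ?fin_num_measure// lee_fin => PH2.
    lra.
  apply: le_trans PU; have <- : P Bs = P (Bs `\` A).
    rewrite measureD//; last by rewrite ltey_eq fin_num_measure.
    by rewrite [X in (_ - X)%E](_ : _ = 0%E) ?sube0.
  by apply: le_measure; rewrite ?inE// => w /HB.
(* A stopping time of maximal mean in [S] is a.s. equal to its debuts in the
   [U n], hence lies in their right closures. *)
pose S := [set tau | stopping_time T G tau /\ forall w t, 0 <= t <= T ->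
  (forall n, U n (t, w)) -> tau w <= t].
have bS tau : S tau -> measurable_fun setT tau /\ forall w, 0 <= tau w <= T.
  by move=> [st _]; split; [exact: stopping_time_measurable|case: st].
have iS tau : S tau -> P.-integrable setT (EFin \o tau).
  move=> /bS[mtau tauT]; apply: measurable_bounded_integrable => //.
    by rewrite ltey_eq fin_num_measure.
  exists T; split; first exact: num_real.
  move=> M TM w _ /=; have /andP[t0 tT] := tauT w.
  by rewrite ger0_norm// (le_trans tT)// ltW.
pose m tau := fine (\int[P]_w (tau w)%:E).
have m_le tau tau' : S tau -> S tau' -> (forall w, tau w <= tau' w) ->
    m tau <= m tau'.
  move=> St St' tt'; rewrite fine_le//; [exact: integrable_fin_num (iS _ St)|
    exact: integrable_fin_num (iS _ St')|].
  by apply: le_integral => //; [exact: iS|exact: iS|move=> w _; rewrite lee_fin].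
have S0 : S (cst 0).
  by split; [exact: stopping_time_cst|move=> w t /andP[]].
have mT tau : S tau -> m tau <= T.
  move=> St; have [mtau tauT] := bS _ St.
  have -> : T = fine (\int[P]_w (cst T%:E w)).
    by rewrite integral_cst//= probability_setT mule1.
  rewrite fine_le//; first exact: integrable_fin_num (iS _ St).
    by rewrite integral_cst//= probability_setT mule1.
  apply: le_integral => //; first exact: iS.
    apply: (@eq_integrable _ _ _ _ _ _ (EFin \o cst T)) => //.
    apply: measurable_bounded_integrable => //.
      by rewrite ltey_eq fin_num_measure.
    exists T; split; first exact: num_real.
    by move=> M TM w _ /=; rewrite gtr0_norm// ltW.
  by move=> w _; rewrite lee_fin; have /andP[] := tauT w.
have hsup : has_sup [set m tau | tau in S].
  by split; [exists (m (cst 0)), (cst 0)|exists T => _ [tau St <-]; exact: mT].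
have /choice[tau_ tauP] : forall n, exists tau,
    S tau /\ sup [set m tau | tau in S] - n.+1%:R^-1 < m tau.
  move=> n; have n0 : 0 < n.+1%:R^-1 :> R by rewrite invr_gt0.
  by have [_ [tau St <-] lt] := sup_adherent n0 hsup; exists tau.
(* Both conditions defining [S] pass to countable suprema, so a maximising sequence yields a
   maximiser. *)
pose tau w := sup (range (fun n => tau_ n w)).
have tau_ge n w : tau_ n w <= tau w.
  apply: ub_le_sup; last by exists n.
  by exists T => _ [k _ <-]; have [/bS[_ /(_ w)/andP[]]] := tauP k.
have St : S tau.
  split; first by apply: stopping_time_sup => n; have [[]] := tauP n.
  move=> w t tT Ut; apply: ge_sup; first by exists (tau_ 0%N w), 0%N.
  by move=> _ [n _ <-]; have [[_ +] _] := tauP n; apply.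
have tau_max tau' : S tau' -> m tau' <= m tau.
  move=> St'; apply: (@le_trans _ _ (sup [set m tau | tau in S])).
    by apply: ub_le_sup; [case: hsup|exists tau'].
  apply/ler_addgt0Pr => e e'0.
  have [n ne] : exists n, n.+1%:R^-1 < e.
    by exists (Num.truncn e^-1); rewrite invf_plt ?posrE// truncnS_gt.
  have [Sn /ltW] := tauP n; rewrite lerBlDr => /le_trans; apply.
  by rewrite lerD// ?(ltW ne)//; apply: m_le => // w; exact: tau_ge.
have [tauG tauB] := St; have [mtau tauT] := bS _ St.
have Sdebut n : S (debut (U n) tau).
  split; first exact: (debut_stopping (Uo n) (UG n) tauG).
  move=> w t tT Ut; apply: debut_le => //.
  by rewrite (tauB w t)//=; case/andP: tT.
have debut_eq n : {ae P, forall w, debut (U n) tau w = tau w}.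
  have [md _] := bS _ (Sdebut n).
  have : ae_eq P setT (EFin \o (debut (U n) tau \- tau)) (cst 0%E).
    apply/ae_eq_integral_abs => //.
      by apply/measurable_EFinP; exact: measurable_funB.
    transitivity (\int[P]_w ((debut (U n) tau w)%:E - (tau w)%:E))%E.
      apply: eq_integral => w _ /=; rewrite ger0_norm//.
      by rewrite subr_ge0; exact: debut_ge.
    rewrite integralB_EFin//; [|exact: iS..].
    have := tau_max _ (Sdebut n); rewrite /m => le1.
    have ge1 : m tau <= m (debut (U n) tau).
      by apply: m_le => // w; exact: debut_ge.
    have E : m (debut (U n) tau) = m tau by apply/eqP; rewrite eq_le le1.
    rewrite -[X in (X - _)%E]fineK; last exact: integrable_fin_num (iS _ _).
    rewrite -[X in (_ - X)%E]fineK; last exact: integrable_fin_num (iS _ _).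
    by rewrite -EFinB -/(m _) -/(m tau) E subrr.
  by apply: filterS => w /(_ Logic.I)[] /eqP; rewrite subr_eq0 => /eqP.
have : {ae P, forall w, forall n, debut (U n) tau w = tau w} by exact/ae_foralln.
move=> eqN; have mBA : measurable (Bs `&` A) by exact: measurableI.
(* On [Bs] and [A], off a null set, [tau] lies in every right closure, so [(tau w, w)] is in [B]; by
   hypothesis that is a null event. *)
move/eqP: PA; apply; apply: measure_negligible => //.
apply: (negligibleS _ (negligibleU eqN (nB tau tauG))) => w [Bw Aw].
have [dE|ndE] := pselect (forall n, debut (U n) tau w = tau w); [right|by left].
apply: UB => //= n.
have sT : 0 <= s w <= T by have [+ _] := BD _ Bw; rewrite /= in_itv.
apply: (debut_right_closure (tauT w)) => //; exists (s w); last exact: Aw.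
rewrite (tauB w (s w))//; first by case/andP: sT.
by move=> k; exact: Aw.
Qed.

End optional_section.

(** * Quantiles and randomisation *)

Definition mfun_of {d1 d2} {T1 : measurableType d1} {T2 : measurableType d2}
    {f : T1 -> T2} (mf : measurable_fun setT f) : {mfun T1 >-> T2} :=
  HB.pack f (isMeasurableFun.Build _ _ _ _ f mf).

Section uniform.
Context {R : realType}.

Definition unif : probability (measurableTypeR R) R := uniform_prob (@ltr01 R).

Lemma unifE (A : set R) : measurable A ->
  unif A = lebesgue_measure (A `&` `[0, 1]).
Proof.
move=> mA; rewrite /unif/= /uniform_prob integral_uniform_pdf.
rewrite (eq_integral (fun=> 1%E)).
  by rewrite integral_cst ?mul1e//; exact: measurableI.
by move=> x; rewrite inE/= in_itv/= /uniform_pdf => -[_ ->]; rewrite subr0 invr1.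
Qed.

Lemma unif_ray (c : R) b : 0 <= c <= 1 ->
  unif [set` Interval -oo%O (BSide b c)] = c%:E.
Proof.
move=> /andP[c0 c1]; rewrite unifE; last exact: measurable_itv.
rewrite (_ : _ `&` _ = [set` Interval (BLeft 0) (BSide b c)]).
  rewrite lebesgue_measure_itv/= lte_fin; case: ltP => [_|c0'].
    by rewrite sube0.
  by congr EFin; apply/eqP; rewrite eq_le c0.
apply/seteqP; split => z /=; rewrite !in_itv/=; first by move=> [-> /andP[->]].
move=> /andP[-> zc]; split => //=.
by move: zc; case: b => /=; [move/ltW|]; move=> /le_trans; exact.
Qed.

End uniform.

Section quantile.
Context {R : realType} (T : R) (hT : 0 < T).
Implicit Types (x : gen_path T) (t z : R).

Definition quant x (z : R) : R := inf ([set t | 0 <= t <= T /\ z < x t] `|` [set T]).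

Lemma rand_timeE {d} {Omega : measurableType d} (rho : Omega -> gen_path T)
  (Z : Omega -> R) : rand_time rho Z = fun w => quant (rho w) (Z w).
Proof. by []. Qed.

Lemma quant_has_inf x z :
  has_inf ([set t | 0 <= t <= T /\ z < x t] `|` [set T]).
Proof.
split; first by exists T; right.
by exists 0 => t [[/andP[]]//|->]; exact: ltW.
Qed.

Lemma quant_itv x z : 0 <= quant x z <= T.
Proof.
apply/andP; split.
  by apply: lb_le_inf; [exists T; right|move=> t [[/andP[]]//|->]; exact: ltW].
by apply: ge_inf; [case: (quant_has_inf x z)|right].
Qed.

Lemma quant_le x z t : 0 <= t <= T -> z < x t -> quant x z <= t.
Proof. by move=> tT zt; apply: ge_inf; [case: (quant_has_inf x z)|left]. Qed.

Lemma quant_lt x z t : quant x z < t -> t <= T ->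
  exists u, [/\ 0 <= u, u < t & z < x u].
Proof.
move=> + tT; have [ne _] := quant_has_inf x z => /(inf_lt ne)[u].
move=> [[/andP[u0 _] zu] ut|-> /lt_le_trans/(_ tT)]; last by rewrite ltxx.
by exists u.
Qed.

Lemma gen_path_le1 x t : 0 <= t <= T -> 0 <= x t <= 1.
Proof.
move=> /andP[t0 tT]; apply/andP; split.
  by apply: (le_trans (gen_path_ge0 x)); apply: gen_path_nd.
by rewrite -(gen_path_T x); apply: gen_path_nd.
Qed.

(** Otherwise right-continuity gives [x s < z] slightly after [t], against the infimum. At [t = T]
    the conclusion fails for [z > 1]. *)
Lemma quant_ge x z t : 0 <= t < T -> quant x z <= t -> z <= x t.
Proof.
move=> tT qt; rewrite leNgt; apply/negP => xtz.
have [+ _] := gen_path_cadlag x => /(_ t tT) xr.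
have /andP[t0 tT'] := tT.
have H : \forall s \near t^'+, [/\ x s < z, t < s & s < T].
  near=> s; split; near: s.
  - exact: (cvgr_lt _ xr).
  - exact: nbhs_right_gt.
  - exact: nbhs_right_lt.
have [s [xsz ts sT]] := @filter_ex _ _ (at_right_proper_filter t) _ H.
have [u [u0 us zu]] := quant_lt (le_lt_trans qt ts) (ltW sT).
have := gen_path_nd x u0 (ltW us) (ltW sT).
by move=> /(lt_le_trans zu) /lt_trans/(_ xsz); rewrite ltxx.
Unshelve. all: by end_near. Qed.

Lemma measurable_quant {d dE} {Omega : measurableType d} {E : measurableType dE}
    (rho : Omega -> gen_path T) (p : E -> Omega) (z : E -> R) :
  (forall t, 0 <= t <= T -> measurable_fun setT (fun e => rho (p e) t)) ->
  measurable_fun setT z -> measurable_fun setT (fun e => quant (rho (p e)) (z e)).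
Proof.
move=> mrho mz mE; apply: (measurability _ (RGenInftyO.measurableE R)) => //.
move=> _ [_ [x ->] <-]; rewrite setTI.
have [Tx|xT] := ltP T x.
  rewrite (_ : _ @^-1` _ = setT); first exact: measurableT.
  apply/seteqP; split => // e _ /=; rewrite in_itv/=.
  by have /andP[_ /le_lt_trans] := quant_itv (rho (p e)) (z e); apply.
rewrite (_ : _ @^-1` _ = \bigcup_(q : rat) (if 0 <= (ratr q : R) < x then
    [set e | z e < rho (p e) (ratr q)] else set0)).
  apply: bigcupT_measurable_rat => q; case: ifPn => // /andP[q0 qx].
  rewrite -[X in measurable X]setTI.
  apply: measurable_fun_ltr => //; apply: mrho.
  by rewrite q0 (le_trans (ltW qx)).
apply/seteqP; split => e /=; rewrite in_itv/=.
  move=> /quant_lt /(_ xT)[u [u0 ux zu]].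
  have [q] := rat_in_itvoo ux; rewrite in_itv/= => /andP[uq qx].
  exists q => //; rewrite qx (le_trans u0 (ltW uq))/=.
  by apply: (lt_le_trans zu); rewrite gen_path_nd// ltW// (lt_le_trans qx).
move=> [q _]; case: ifPn => // /andP[q0 qx] zq.
by apply: le_lt_trans (qx); apply: quant_le => //; rewrite q0 (le_trans (ltW qx)).
Qed.

Lemma measurable_quant1 x : measurable_fun setT (quant x).
Proof.
exact: (@measurable_quant _ _ unit _ (fun=> x) (fun=> tt) id).
Qed.

(** For [t] in [0, T[ the event is caught between {z < x_t} and {z <= x_t}, which have the same
    uniform mass. *)
Lemma unif_quant_le x t : unif (quant x @^-1` `]-oo, t]) = (extend x t)%:E.
Proof.
rewrite /extend; case: ltP => [t0|t0].
  rewrite (_ : _ @^-1` _ = set0) ?measure0//; apply/seteqP; split => // z /=.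
  rewrite in_itv/= => /le_lt_trans/(_ t0).
  by have /andP[q0 _] := quant_itv x z; rewrite ltNge q0.
case: leP => [Tt|tT].
  rewrite (_ : _ @^-1` _ = setT) ?probability_setT//.
  apply/seteqP; split => // z _ /=; rewrite in_itv/=.
  by have /andP[_ /le_trans] := quant_itv x z; apply.
have tT' : 0 <= t <= T by rewrite t0 ltW.
have xt := gen_path_le1 x tT'.
apply/eqP; rewrite eq_le -{1}(unif_ray false xt) -(unif_ray true xt).
have mq : measurable (quant x @^-1` `]-oo, t]).
  by rewrite -[X in measurable X]setTI; exact: measurable_quant1.
apply/andP; split; apply: le_measure; rewrite ?inE//; try exact: measurable_itv.
  by move=> z /=; rewrite !in_itv/= => qt; apply: quant_ge => //; rewrite t0.
by move=> z /=; rewrite !in_itv/=; exact: quant_le.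
Qed.

(** Both sides give []a, b]] the increment of the extended path, and these intervals determine the
    measure. *)
Lemma stieltjesE x (A : set R) : measurable A ->
  stieltjes x A = unif (quant x @^-1` A).
Proof.
have mq := measurable_quant1 x.
pose nu : {measure set (measurableTypeR R) -> \bar R} :=
  distribution unif (mfun_of (mq : measurable_fun setT
    (quant x : measurableTypeR R -> measurableTypeR R))).
move=> mA; rewrite /stieltjes.
apply: (@lebesgue_stieltjes_measure_unique _ (extend x) nu) => // X [[a b] _ <-].
rewrite /lebesgue_stieltjes_measure/= /measure_extension/=.
rewrite measurable_mu_extE/=; last exact: is_ocitv.
have nuE t : nu `]-oo, t]%classic = (extend x t)%:E by exact: unif_quant_le.
have mle t : measurable (quant x @^-1` `]-oo, t]).
  by rewrite -[X in measurable X]setTI; exact: measurable_quant1.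
have [ab|ba] := leP a b; last first.
  by rewrite set_itv_ge ?measure0// -leNgt bnd_simp ltW.
rewrite wlength_itv_bnd// (_ : [set` _] = `]-oo, b] `\` `]-oo, a]).
  transitivity (nu `]-oo, b]%classic - nu (`]-oo, b]%classic `&` `]-oo, a]%classic))%E; last first.
    apply/esym/measureD; [exact: mle|exact: mle|].
    by have := nuE b; rewrite /nu/= => ->; rewrite ltry.
  rewrite (_ : _ `&` _ = `]-oo, a]%classic); first by rewrite !nuE EFinB.
  apply/seteqP; split => z /=; first by case.
  by rewrite !in_itv/= => za; split => //; exact: le_trans ab.
apply/seteqP; split => z /=; rewrite !in_itv/=.
  by move=> /andP[az ->]; split => //; apply/negP; rewrite -ltNge.
by move=> [-> /negP]; rewrite -ltNge => ->.
Qed.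

(* By monotonicity the left limit in [jump] exists. *)
Lemma jumpE x t : stieltjes x [set t] = (jump x t)%:E.
Proof.
have nd := @extend_nd _ _ x.
have cl : cvg (extend x s @[s --> t^'-]).
  apply: nondecreasing_at_left_is_cvgr.
    by near=> u; move=> a b _ _; exact: nd.
  near=> u; exists (extend x t); move=> _ [v /= + <-].
  rewrite in_itv/= => /andP[_ vt].
  by apply: nd; exact: ltW.
have seq_l : extend x (t - n.+1%:R^-1) @[n --> \oo] --> lim (extend x s @[s --> t^'-]).
  move/cvg_at_leftP : cl; apply; split => [n|]; first by rewrite gtrBl invr_gt0.
  rewrite -[X in _ --> X]subr0; apply: cvgB; first exact: cvg_cst.
  exact: cvg_harmonic.
have mF n : measurable (`]t - n.+1%:R^-1, t]%classic : set R) by exact: measurable_itv.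
have stE n : stieltjes x `]t - n.+1%:R^-1, t] =
    (extend x t - extend x (t - n.+1%:R^-1))%:E.
  rewrite /stieltjes /lebesgue_stieltjes_measure/= /measure_extension/=.
  rewrite measurable_mu_extE/=; last exact: is_ocitv.
  by rewrite wlength_itv_bnd// gerBl invr_ge0.
have lim1 : stieltjes x `]t - n.+1%:R^-1, t] @[n --> \oo] --> stieltjes x [set t].
  rewrite set1_bigcap_oc; apply: (@nonincreasing_cvg_mu _ _ _ (stieltjes x)) => //.
  - exact: (eq_ind_r (fun e => (e < +oo)%E) (ltry _) (stE 0%N)).
  - exact: bigcapT_measurable.
  - move=> m n mn; apply/subsetPset => u /=; rewrite !in_itv/= => /andP[tu ->].
    rewrite andbT; apply: le_lt_trans tu; rewrite lerD2l lerN2.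
    by rewrite lef_pV2 ?posrE// ler_nat.
have lim2 : stieltjes x `]t - n.+1%:R^-1, t] @[n --> \oo] --> (jump x t)%:E.
  under eq_fun do rewrite stE.
  apply: cvg_EFin; first by near=> n.
  by apply: cvgB => //; exact: cvg_cst.
exact: (cvg_unique _ lim1 lim2).
Unshelve. all: by end_near. Qed.

End quantile.

(** * Integrating out an independent uniform device *)

Section independence.
Context {R : realType} {d dE : measure_display} {Omega : measurableType d}
  {E : measurableType dE} (P : probability Omega R).

(** Needed to pass from rectangles to the joint law of an outcome and a device; the product identity
    is stable under complements and disjoint unions. *)
Lemma dynkin_independence (Q : set_system E) (X : Omega -> E) (D : set Omega) :
  @measurable _ E = <<s Q >> -> setI_closed Q ->
  measurable_fun setT X -> measurable D ->
  (forall A, Q A -> P (X @^-1` A `&` D) = P (X @^-1` A) * P D)%E ->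
  forall A, measurable A -> (P (X @^-1` A `&` D) = P (X @^-1` A) * P D)%E.
Proof.
move=> QE QI mX mD QD.
have mXA A : measurable A -> measurable (X @^-1` A).
  by move=> mA; rewrite -[X in measurable X]setTI; exact: mX.
move=> A; rewrite QE; move: A.
apply: (dynkin_induction QE QI) => //.
- by rewrite preimage_setT setTI probability_setT mul1e.
- move=> A mA AD; rewrite preimage_setC setIC -setDE.
  have -> : P (D `\` X @^-1` A) = (P D - P (X @^-1` A `&` D))%E.
    rewrite [X in (_ - P X)%E]setIC; apply: measureD => //; first exact: mXA.
    by rewrite ltey_eq fin_num_measure.
  rewrite AD probability_setC; last exact: mXA.
  rewrite -[P (X @^-1` A)]fineK ?fin_num_measure//; last exact: mXA.
  rewrite -[P D]fineK ?fin_num_measure//.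
  by rewrite -[1%E]/(1%:E)%E -!(EFinM, EFinB) mulrBl mul1r.
- move=> A mA tA AD; rewrite preimage_bigcup setI_bigcupl.
  have tXA : trivIset setT (fun n => X @^-1` A n).
    by apply/trivIsetP => i j _ _ ij; rewrite -preimage_setI;
      move/trivIsetP : tA => /(_ _ _ Logic.I Logic.I ij) ->.
  rewrite measure_bigcup//=; last 2 first.
    by move=> i _; apply: measurableI => //; exact: mXA.
    by apply: trivIset_setIr; exact: tXA.
  rewrite measure_bigcup//=; last by move=> i _; exact: mXA.
  rewrite (eq_eseriesr (g := fun i => (fine (P D))%:E * P (X @^-1` A i))%E);
    last first.
    by move=> i _; rewrite AD muleC fineK ?fin_num_measure.
  rewrite nneseriesZl; last by move=> i _; exact: measure_ge0.
  by rewrite muleC fineK ?fin_num_measure.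
Qed.

Variables (X : Omega -> E) (Z : Omega -> measurableTypeR R)
  (phi : E * measurableTypeR R -> R) (M : Omega -> R).
Hypotheses (mX : measurable_fun setT X) (mZ : measurable_fun setT Z)
  (XZ : forall A B, measurable A -> measurable B ->
     (P (X @^-1` A `&` Z @^-1` B) = P (X @^-1` A) * unif B)%E)
  (mphi : measurable_fun setT phi)
  (phiM : forall w z, `|phi (X w, z)| <= M w)
  (iM : P.-integrable setT (EFin \o M)).

Let LX : probability E R := distribution P (mfun_of mX).

Let mXZ : measurable_fun setT (fun w => (X w, Z w)).
Proof. exact: measurable_fun_pair. Qed.

Let LXZ : probability (E * measurableTypeR R)%type R := distribution P (mfun_of mXZ).

Let LXZE (A : set (E * measurableTypeR R)) : measurable A -> (LX \x unif)%E A = LXZ A.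
Proof. by move=> mA; apply: product_measure_unique => // B C mB mC; exact: XZ. Qed.

Let iphiXZ : P.-integrable setT (EFin \o phi \o (fun w => (X w, Z w))).
Proof.
apply: (le_integrable _ _ _ iM) => //.
  by apply/measurable_EFinP; exact: (measurableT_comp mphi mXZ).
by move=> w _ /=; rewrite lee_fin (le_trans (phiM w (Z w)))// ler_norm.
Qed.

Let iphi : (LX \x unif)%E.-integrable setT (EFin \o phi).
Proof.
have mphi' : measurable_fun setT (EFin \o phi) by exact/measurable_EFinP.
apply/integrableP; split => //.
rewrite (eq_measure_integral LXZ); last by move=> A mA _; exact: LXZE.
have := @integrable_pushforward _ _ _ _ _ _ mXZ P setT _ mphi' iphiXZ measurableT.
by move/integrableP => [].
Qed.

Let intE : (\int[P]_w (phi (X w, Z w))%:E =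
  \int[LX \x unif]_p (phi p)%:E)%E.
Proof.
have mphi' : measurable_fun setT (EFin \o phi) by exact/measurable_EFinP.
rewrite [RHS](eq_measure_integral LXZ); last by move=> A mA _; exact: LXZE.
have := @integral_pushforward _ _ _ _ _ _ mXZ P setT _ mphi' iphiXZ measurableT.
by move=> ->.
Qed.

Let integral_X z : (\int[P]_w (phi (X w, z))%:E = \int[LX]_e (phi (e, z))%:E)%E.
Proof.
have mz : measurable_fun setT (fun e => (phi (e, z))%:E).
  by apply/measurable_EFinP/(measurableT_comp mphi); exact: measurable_pair2.
have iz : P.-integrable (X @^-1` setT) ((fun e => (phi (e, z))%:E) \o X).
  rewrite preimage_setT; apply: (le_integrable _ _ _ iM) => //.
    exact: (measurableT_comp mz mX).
  by move=> w _ /=; rewrite lee_fin (le_trans (phiM w z))// ler_norm.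
exact/esym/(@integral_pushforward _ _ _ _ _ _ mX P setT _ mz iz measurableT).
Qed.

(** Device outside: for the player's own device, whose values index a family of stopping times. *)
Lemma independent_fubini_G : (\int[P]_w (phi (X w, Z w))%:E =
  \int[unif]_z \int[P]_w (phi (X w, z))%:E)%E.
Proof.
rewrite intE -integral21_prod_meas1//; apply: eq_integral => z _.
exact/esym/integral_X.
Qed.

Lemma independent_measurable_G :
  measurable_fun setT (fun z => \int[P]_w (phi (X w, z))%:E)%E.
Proof.
have mG := measurable_fubini_G iphi.
apply: (eq_measurable_fun _ _ mG) => z _; exact/esym/integral_X.
Qed.

Let mF : measurable_fun setT (fun e => \int[unif]_z (phi (e, z))%:E)%E.
Proof. exact: (measurable_fubini_F iphi). Qed.

Lemma independent_integrable :
  P.-integrable setT (fun w => \int[unif]_z (phi (X w, z))%:E)%E.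
Proof.
apply: (le_integrable _ _ _ iM) => //; first exact: (measurableT_comp mF mX).
move=> w _; apply: le_trans (le_abse_integral _ _ _) _ => //.
  apply/measurable_EFinP/(measurableT_comp mphi); exact: measurable_pair1.
apply: le_trans (_ : (\int[unif]_z (M w)%:E <= _)%E); last first.
  rewrite integral_cst// [X in (_ * X <= _)%E](_ : _ = 1%E).
    by rewrite mule1 lee_fin ler_norm.
  exact: (probability_setT unif).
apply: ge0_le_integral => //.
- apply/measurable_EFinP; apply: measurableT_comp => //.
  by apply: (measurableT_comp mphi); exact: measurable_pair1.
- by move=> z _; rewrite lee_fin phiM.
Qed.

(** Device inside: for the opponent's device, averaged at a fixed outcome. *)
Lemma independent_fubini_F : (\int[P]_w (phi (X w, Z w))%:E =
  \int[P]_w \int[unif]_z (phi (X w, z))%:E)%E.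
Proof.
rewrite intE -integral12_prod_meas1//.
have := @integral_pushforward _ _ _ _ _ _ mX P setT _ mF.
by rewrite preimage_setT => /(_ independent_integrable measurableT).
Qed.

End independence.

(** * Payoffs against a fixed opponent *)

Section envelope.
Context {R : realType} (T : R) (hT : 0 < T).

Lemma near_left_right (Q : R -> Prop) (t : R) :
  (\forall s \near t^'-, Q s) -> (\forall s \near t^'+, Q s) -> Q t ->
  \forall s \near t, Q s.
Proof.
rewrite !near_withinE => Ql Qr Qt; near=> s.
have [st|ts|->] := ltgtP s t; last by [].
- by move: st; near: s.
- by move: ts; near: s.
Unshelve. all: by end_near. Qed.

(** One-sided limits bound the path near each time, and [0, T] is compact. *)
Lemma cadlag_bounded (x : R -> R) : cadlag_path T x ->
  exists K, forall t, 0 <= t <= T -> `|x t| <= K.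
Proof.
move=> [xr xl].
have loc (t : R) : 0 <= t <= T -> exists K, \forall s \near t,
    0 <= s <= T -> `|x s| <= K.
  move=> /andP[t0 tT].
  have [Kl HKl] : exists K, \forall s \near t^'-, 0 <= s <= T -> `|x s| <= K.
    have [t0'|t0'] := ltP 0 t; last first.
      exists 0; near=> s => /andP[s0 _].
      have : s < t by near: s; exact: nbhs_left_lt.
      by move=> /lt_le_trans/(_ t0'); rewrite ltNge s0.
    have tt : 0 < t <= T by rewrite t0'.
    have /cvg_ex[/= l xl'] := xl t tt.
    exists (`|l| + 1); near=> s => _; near: s.
    by apply: cvgr_norm_le xl' _ _; rewrite ltrDl.
  have [Kr HKr] : exists K, \forall s \near t^'+, 0 <= s <= T -> `|x s| <= K.
    have [tT'|tT'] := ltP t T; last first.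
      exists 0; near=> s => /andP[_ sT].
      have : t < s by near: s; exact: nbhs_right_gt.
      by move=> /(le_lt_trans tT'); rewrite ltNge sT.
    exists (`|x t| + 1); near=> s => _; near: s.
    by apply: cvgr_norm_le; [apply: xr; rewrite t0|rewrite ltrDl].
  exists (Num.max (Num.max Kl Kr) `|x t|); apply: near_left_right.
  - by apply: filterS HKl => s + sT => /(_ sT); rewrite !le_max => ->.
  - by apply: filterS HKr => s + sT => /(_ sT); rewrite !le_max => ->; rewrite orbT.
  - by move=> _; rewrite le_max lexx orbT.
have := (@compact_near_coveringP _ `[0, T]).1 (@segment_compact _ 0 T).
move=> /(_ _ (pinfty_nbhs R) (fun K s => 0 <= s <= T -> `|x s| <= K) _).
have H : forall s, `[0, T]%classic s -> \forall s' \near s & i \near +oo,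
    0 <= s' <= T -> `|x s'| <= i.
  move=> t /=; rewrite in_itv/= => /loc[K HK].
  exists ([set s | 0 <= s <= T -> `|x s| <= K], [set i | K <= i]) => /=.
    by split => //; apply: nbhs_pinfty_ge; exact: num_real.
  by move=> [s i] /= [xK Ki] /xK /le_trans; apply.
move=> /(_ H) [K [_ HK]]; exists (K + 1) => t tT.
by apply: (HK (K + 1)) => //=; rewrite ?ltrDl// in_itv.
Unshelve. all: by end_near. Qed.

Definition envelope {Omega : Type} (X : R -> Omega -> R) (w : Omega) : R :=
  sup [set `|X t w| | t in `[0, T]].

Section envelope_lemmas.
Context {d : measure_display} {Omega : measurableType d}.
Variable X : R -> Omega -> R.
Hypothesis cX : cadlag T X.

Lemma envelope_ub w t : 0 <= t <= T -> `|X t w| <= envelope X w.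
Proof.
move=> tT; have [K XK] := cadlag_bounded (cX w).
apply: ub_le_sup; first by exists K => _ [s /= + <-]; rewrite in_itv/=; exact: XK.
by exists t => //=; rewrite in_itv.
Qed.

Lemma envelope_ge0 w : 0 <= envelope X w.
Proof.
have T0 : 0 <= (0 : R) <= T by rewrite lexx ltW.
exact: le_trans (envelope_ub w T0).
Qed.

(** Right-continuity leaves countably many times, which makes the supremum measurable. Rationals
    beyond [T] clamp to [T], so an irrational [T] is covered as well. *)
Lemma envelope_rat w : envelope X w =
  sup (range (fun n : nat => `|X (clamp T (ratr (odflt 0 (unpickle n : option rat)))) w|)).
Proof.
have [K XK] := cadlag_bounded (cX w).
have ub1 : has_ubound (range (fun n : nat =>
    `|X (clamp T (ratr (odflt 0 (unpickle n : option rat)))) w|)).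
  by exists K => _ [n _ <-]; apply: XK; exact: clamp_itv.
apply/eqP; rewrite eq_le; apply/andP; split; apply: ge_sup.
- by exists `|X 0 w|, 0 => //=; rewrite in_itv/= lexx ltW.
- move=> _ [t /= + <-]; rewrite in_itv/= => tT.
  have ubq (p : rat) : `|X (clamp T (ratr p)) w| <=
     sup (range (fun n : nat => `|X (clamp T (ratr (odflt 0 (unpickle n : option rat)))) w|)).
    by apply: ub_le_sup => //; exists (pickle p) => //; rewrite pickleK.
  have /andP[t0] := tT; rewrite le_eqVlt => /orP[/eqP ->|tT'].
    have [p Tp] : exists p : rat, T < ratr p.
      have TT1 : T < T + 1 by rewrite ltrDl.
      have [p] := rat_in_itvoo TT1.
      by rewrite in_itv/= => /andP[Tp _]; exists p.
    by have := ubq p; rewrite /clamp min_r ?max_r// ltW.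
  rewrite leNgt; apply/negP => lt_sup.
  have [xr _] := cX w.
  have Xr : `|X s w| @[s --> t^'+] --> `|X t w|.
    by apply: cvg_norm; apply: xr; rewrite t0.
  have [e /= e0 eP] := cvgr_gt _ Xr _ lt_sup.
  have : t < Num.min (t + e) T by rewrite lt_min ltrDl e0.
  move=> /rat_in_itvoo[p]; rewrite in_itv/= lt_min => /andP[tp /andP[pe pT]].
  have := eP (ratr p) _ tp; rewrite /= ltr0_norm ?subr_lt0// opprB ltrBlDl.
  move=> /(_ pe); rewrite ltNge -(clampK (T := T) (t := ratr p)) ?ubq//.
  by rewrite (le_trans t0 (ltW tp)) ltW.
- by exists (`|X (clamp T (ratr (odflt 0 (unpickle 0%N : option rat)))) w|), 0%N.
- by move=> _ [n _ <-]; apply: envelope_ub; exact: clamp_itv.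
Qed.

Lemma measurable_envelope :
  (forall t, 0 <= t <= T -> measurable_fun setT (X t)) ->
  measurable_fun setT (envelope X).
Proof.
move=> mX; pose Y (n : nat) w :=
  `|X (clamp T (ratr (odflt 0 (unpickle n : option rat)))) w|.
rewrite (_ : envelope X = fun w => sups (Y ^~ w) 0); last first.
  apply/funext => w; rewrite envelope_rat /sups /sdrop; congr sup.
  by apply/seteqP; split => [_ [k _ <-]|_ [k _ <-]]; exists k.
apply: measurable_fun_sups.
  move=> w _; have [K XK] := cadlag_bounded (cX w).
  by exists K => _ [n _ <-]; apply: XK; exact: clamp_itv.
move=> n; apply: measurableT_comp => //; apply: mX; exact: clamp_itv.
Qed.

Lemma integrable_envelope (P : probability Omega R) :
  (forall t, 0 <= t <= T -> measurable_fun setT (X t)) -> Lb T P X ->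
  P.-integrable setT (EFin \o envelope X).
Proof.
move=> mX [_ _ lX]; apply/integrableP; split.
  by apply/measurable_EFinP; exact: measurable_envelope.
apply: le_lt_trans lX; rewrite le_eqVlt; apply/orP; left; apply/eqP.
apply: eq_integral => w _ /=; rewrite ger0_norm ?envelope_ge0//.
apply/eqP; rewrite eq_le; apply/andP; split.
  have [K XK] := cadlag_bounded (cX w).
  rewrite /envelope -ereal_sup_EFin.
  - rewrite image_comp//.
  - by exists K => _ [t /= + <-]; rewrite in_itv/=; exact: XK.
  - by exists `|X 0 w|, 0 => //=; rewrite in_itv/= lexx ltW.
apply: ge_ereal_sup => _ [t /= + <-]; rewrite in_itv/= => tT.
by rewrite lee_fin; exact: envelope_ub.
Qed.

End envelope_lemmas.
End envelope.

Section path_payoffs.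
Context {R : realType} (T : R) (hT : 0 < T).
Implicit Types (x : gen_path T) (b : R -> R).

Lemma measurable_cadlag_path b : cadlag_path T b ->
  measurable_fun setT (fun t => b (clamp T t)).
Proof.
move=> cb.
have cX : cadlag T (fun t (_ : unit) => b t) by [].
apply: (measurable_cadlag hT (p := fun=> tt) cX).
- by move=> t _; exact: measurable_cst.
- exact: measurable_clamp.
- exact: clamp_itv.
Qed.

Lemma measurable_cadlag_itv b : cadlag_path T b ->
  measurable_fun `[0, T] b.
Proof.
move=> cb; apply: (eq_measurable_fun (fun t => b (clamp T t))).
  by move=> t; rewrite inE/= in_itv/= => tT; rewrite clampK.
by apply: measurable_funS (measurable_cadlag_path cb).
Qed.

Lemma stieltjes_lty x (A : set R) : measurable A -> (stieltjes x A < +oo)%E.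
Proof.
move=> mA; rewrite stieltjesE//.
have mq : measurable (quant x @^-1` A).
  by rewrite -[X in measurable X]setTI; exact: measurable_quant1.
apply: le_lt_trans (probability_le1 unif mq) _; exact: ltry.
Qed.

Lemma integrable_stieltjes x b : cadlag_path T b ->
  (stieltjes x).-integrable `[0, T] (EFin \o b).
Proof.
move=> cb; apply: measurable_bounded_integrable => //.
- exact: stieltjes_lty.
- exact: measurable_cadlag_itv.
- have [K bK] := cadlag_bounded cb.
  exists K; split; first exact: num_real.
  move=> M KM t /=; rewrite in_itv/= => tT.
  by rewrite (le_trans (bK t tT))// ltW.
Qed.

Lemma integrable_stieltjesS x b (D : set (measurableTypeR R)) :
  cadlag_path T b -> measurable D -> D `<=` `[0, T] ->
  (stieltjes x).-integrable D (EFin \o b).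
Proof.
move=> cb mD DT; apply: (integrableS _ mD DT (integrable_stieltjes x cb)).
exact: measurable_itv.
Qed.

Lemma Rintegral_stieltjes_split x b (s t : R) : cadlag_path T b ->
  0 <= s <= t -> t <= T ->
  \int[stieltjes x]_(u in `[0, t[) b u =
  \int[stieltjes x]_(u in `[0, s[) b u + \int[stieltjes x]_(u in `[s, t[) b u.
Proof.
move=> cb /andP[s0 st] tT.
have E : `[0, t[%classic = `[0, s[%classic `|` `[s, t[%classic.
  apply/seteqP; split => u /=; rewrite !in_itv/=.
    by move=> /andP[u0 ut]; have [us|su] := ltP u s; [left; rewrite u0|right].
  by move=> [/andP[-> /lt_le_trans]|/andP[/(le_trans s0) ->]//]; apply.
rewrite {1}E Rintegral_setU//.
  rewrite -E; apply: integrable_stieltjesS => // u /=.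
  by rewrite !in_itv/= => /andP[-> /ltW/le_trans]; apply.
apply/disj_setPS => u /= []; rewrite !in_itv/= => /andP[_ us] /andP[su _].
by move: us; rewrite ltNge su.
Qed.

Lemma unif_quant_gt x (s : R) : 0 <= s <= T ->
  unif [set z | s < quant x z] = (1 - x s)%:E.
Proof.
move=> sT; have mle : measurable (quant x @^-1` `]-oo, s]).
  by rewrite -[X in measurable X]setTI; exact: measurable_quant1.
rewrite (_ : [set z | _] = ~` (quant x @^-1` `]-oo, s])).
  rewrite probability_setC//; have /= -> := unif_quant_le hT x s.
  rewrite -[1%E]/(1%:E)%E -EFinB /extend; have /andP[s0 sT'] := sT.
  rewrite ltNge s0/=; case: leP => // Ts.
  suff -> : s = T by rewrite gen_path_T.
  by apply/eqP; rewrite eq_le sT'.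
apply/seteqP; split => z /=; rewrite in_itv/= ltNge; first by move/negP.
by move=> /negP.
Qed.

Lemma unif_quant_eq x (s : R) : unif [set z | quant x z = s] = (jump x s)%:E.
Proof. by rewrite -jumpE// stieltjesE. Qed.

(** Against the path [x], the opponent stops after [s] with probability [1 - x s], at [s] with
    probability [jump x s], and before [s] according to the law of [quant x], which is the Stieltjes
    measure. *)
Lemma path_payoffE x b (s A B : R) : cadlag_path T b -> 0 <= s <= T ->
  \int[unif]_(z in setT) (if s < quant x z then A
    else if s == quant x z then B else b (quant x z)) =
  A * (1 - x s) + \int[stieltjes x]_(u in `[0, s[) b u + B * jump x s.
Proof.
move=> cb sT; have mq := measurable_quant1 hT x.
have qT z : 0 <= quant x z <= T by exact: quant_itv.
have mbq : measurable_fun setT (fun z => b (quant x z)).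
  rewrite (_ : (fun z => _) = (fun t => b (clamp T t)) \o quant x).
    exact: measurableT_comp (measurable_cadlag_path cb) mq.
  by apply/funext => z /=; rewrite clampK.
pose f z := if s < quant x z then A
    else if s == quant x z then B else b (quant x z).
have mf : measurable_fun setT f.
  apply: measurable_fun_ifT; [exact: measurable_fun_ltr|exact: measurable_cst|].
  by apply: measurable_fun_ifT; [exact: measurable_fun_eqr|exact: measurable_cst|].
have [K bK] := cadlag_bounded cb.
have fi : unif.-integrable setT (EFin \o f).
  apply: measurable_bounded_integrable => //.
    apply: le_lt_trans (probability_le1 unif measurableT) _; exact: ltry.
  exists (Num.max (Num.max `|A| `|B|) K); split; first exact: num_real.
  move=> M KM z _ /=; apply: le_trans (ltW KM); rewrite /f !le_max.
  case: ifP => _; first by rewrite lexx.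
  by case: ifP => _; [rewrite lexx orbT|rewrite bK ?orbT].
pose Dgt := [set z | s < quant x z]; pose Deq := [set z | quant x z = s].
pose Dlt := quant x @^-1` `[0, s[.
have mpre (I : interval R) : measurable (quant x @^-1` [set` I]).
  by rewrite -[X in measurable X]setTI; exact: mq.
have mgt : measurable Dgt.
  rewrite (_ : Dgt = quant x @^-1` `]s, +oo[)//.
  by apply/seteqP; split => z /=; rewrite in_itv/= andbT.
have meq : measurable Deq by have := mq measurableT _ (measurable_set1 s); rewrite setTI.
have mlt : measurable Dlt by exact: mpre.
have ET : [set: measurableTypeR R] = Dgt `|` (Deq `|` Dlt).
  apply/seteqP; split => // z _; rewrite /Dgt /Deq /Dlt /= in_itv/=.
  by case: (ltgtP s (quant x z)) => h; [left|right; right; rewrite andbT;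
    case/andP: (qT z)|right; left].
have fiS (D : set (measurableTypeR R)) : measurable D ->
    unif.-integrable D (EFin \o f).
  by move=> mD; apply: integrableS fi.
rewrite ET Rintegral_setU//; last 3 first.
- exact: measurableU.
- by rewrite -ET.
- apply/disj_setPS => z /= []; rewrite /Dgt/= => sq [|]; rewrite /Deq/Dlt/=.
    by move=> qs; move: sq; rewrite qs ltxx.
  by rewrite in_itv/= => /andP[_ /(lt_trans sq)]; rewrite ltxx.
rewrite Rintegral_setU//; last 2 first.
- by apply: fiS; exact: measurableU.
- apply/disj_setPS => z /= []; rewrite /Deq/Dlt/= => ->.
  by rewrite in_itv/= ltxx andbF.
rewrite (_ : \int[unif]_(z in Dgt) _ = A * (1 - x s)); last first.
  rewrite (@eq_Rintegral _ _ _ _ _ (cst A)); last first.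
    by move=> z; rewrite inE /Dgt/= => ->.
  by rewrite Rintegral_cst// -[1 - x s]/(fine (1 - x s)%:E) -(unif_quant_gt x sT).
rewrite (_ : \int[unif]_(z in Deq) _ = B * jump x s); last first.
  rewrite (@eq_Rintegral _ _ _ _ _ (cst B)); last first.
    by move=> z; rewrite inE /Deq/= => ->; rewrite ltxx eqxx.
  by rewrite Rintegral_cst// -[jump x s]/(fine (jump x s)%:E) -unif_quant_eq.
rewrite -addrA; congr (_ + _); rewrite addrC; congr (_ + _).
rewrite (@eq_Rintegral _ _ _ _ _
  (fun z : measurableTypeR R => b (clamp T (quant x z)))); last first.
  move=> z; rewrite inE /Dlt/= in_itv/= => /andP[_ qs].
  by rewrite ltNge (ltW qs)/= gt_eqF// clampK.
have mq' : measurable_fun setT (quant x : measurableTypeR R -> measurableTypeR R).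
  exact: mq.
pose nu : {measure set (measurableTypeR R) -> \bar R} :=
  distribution unif (mfun_of mq').
have mbc : measurable_fun [set: measurableTypeR R] (EFin \o (fun t => b (clamp T t))).
  by apply/measurable_EFinP; exact: measurable_cadlag_path.
have ibc : unif.-integrable Dlt ((EFin \o (fun t => b (clamp T t))) \o quant x).
  have := fiS _ mlt; apply: eq_integrable => //.
  move=> z; rewrite inE /Dlt/= in_itv/= => /andP[_ qs].
  by rewrite /f ltNge (ltW qs)/= gt_eqF// clampK.
rewrite /Rintegral.
have := @integral_pushforward _ _ _ _ _ _ mq' unif `[0, s[%classic _ mbc ibc.
move=> /(_ (measurable_itv _)) /= <-; congr fine.
rewrite [RHS](eq_measure_integral nu); last first.
  by move=> C mC _; exact: stieltjesE.
apply: eq_integral => [|u]; first exact: mq.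
rewrite inE/= in_itv/= => /andP[u0 us].
have /andP[_ sT'] := sT.
by rewrite clampK// u0 (le_trans (ltW us)).
Qed.

End path_payoffs.

(** * Payoff of a stopping time against a randomised opponent *)

Section player.
Context {R : realType} (T : R) (hT : 0 < T) {d : measure_display}
  {Omega : measurableType d} (P : probability Omega R).
Variable F : R -> set_system Omega.
Hypothesis hF : filtration T P F.
Variables (a b h : R -> Omega -> R) (rho : Omega -> gen_path T).
Hypotheses (ha : Lb T P a) (hb : Lb T P b) (hh : Lb T P h).
Hypotheses (aa : adapted T F a) (ab : adapted T F b) (ah : adapted T F h).
Hypothesis arho : adapted T F (fun t w => rho w t).

Let TT : 0 <= T <= T. Proof. by rewrite lexx ltW. Qed.
Let FT_sigma : sigma_algebra setT (F T). Proof. exact: (filtration_sigma hF). Qed.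
Let FT_sub : F T `<=` measurable. Proof. exact: (filtration_sub hF). Qed.

Notation OT := (g_sigma_algebraType (F T)).

Lemma adapted_FT X t : adapted T F X -> 0 <= t <= T ->
  measurable_fun [set: OT] (X t).
Proof.
move=> aX tT; apply/(sub_measurableE _ FT_sigma) => B mB.
have /andP[t0 tT'] := tT.
by apply: (filtration_le hF t0 tT') => //; exact: aX.
Qed.

Lemma adapted_measurable X t : adapted T F X -> 0 <= t <= T ->
  measurable_fun [set: Omega] (X t).
Proof.
by move=> aX tT; exact: (sub_measurable_fun (filtration_sub hF tT) (aX t tT)).
Qed.

Lemma measurable_idT : measurable_fun [set: Omega] (id : Omega -> OT).
Proof.
move=> _ B; rewrite setTI preimage_id.
by rewrite -(sigma_algebraE FT_sigma) => /FT_sub.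
Qed.

Let measurable_process X {dE} {E : measurableType dE} (s : E -> R) (p : E -> OT) :
  Lb T P X -> adapted T F X -> measurable_fun setT s -> (forall e, 0 <= s e <= T) ->
  measurable_fun setT p -> measurable_fun setT (fun e => X (s e) (p e)).
Proof.
move=> [cX _ _] aX ms sT mp; apply: (measurable_cadlag hT (p := p) cX) => // t tT.
exact: (measurableT_comp (adapted_FT aX tT) mp).
Qed.

Definition pay (s t : R) (w : Omega) : R :=
  if s < t then a s w else if s == t then h s w else b t w.

Lemma measurable_pay {dE} {E : measurableType dE} (s t : E -> R) (p : E -> OT) :
  measurable_fun setT s -> (forall e, 0 <= s e <= T) ->
  measurable_fun setT t -> (forall e, 0 <= t e <= T) ->
  measurable_fun setT p -> measurable_fun setT (fun e => pay (s e) (t e) (p e)).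
Proof.
move=> ms sT mt tT mp; apply: measurable_fun_ifT.
- exact: measurable_fun_ltr.
- exact: measurable_process.
- apply: measurable_fun_ifT; first exact: measurable_fun_eqr.
    exact: measurable_process.
  exact: measurable_process.
Qed.

Definition payoff_bound w := envelope T a w + envelope T b w + envelope T h w.

Lemma pay_bound s t w : 0 <= s <= T -> 0 <= t <= T -> `|pay s t w| <= payoff_bound w.
Proof.
move=> sT tT; have [[ca _ _] [cb _ _] [ch _ _]] := And3 ha hb hh.
have a0 := envelope_ge0 hT ca w; have b0 := envelope_ge0 hT cb w.
have h0 := envelope_ge0 hT ch w.
rewrite /pay /payoff_bound; case: ifP => _.
  by have := envelope_ub ca w sT; lra.
by case: ifP => _; [have := envelope_ub ch w sT|have := envelope_ub cb w tT]; lra.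
Qed.

Lemma integrable_pay_bound : P.-integrable setT (EFin \o payoff_bound).
Proof.
have [[ca _ _] [cb _ _] [ch _ _]] := And3 ha hb hh.
have ia := integrable_envelope hT ca (fun t => adapted_measurable aa) ha.
have ib := integrable_envelope hT cb (fun t => adapted_measurable ab) hb.
have ih := integrable_envelope hT ch (fun t => adapted_measurable ah) hh.
apply: (eq_integrable measurableT ((EFin \o envelope T a) \+
  (EFin \o envelope T b) \+ (EFin \o envelope T h))%E).
  by move=> w _; rewrite /= !EFinD.
by apply: integrableD => //; exact: integrableD.
Qed.

(** The payoff of [tau] conditionally on F_T: the opponent's device is averaged out. *)
Definition cond_payoff (tau : Omega -> R) (w : Omega) : R :=
  \int[unif]_(z in setT) pay (tau w) (quant (rho w) z) w.

Lemma cond_payoffE tau w : 0 <= tau w <= T ->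
  cond_payoff tau w = stop_payoff a b h rho (cst 0) tau w.
Proof.
move=> tT; have [cb _ _] := hb.
exact: (@path_payoffE _ _ hT (rho w) (b ^~ w) (tau w) _ _ (cb w) tT).
Qed.

(** Counting from [theta] discards the opponent's mass before [theta], a term common to [tau] and
    [theta]. *)
Lemma stop_payoff_diff (theta tau : Omega -> R) w :
  0 <= theta w <= tau w -> tau w <= T ->
  stop_payoff a b h rho theta tau w - stop_payoff a b h rho theta theta w =
  cond_payoff tau w - cond_payoff theta w.
Proof.
move=> thtau tauT; have [cb _ _] := hb.
have thT : 0 <= theta w <= T.
  by have /andP[-> /= /le_trans] := thtau; exact.
have tT : 0 <= tau w <= T.
  by rewrite tauT andbT; have /andP[/le_trans] := thtau; apply.
rewrite !cond_payoffE// /stop_payoff/=.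
rewrite (Rintegral_stieltjes_split hT (rho w) (cb w) thtau tauT).
rewrite set_itvco0 Rintegral_set0.
lra.
Qed.

Lemma stop_payoff_now (theta : Omega -> R) w :
  stop_payoff a b h rho theta theta w =
  a (theta w) w * (1 - rho w (theta w)) + h (theta w) w * jump (rho w) (theta w).
Proof. by rewrite /stop_payoff set_itvco0 Rintegral_set0 addr0. Qed.

Section device.
Variable Z : Omega -> R.
Hypotheses (mZ : measurable_fun setT Z)
  (FZ : forall A B, F T A -> measurable B ->
     (P (A `&` Z @^-1` B) = P A * unif B)%E).

Variable tau : Omega -> R.
Hypotheses (tauT : forall w, 0 <= tau w <= T) (mtau : measurable_fun [set: OT] tau).

Let phi (p : OT * measurableTypeR R) := pay (tau p.1) (quant (rho p.1) p.2) p.1.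

Let mphi : measurable_fun setT phi.
Proof.
apply: measurable_pay => //.
- exact: measurableT_comp.
- apply: (measurable_quant hT (z := snd) (p := fst)) => //.
  move=> t tT; apply: (measurableT_comp (f := fun w : OT => rho w t)) => //.
  exact: (adapted_FT arho).
- by move=> e; exact: quant_itv.
Qed.

Let phi_bound w z : `|phi (w, z)| <= payoff_bound w.
Proof. by apply: pay_bound => //; exact: quant_itv. Qed.

Let indep (A : set OT) (B : set (measurableTypeR R)) :
  measurable A -> measurable B ->
  (P (id @^-1` A `&` Z @^-1` B) = P (id @^-1` A) * unif B)%E.
Proof. by rewrite -(sigma_algebraE FT_sigma) !preimage_id; exact: FZ. Qed.

Let fin_phi w : (\int[unif]_z (phi (w, z))%:E)%E = (cond_payoff tau w)%:E.
Proof.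
rewrite /cond_payoff /Rintegral fineK//; apply: integrable_fin_num => //.
apply: measurable_bounded_integrable => //.
- apply: le_lt_trans (probability_le1 unif measurableT) _; exact: ltry.
- exact: (measurableT_comp mphi (measurable_pair1 w)).
- exists (payoff_bound w); split; first exact: num_real.
  by move=> M /ltW bM z _ /=; rewrite (le_trans _ bM)//; exact: phi_bound.
Qed.

Lemma cond_payoff_integrable : P.-integrable setT (EFin \o cond_payoff tau).
Proof.
have := independent_integrable measurable_idT (mZ : measurable_fun setT
  (Z : Omega -> measurableTypeR R)) indep mphi phi_bound integrable_pay_bound.
by apply: eq_integrable => // w _; exact: fin_phi.
Qed.

Lemma expected_payoff :
  'E_P[game_payoff a b h tau (rand_time rho Z)]%E =
  (\int[P]_w (cond_payoff tau w)%:E)%E.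
Proof.
rewrite unlock.
transitivity (\int[P]_w (phi (id w, Z w))%:E)%E; first by apply: eq_integral.
rewrite (independent_fubini_F measurable_idT (mZ : measurable_fun setT
  (Z : Omega -> measurableTypeR R)) indep mphi phi_bound integrable_pay_bound).
by apply: eq_integral => w _; exact: fin_phi.
Qed.

End device.

End player.

Section conditional_expectation.
Context {R : realType} {d : measure_display} {Omega : measurableType d}
  (P : probability Omega R).

Lemma is_cond_expD S (X1 X2 Y1 Y2 : Omega -> R) :
  sigma_algebra setT S -> S `<=` measurable ->
  P.-integrable setT (EFin \o X1) -> P.-integrable setT (EFin \o X2) ->
  is_cond_exp P S X1 Y1 -> is_cond_exp P S X2 Y2 ->
  is_cond_exp P S (X1 \+ X2) (Y1 \+ Y2).
Proof.
move=> Ssig Ssub iX1 iX2 [mY1 iY1 EY1] [mY2 iY2 EY2]; split.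
- apply/(sub_measurableE _ Ssig); apply: measurable_funD;
    exact/(sub_measurableE _ Ssig).
- apply: (eq_integrable measurableT ((EFin \o Y1) \+ (EFin \o Y2))%E) => //.
  exact: integrableD.
- move=> A SA; have mA := Ssub _ SA.
  have intS X : P.-integrable setT (EFin \o X) -> P.-integrable A (EFin \o X).
    by apply: integrableS.
  transitivity (\int[P]_(w in A) (Y1 w)%:E + \int[P]_(w in A) (Y2 w)%:E)%E.
    by rewrite -integralD_EFin//; exact: intS.
  by rewrite EY1// EY2// -integralD_EFin//; exact: intS.
Qed.

End conditional_expectation.

Section zero_process.
Context {R : realType} (T : R) (hT : 0 < T) {d : measure_display}
  {Omega : measurableType d} (P : probability Omega R) (F : R -> set_system Omega).

(** Setting the other two payoffs to zero turns [cond_payoff] into a single term of the payoff of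
    stopping at once, and so gives the integrability of each term separately. *)
Lemma Lb_zero : Lb T P (fun _ _ => 0).
Proof.
split.
- move=> w; split => t _; first exact: cvg_cst.
  exact: is_cvg_cst.
- exact: measurable_cst.
- have E : ereal_sup [set `|0 : R|%:E | _ in `[0, T]%classic] = 0%E.
    apply/eqP; rewrite eq_le; apply/andP; split.
      by apply: ge_ereal_sup => _ [t _ <-]; rewrite normr0.
    apply: ereal_sup_ubound; exists 0; rewrite ?normr0//.
    by rewrite /= in_itv/= lexx ltW.
  rewrite (eq_integral (cst 0%E)); first by rewrite integral0 ltry.
  by move=> w _; rewrite /= E.
Qed.

Lemma adapted_zero : (forall t, 0 <= t <= T -> sigma_algebra setT (F t)) ->
  adapted T F (fun _ _ => 0).
Proof.
move=> sF t tT; apply/(sub_measurableE _ (sF t tT)); exact: measurable_cst.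
Qed.

End zero_process.

Section stopped_sigma.
Context {R : realType} (T : R) (hT : 0 < T) {d : measure_display}
  {Omega : measurableType d} (P : probability Omega R).
Variable G : R -> set_system Omega.
Hypothesis hG : filtration T P G.
Variable theta : Omega -> R.
Hypothesis st : stopping_time T G theta.

Lemma stopped_sigma_algebra : sigma_algebra setT (stopped_sigma T G theta).
Proof.
have [thT thG] := st; split.
- move=> t tT; rewrite set0I (sigma_algebraE (filtration_sigma hG tT)).
  exact: measurable0.
- move=> A SA t tT.
  rewrite (_ : _ `&` _ = [set w | theta w <= t] `\` (A `&` [set w | theta w <= t])).
    rewrite (sigma_algebraE (filtration_sigma hG tT)).
    by apply: measurableD; rewrite -(sigma_algebraE (filtration_sigma hG tT));
      [exact: thG|exact: SA].
  apply/seteqP; split => w /=; first by move=> [[_ nA] ?]; split => // -[].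
  by move=> [? nA]; split => //; split => // Aw; apply: nA.
- move=> A SA t tT; rewrite setI_bigcupl.
  rewrite (sigma_algebraE (filtration_sigma hG tT)).
  apply: bigcupT_measurable => i.
  by rewrite -(sigma_algebraE (filtration_sigma hG tT)); exact: SA.
Qed.

Lemma stopped_sigma_sub : stopped_sigma T G theta `<=` measurable.
Proof.
have [thT _] := st; have TT : 0 <= T <= T by rewrite lexx ltW.
move=> A /(_ T TT); rewrite (_ : [set w | _] = setT) ?setIT.
  exact: (filtration_sub hG).
by apply/seteqP; split => // w _ /=; have /andP[] := thT w.
Qed.

(** On {tau <= t} one has theta <= t, so membership in [A] is already decided at time [t]. *)
Lemma stopping_time_paste (A : set Omega) (tau : Omega -> R) :
  stopped_sigma T G theta A -> stopping_time_from T G theta tau ->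
  stopping_time T G (fun w => if `[< A w >] then tau w else theta w).
Proof.
move=> SA [[tauT tauG] thtau]; have [thT thG] := st; split=> [w|t tT].
  by case: ifP.
rewrite (_ : [set w | _] =
    ((A `&` [set w | theta w <= t]) `&` [set w | tau w <= t]) `|`
    ([set w | theta w <= t] `\` (A `&` [set w | theta w <= t]))).
  rewrite (sigma_algebraE (filtration_sigma hG tT)).
  apply: measurableU; [apply: measurableI|apply: measurableD];
    rewrite -(sigma_algebraE (filtration_sigma hG tT));
    [exact: SA|exact: tauG|exact: thG|exact: SA].
apply/seteqP; split => w /=; case: asboolP => Aw.
- by move=> tt; left; split => //; split => //; exact: le_trans tt.
- by move=> tt; right; split => // -[].
- by move=> [[]//|[tt nA]]; exfalso; apply: nA.
- by move=> [[[]//]|[]].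
Qed.

End stopped_sigma.

(** * The value at an optimal stopping time *)

Section best_response.
Context {R : realType} (T : R) (hT : 0 < T) {d : measure_display}
  {Omega : measurableType d} (P : probability Omega R).
Variables F G : R -> set_system Omega.
Hypotheses (hF : filtration T P F) (hG : filtration T P G).
Hypothesis GF : forall t, 0 <= t <= T -> G t `<=` F t.
Variables (a b h : R -> Omega -> R) (rho : Omega -> gen_path T).
Hypotheses (ha : Lb T P a) (hb : Lb T P b) (hh : Lb T P h).
Hypotheses (aa : adapted T F a) (ab : adapted T F b) (ah : adapted T F h).
Hypothesis arho : adapted T F (fun t w => rho w t).
Variable Z : Omega -> R.
Hypotheses (mZ : measurable_fun setT Z)
  (FZ : forall A B, F T A -> measurable B ->
     (P (A `&` Z @^-1` B) = P A * unif B)%E).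

Let TT : 0 <= T <= T. Proof. by rewrite lexx ltW. Qed.

Lemma stopping_time_FT tau : stopping_time T G tau ->
  measurable_fun [set: g_sigma_algebraType (F T)] tau.
Proof.
move=> st; apply/(sub_measurableE _ (filtration_sigma hF TT)) => B mB.
by apply: GF => //; exact: (stopping_time_sub_measurable hT hG st).
Qed.

Let cp := cond_payoff a b h rho.

Let icp tau : stopping_time T G tau -> P.-integrable setT (EFin \o cp tau).
Proof.
move=> st; apply: (cond_payoff_integrable hT hF ha hb hh aa ab ah arho mZ FZ).
  by case: st.
exact: stopping_time_FT.
Qed.

Variables (theta : Omega -> R) (pa ph V : Omega -> R).
Hypotheses (st : stopping_time T G theta)
  (hpa : is_cond_exp P (stopped_sigma T G theta)
     (fun w => a (theta w) w * (1 - rho w (theta w))) pa)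
  (hph : is_cond_exp P (stopped_sigma T G theta)
     (fun w => h (theta w) w * jump (rho w) (theta w)) ph)
  (hV : is_ess_inf P (cond_payoffs P G a b h rho theta) V).

Let Sth := stopped_sigma T G theta.
Let Sth_sigma : sigma_algebra setT Sth := stopped_sigma_algebra hG st.
Let Sth_sub : Sth `<=` measurable := stopped_sigma_sub hT hG st.

Let now := stop_payoff a b h rho theta theta.

Let inow1 : P.-integrable setT
  (EFin \o (fun w => a (theta w) w * (1 - rho w (theta w)))).
Proof.
have [thT _] := st; have F0 := adapted_zero (fun t => filtration_sigma hF (t := t)).
have L0 := Lb_zero hT P.
have := cond_payoff_integrable hT hF ha L0 L0 aa F0 F0 arho mZ FZ thT
  (stopping_time_FT st).
apply: eq_integrable => // w _ /=.
by rewrite (cond_payoffE hT _ _ _ L0)// /stop_payoff Rintegral_cst// !mul0r !addr0.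
Qed.

Let inow2 : P.-integrable setT
  (EFin \o (fun w => h (theta w) w * jump (rho w) (theta w))).
Proof.
have [thT _] := st; have F0 := adapted_zero (fun t => filtration_sigma hF (t := t)).
have L0 := Lb_zero hT P.
have := cond_payoff_integrable hT hF L0 L0 hh F0 F0 ah arho mZ FZ thT
  (stopping_time_FT st).
apply: eq_integrable => // w _ /=.
by rewrite (cond_payoffE hT _ _ _ L0)// /stop_payoff Rintegral_cst// !mul0r !add0r.
Qed.

Let W := pa \+ ph.

Let cond_now : is_cond_exp P Sth now W.
Proof.
rewrite (_ : now = (fun w => a (theta w) w * (1 - rho w (theta w))) \+
  (fun w => h (theta w) w * jump (rho w) (theta w))); first exact: is_cond_expD.
by apply/funext => w; exact: stop_payoff_now.
Qed.

Lemma value_le_now : {ae P, forall w, V w <= pa w + ph w}.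
Proof.
have [_ Vle _] := hV; apply: (Vle W); exists theta; last exact: cond_now.
by split.
Qed.

Hypothesis th_min : forall tau, stopping_time T G tau ->
  (\int[P]_w (cp theta w)%:E <= \int[P]_w (cp tau w)%:E)%E.

(* If some continuation [tau] were better than stopping at [theta] on a
   non-null event of [Sth], pasting it there would beat [theta]. *)
Let now_le_continuation X : cond_payoffs P G a b h rho theta X ->
  {ae P, forall w, W w <= X w}.
Proof.
move=> [tau stau [mX iX EX]]; have [[tauT _] thtau] := stau.
have [mW iW EW] := cond_now; have [thT _] := st.
pose A := [set w | X w < W w].
have SA : Sth A.
  rewrite (sigma_algebraE Sth_sigma) /A.
  have := @measurable_fun_ltr _ (g_sigma_algebraType Sth) _ setT _ _
    ((sub_measurableE _ Sth_sigma).1 mX) ((sub_measurableE _ Sth_sigma).1 mW).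
  move=> /(_ measurableT [set true]); rewrite setTI; exact.
have mA := Sth_sub SA.
pose tau' w := if `[< A w >] then tau w else theta w.
have stau' : stopping_time T G tau' by exact: (stopping_time_paste hG st SA stau).
have cpE w : (cp tau' w - cp theta w)%:E = ((EFin \o (cp tau \- cp theta)) \_ A) w.
  rewrite patchE /cp /cond_payoff /tau'; case: asboolP => Aw.
    by rewrite mem_set.
  by rewrite memNset// subrr.
have diffE w : cp tau w - cp theta w = stop_payoff a b h rho theta tau w - now w.
  rewrite /now (stop_payoff_diff hT _ _ _ hb)//.
    by rewrite thtau andbT; case/andP: (thT w).
  by case/andP: (tauT w).
have intA Y : P.-integrable setT (EFin \o Y) -> P.-integrable A (EFin \o Y).
  by apply: integrableS.
have icp_tau : P.-integrable setT (EFin \o cp tau) by apply: icp; case: stau.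
have inow : P.-integrable setT (EFin \o now).
  have := integrableD measurableT inow1 inow2.
  by apply: eq_integrable => // w _; rewrite /= /now stop_payoff_now EFinD.
(* The payoff counted from [theta] is not itself a [cond_payoff]; its integrability is read off the
   difference identity. *)
have istop : P.-integrable setT (EFin \o stop_payoff a b h rho theta tau).
  have := integrableD measurableT (integrableB measurableT icp_tau (icp st)) inow.
  apply: eq_integrable => // w _ /=.
  by rewrite -EFinB diffE -EFinD subrK.
(* This is the optimality of [theta] against the pasted time. Since [X < W] on [A], the integrand is
   positive there, so [A] has to be null. *)
have gain : (\int[P]_(w in A) (W w - X w)%:E <= 0)%E.
  have := th_min stau'; rewrite -sube_le0.
  rewrite -(integralB_EFin measurableT (icp st) (icp stau')).
  apply: le_trans; rewrite le_eqVlt; apply/orP; left; apply/eqP.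
  transitivity (\int[P]_(w in A) (W w)%:E - \int[P]_(w in A) (X w)%:E)%E.
    by rewrite -integralB_EFin//; exact: intA.
  rewrite EW// EX// -integralB_EFin//; [|exact: intA..].
  rewrite integral_mkcond; apply: eq_integral => w _.
  rewrite patchE -EFinB; have := cpE w; rewrite patchE/=.
  case: ifP => _ [E].
    by rewrite -EFinB -opprB -diffE -E opprB.
  by rewrite -[LHS]oppe0 -EFinN -E opprB.
have gainP : ae_eq P A (fun w => (W w - X w)%:E) (cst 0%E).
  apply/ae_eq_integral_abs => //.
    apply/measurable_EFinP; apply: measurable_funB;
      apply: measurable_funTS; exact: sub_measurable_fun Sth_sub _.
  apply/eqP; rewrite eq_le; apply/andP; split; last exact: integral_ge0.
  apply: le_trans gain; rewrite le_eqVlt; apply/orP; left; apply/eqP.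
  by apply: eq_integral => w /set_mem Aw; rewrite gee0_abs// lee_fin subr_ge0 ltW.
apply: filterS gainP => w gw; rewrite leNgt; apply/negP => Aw.
have /eqP := gw Aw; rewrite eqe subr_eq0 => /eqP XW.
by move: Aw; rewrite XW ltxx.
Qed.

Lemma value_eq_now : {ae P, forall w, V w = pa w + ph w}.
Proof.
have [_ _ Vge] := hV.
have mW : measurable_fun setT W.
  by have [mW _ _] := cond_now; exact: sub_measurable_fun Sth_sub mW.
have := Vge W mW now_le_continuation.
apply: filterS2 value_le_now => w le1 ge1.
by apply/eqP; rewrite eq_le le1.
Qed.

End best_response.

(** * Equilibria *)

Section step_path.
Context {R : realType} (T : R) (hT : 0 < T) (s : R).
Hypothesis sT : 0 <= s <= T.

(** Taken outcome by outcome, this path presents a stopping time as a randomised one. *)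
Definition step_fun (t : R) : R := if s <= t then 1 else 0.

Lemma step_fun_cadlag : cadlag_path T step_fun.
Proof.
split=> t tT.
  rewrite /step_fun; case: ifPn => st; apply: cvg_near_cst; near=> u.
    have tu : t < u by near: u; exact: nbhs_right_gt.
    by rewrite /step_fun (le_trans st (ltW tu)).
  have us : u < s by near: u; apply: nbhs_right_lt; rewrite ltNge.
  by rewrite /step_fun leNgt us.
have [st|ts] := ltP s t.
  apply/cvg_ex; exists 1; apply: cvg_near_cst; near=> u.
  have su : s < u by near: u; exact: nbhs_left_gt.
  by rewrite /step_fun ltW.
apply/cvg_ex; exists 0; apply: cvg_near_cst; near=> u.
have us : u < t by near: u; exact: nbhs_left_lt.
by rewrite /step_fun leNgt (lt_le_trans us ts).
Unshelve. all: by end_near. Qed.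

Lemma step_fun_nd u v : 0 <= u -> u <= v -> v <= T -> step_fun u <= step_fun v.
Proof.
move=> _ uv _; rewrite /step_fun; case: ifPn => su; last by case: ifP.
by rewrite (le_trans su uv).
Qed.

Lemma step_fun_ge0 : 0 <= step_fun 0.
Proof. by rewrite /step_fun; case: ifP. Qed.

Lemma step_fun_T : step_fun T = 1.
Proof. by rewrite /step_fun; case/andP: sT => _ ->. Qed.

Definition step_path : gen_path T :=
  GenPath step_fun_cadlag step_fun_nd step_fun_ge0 step_fun_T.

Lemma quant_step_path z : 0 <= z < 1 -> quant step_path z = s.
Proof.
move=> /andP[z0 z1]; have /andP[s0 sT'] := sT.
apply/eqP; rewrite eq_le; apply/andP; split.
  by apply: quant_le => //=; rewrite /step_fun lexx.
apply: lb_le_inf; first by exists T; right.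
move=> t [[_ /=]|->//]; rewrite /step_fun; case: ifP => // _.
by rewrite ltNge z0.
Qed.

End step_path.

Section optional_processes.
Context {R : realType} (T : R) (hT : 0 < T) {d : measure_display}
  {Omega : measurableType d} (P : probability Omega R).
Variable G : R -> set_system Omega.
Hypothesis hG : filtration T P G.

Let Dom : set (R * Omega) := `[0, T] `*` setT.

(** Testing the trace on the domain extends the optional sigma-algebra to the whole product, so that
    optional processes become total measurable functions. *)
Let optT : set_system (R * Omega) := [set A | optional_sigma T G (Dom `&` A)].

Let optT_sigma : sigma_algebra setT optT.
Proof.
have [s0 sD sU] : sigma_algebra Dom (optional_sigma T G).
  exact: smallest_sigma_algebra.
split.
- by rewrite /optT/= setI0.
- move=> A oA; rewrite /optT/= (_ : _ `&` _ = Dom `\` (Dom `&` A)); first exact: sD.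
  apply/seteqP; split => p; first by move=> [Dp [_ nA]]; split => // -[].
  by move=> [Dp nA]; do 2!split => //; move=> Ap; apply: nA.
- by move=> A oA; rewrite /optT/= setI_bigcupr; exact: sU.
Qed.

Let optionalE (X : R -> Omega -> R) : optional T G X <->
  measurable_fun [set: g_sigma_algebraType optT] (fun p => X p.1 p.2).
Proof.
split=> oX; last first.
  by move=> B mB; have := oX measurableT B mB; rewrite setTI -(sigma_algebraE optT_sigma).
by move=> _ B mB; rewrite setTI -(sigma_algebraE optT_sigma); exact: oX.
Qed.

Lemma optionalB (X Y : R -> Omega -> R) : optional T G X -> optional T G Y ->
  optional T G (fun t w => X t w - Y t w).
Proof. by move=> /optionalE oX /optionalE oY; apply/optionalE/measurable_funB. Qed.

Lemma optionalN (X : R -> Omega -> R) : optional T G X ->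
  optional T G (fun t w => - X t w).
Proof. by move=> /optionalE oX; apply/optionalE/measurable_funN. Qed.

Lemma optional_measurable (X : R -> Omega -> R) : optional T G X ->
  measurable_fun (`[0, T] `*` setT) (fun p : R * Omega => X p.1 p.2).
Proof. by move=> oX mD B mB; apply: (optional_sigma_sub hT hG); exact: oX. Qed.

Lemma optional_measurable_path (X : R -> Omega -> R) w : optional T G X ->
  measurable_fun `[0, T] (X ^~ w).
Proof.
move=> oX; apply: (measurable_comp (F := `[0, T] `*` setT) (f := fun p => X p.1 p.2)
  (g := fun t => (t, w))).
- exact: measurableX.
- by move=> _ [t /= tT <-].
- exact: optional_measurable.
- apply: measurable_funTS; exact: measurable_pair2.
Qed.

Lemma optional_le0 (X : R -> Omega -> R) : optional T G X ->
  (forall tau, stopping_time T G tau -> {ae P, forall w, X (tau w) w <= 0}) ->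
  {ae P, forall w, forall t, 0 <= t <= T -> X t w <= 0}.
Proof.
move=> oX X0; pose B := (`[0, T] `*` setT) `&` [set p : R * Omega | 0 < X p.1 p.2].
have oB : optional_sigma T G B.
  rewrite /B; have := oX `]0, +oo[%classic (measurable_itv _).
  congr optional_sigma; congr (_ `&` _); apply/seteqP.
  by split => p /=; rewrite in_itv/= andbT.
have nB tau : stopping_time T G tau -> P.-negligible [set w | B (tau w, w)].
  move=> st; apply: negligibleS (X0 tau st) => w [_ /= Xw] /=.
  by rewrite leNgt Xw.
apply: negligibleS (optional_section hT hG oB nB) => w /= /existsNP[t].
move=> /not_implyP[tT /negP]; rewrite -ltNge => Xt; exists t.
by split => //=; split => //=; rewrite in_itv.
Qed.

End optional_processes.

(** * The minimising player's half of the statement *)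

Section equilibrium_half.
Context {R : realType} (T : R) (hT : 0 < T) {d : measure_display}
  {Omega : measurableType d} (P : probability Omega R).
Variables F G : R -> set_system Omega.
Hypotheses (hF : filtration T P F) (hG : filtration T P G).
Hypothesis GF : forall t, 0 <= t <= T -> G t `<=` F t.
Variables (a b h : R -> Omega -> R) (xi rho : Omega -> gen_path T).
Hypotheses (ha : Lb T P a) (hb : Lb T P b) (hh : Lb T P h).
Hypotheses (aa : adapted T F a) (ab : adapted T F b) (ah : adapted T F h).
Hypotheses (gxi : generating G xi) (arho : adapted T F (fun t w => rho w t)).
Variables Z1 Z2 : {RV P >-> R}.
Hypothesis dev : devices (F T) Z1 Z2.
Hypothesis saddle : forall tau, randomised_time T G Z1 tau ->
  ('E_P[game_payoff a b h (rand_time xi Z1) (rand_time rho Z2)] <=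
   'E_P[game_payoff a b h tau (rand_time rho Z2)])%E.

Notation OT := (g_sigma_algebraType (F T)).
Let TT : 0 <= T <= T. Proof. by rewrite lexx ltW. Qed.
Let FT_sigma : sigma_algebra setT (F T). Proof. exact: (filtration_sigma hF). Qed.
Let FT_sub : F T `<=` measurable. Proof. exact: (filtration_sub hF). Qed.
Let mZ1 : measurable_fun setT (Z1 : Omega -> R). Proof. exact: measurable_funP. Qed.
Let mZ2 : measurable_fun setT (Z2 : Omega -> R). Proof. exact: measurable_funP. Qed.

Let uZ1 B : measurable B -> P (Z1 @^-1` B) = unif B.
Proof. by move=> mB; have [uZ _ _] := dev; exact: uZ. Qed.

Let uZ2 B : measurable B -> P (Z2 @^-1` B) = unif B.
Proof. by move=> mB; have [_ uZ _] := dev; exact: uZ. Qed.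

Let FZ2 A B : F T A -> measurable B -> (P (A `&` Z2 @^-1` B) = P A * unif B)%E.
Proof.
move=> FA mB; have [_ _ /(_ A setT B FA measurableT mB)] := dev.
by rewrite preimage_setT setIT probability_setT mule1 uZ2.
Qed.

Let mgeneric X : adapted T F X -> forall t, 0 <= t <= T -> measurable_fun [set: OT] (X t).
Proof.
move=> aX t tT; apply/(sub_measurableE _ FT_sigma) => B mB.
have /andP[t0 tT'] := tT.
by apply: (filtration_le hF t0 tT') => //; exact: aX.
Qed.

Let axi : adapted T F (fun t w => xi w t).
Proof. by move=> t tT B mB; apply: GF => //; exact: gxi. Qed.

Let cp := cond_payoff a b h rho.

Let J (tau : Omega -> R) := (\int[P]_w (cp tau w)%:E)%E.

Let JE tau : stopping_time T G tau ->
  ('E_P[game_payoff a b h tau (rand_time rho Z2)] = J tau)%E.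
Proof.
move=> st; apply: (expected_payoff hT hF ha hb hh aa ab ah arho mZ2 FZ2).
  by case: st.
exact: (stopping_time_FT hT hF hG GF st).
Qed.

Let v := ('E_P[game_payoff a b h (rand_time xi Z1) (rand_time rho Z2)])%E.

Let mrand {zeta : Omega -> gen_path T} (Z : {RV P >-> R}) :
  (forall t, 0 <= t <= T -> measurable_fun setT (fun w => zeta w t)) ->
  measurable_fun setT (rand_time zeta Z).
Proof.
move=> mzeta; exact: (measurable_quant hT (p := id) (z := Z) mzeta).
Qed.

Let mgame tau : (forall w, 0 <= tau w <= T) -> measurable_fun setT tau ->
  measurable_fun setT (game_payoff a b h tau (rand_time rho Z2)).
Proof.
move=> tauT mtau.
apply: (measurable_pay hT hF ha hb hh aa ab ah (p := id : Omega -> OT)) => //.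
- by apply: mrand => t tT; exact: (adapted_measurable hF arho).
- by move=> w; exact: quant_itv.
- exact: (measurable_idT hT hF).
Qed.

(** A stopping time is the randomised time of its step path except where [Z1] leaves [0, 1[, a null
    event. *)
Let v_le_J tau : stopping_time T G tau -> (v <= J tau)%E.
Proof.
move=> st; have [tauT tauG] := st.
pose step w : gen_path T := step_path (tauT w).
have gstep : generating G step.
  move=> t tT; apply/(sub_measurableE _ (filtration_sigma hG tT)) => /=.
  rewrite /step_fun; apply: measurable_fun_ifT; [|exact: measurable_cst..].
  apply: (measurable_fun_bool true); rewrite setTI.
  rewrite -(sigma_algebraE (filtration_sigma hG tT)).
  exact: tauG.
have := saddle (ex_intro2 _ _ step gstep erefl).
rewrite -/v -JE//; congr (_ <= _)%E; rewrite !unlock.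
have Z1_01 : {ae P, forall w, 0 <= Z1 w < 1}.
  exists (~` (Z1 @^-1` `[0, 1[)); split.
  - by apply: measurableC; rewrite -[X in measurable X]setTI; exact: mZ1.
  - rewrite probability_setC; last by rewrite -[X in measurable X]setTI; exact: mZ1.
    rewrite uZ1// unifE// (_ : _ `&` _ = `[0, 1[%classic).
      by rewrite lebesgue_measure_itv/= lte_fin ltr01 oppr0 adde0 subee.
    apply/seteqP; split => z /=; first by case.
    by rewrite !in_itv/= => /andP[-> z1]; split => //; exact: ltW.
  - by move=> w; apply: contra_not => /=; rewrite in_itv/=.
apply: ae_eq_integral => //.
- apply/measurable_EFinP/mgame; first by move=> w; exact: quant_itv.
  apply: mrand => t tT; apply: sub_measurable_fun (filtration_sub hG tT) _.
  exact: gstep.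
- by apply/measurable_EFinP/mgame => //; exact: (stopping_time_measurable hT hG st).
- by apply: filterS Z1_01 => w zw _; rewrite /game_payoff rand_timeE quant_step_path.
Qed.

(** Right-continuity of the filtration reduces this to {quant < t}, which is seen at rational times
    because the paths are monotone. *)
Let quant_stopping z : stopping_time T G (fun w => quant (xi w) z).
Proof.
apply: (stopping_time_lt hT hG) => [w|t tT]; first exact: quant_itv.
have /andP[t0 tT'] := tT; have sGt := filtration_sigma hG tT.
rewrite (_ : [set w | _] = \bigcup_(q : rat) (if 0 <= (ratr q : R) < t then
    [set w | z < xi w (ratr q)] else set0)).
  rewrite (sigma_algebraE sGt); apply: bigcupT_measurable_rat => q.
  case: ifPn => // /andP[q0 qt]; rewrite -(sigma_algebraE sGt).
  apply: (filtration_le hG q0 (ltW qt) tT').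
  rewrite (_ : [set w | _] = (fun w => xi w (ratr q)) @^-1` `]z, +oo[).
    by apply: gxi; [rewrite q0 (le_trans (ltW qt))|exact: measurable_itv].
  by apply/seteqP; split => w /=; rewrite in_itv/= andbT.
apply/seteqP; split => w /=.
  move=> qlt; have [u [u0 ut zu]] := quant_lt hT qlt tT'.
  have [q] := @rat_in_itvoo R u t ut; rewrite in_itv/= => /andP[uq qt].
  exists q => //; rewrite qt (le_trans u0 (ltW uq))/=.
  by apply: (lt_le_trans zu); rewrite gen_path_nd// ltW// (lt_le_trans qt).
move=> [q _]; case: ifPn => // /andP[q0 qt] zq.
apply: le_lt_trans (qt); apply: quant_le => //.
by rewrite q0 (le_trans (ltW qt)).
Qed.

(** The outcome and the opponent's device form the first component; the player's own device,
    independent of that pair, is the second. *)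
Let phi (p : (OT * measurableTypeR R) * measurableTypeR R) : R :=
  pay a b h (quant (xi p.1.1) p.2) (quant (rho p.1.1) p.1.2) p.1.1.

Let mphi : measurable_fun setT phi.
Proof.
apply: (measurable_pay hT hF ha hb hh aa ab ah).
- apply: (measurable_quant hT (z := snd) (p := fst \o fst)) => // t tT.
  apply: (measurableT_comp (f := fun w : OT => xi w t)) => //.
    exact: (mgeneric axi).
  exact: measurableT_comp.
- by move=> e; exact: quant_itv.
- apply: (measurable_quant hT (z := snd \o fst) (p := fst \o fst)) => //.
    move=> t tT; apply: (measurableT_comp (f := fun w : OT => rho w t)) => //.
      exact: (mgeneric arho).
    exact: measurableT_comp.
  exact: measurableT_comp.
- by move=> e; exact: quant_itv.
- exact: measurableT_comp.
Qed.

Let X2 (w : Omega) : OT * measurableTypeR R := (w, Z2 w).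

Let mX2 : measurable_fun setT X2.
Proof. by apply: measurable_fun_pair => //; exact: (measurable_idT hT hF). Qed.

Let indep (A : set (OT * measurableTypeR R)) (B : set (measurableTypeR R)) :
  measurable A -> measurable B ->
  (P (X2 @^-1` A `&` Z1 @^-1` B) = P (X2 @^-1` A) * unif B)%E.
Proof.
move=> mA mB; rewrite -uZ1//.
have mB1 : measurable (Z1 @^-1` B).
  by rewrite -[X in measurable X]setTI; exact: mZ1.
apply: (dynkin_independence (measurable_prod_measurableType _ _) _ mX2 mB1 _ mA).
  move=> _ _ [A1 mA1 [B1 mB1' <-]] [A2 mA2 [B2 mB2 <-]].
  exists (A1 `&` A2); first exact: measurableI.
  exists (B1 `&` B2); first exact: measurableI.
  by rewrite setXI.
move=> _ [A1 mA1 [B2 mB2 <-]].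
have FA1 : F T A1 by rewrite (sigma_algebraE FT_sigma).
rewrite (_ : X2 @^-1` _ = A1 `&` Z2 @^-1` B2)//.
have [_ _ /(_ A1 B B2 FA1 mB mB2)] := dev.
rewrite setIAC => ->; rewrite FZ2// uZ1// uZ2//.
by rewrite -!muleA (muleC (unif B)).
Qed.

Let phi_bound w z : `|phi (X2 w, z)| <= payoff_bound T a b h w.
Proof. by apply: (pay_bound hT ha hb hh); exact: quant_itv. Qed.

Let ibound := integrable_pay_bound hT hF ha hb hh aa ab ah.

Let Jz z := J (fun w => quant (xi w) z).

Let JzE z : (\int[P]_w (phi (X2 w, z))%:E)%E = Jz z.
Proof.
rewrite /Jz -JE; last exact: quant_stopping.
by rewrite unlock; apply: eq_integral.
Qed.

Let v_int : v = (\int[unif]_z Jz z)%E.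
Proof.
rewrite /v unlock.
transitivity (\int[P]_w (phi (X2 w, Z1 w))%:E)%E; first by apply: eq_integral.
rewrite (independent_fubini_G mX2 mZ1 indep mphi phi_bound ibound).
by apply: eq_integral => z _; exact: JzE.
Qed.

Let mJz : measurable_fun [set: measurableTypeR R] Jz.
Proof.
have := independent_measurable_G mX2 mZ1 indep mphi phi_bound ibound.
by apply: eq_measurable_fun => z _; exact: JzE.
Qed.

Let Jz_fin z : Jz z \is a fin_num.
Proof.
apply: integrable_fin_num => //.
apply: (cond_payoff_integrable hT hF ha hb hh aa ab ah arho mZ2 FZ2).
  by move=> w; exact: quant_itv.
exact: (stopping_time_FT hT hF hG GF (quant_stopping z)).
Qed.

Let v_fin : v \is a fin_num.
Proof.
rewrite /v unlock; apply: integrable_fin_num => //.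
apply: (le_integrable _ _ _ ibound) => //.
  apply/measurable_EFinP; apply: (measurableT_comp mphi (g := fun w => (X2 w, Z1 w))).
  by apply: measurable_fun_pair.
by move=> w _ /=; rewrite lee_fin (le_trans (phi_bound w (Z1 w)))// ler_norm.
Qed.

Let Jz_eq_v : {ae unif, forall z, Jz z = v}.
Proof.
pose j z := fine (Jz z); have jE z : (j z)%:E = Jz z by rewrite fineK.
have mj : measurable_fun [set: measurableTypeR R] j by exact: measurableT_comp.
have ij : unif.-integrable setT (EFin \o j).
  apply: measurable_bounded_integrable => //.
    apply: le_lt_trans (probability_le1 unif measurableT) _; exact: ltry.
  (* The mean of the payoff bound dominates all the [Jz] uniformly in [z]. *)
  pose K := fine (\int[P]_w (payoff_bound T a b h w)%:E).
  have jK z : `|j z| <= K.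
    rewrite -lee_fin fineK; last exact: integrable_fin_num ibound.
    rewrite -abse_EFin jE -JzE.
    have mphiz : measurable_fun setT (fun w => phi (X2 w, z)).
      apply: (measurableT_comp mphi (g := fun w => (X2 w, z))).
      by apply: measurable_fun_pair => //; exact: measurable_cst.
    apply: le_trans (le_abse_integral _ _ _) _ => //; first exact/measurable_EFinP.
    apply: ge0_le_integral => //.
    - by apply/measurable_EFinP; exact: measurableT_comp.
    - by have /measurable_int := ibound.
    - by move=> w _; rewrite lee_fin; exact: phi_bound.
  exists K; split; first exact: num_real.
  by move=> M /ltW KM z _ /=; rewrite (le_trans (jK z)).
have jv z : fine v <= j z.
  rewrite fine_le//; apply: v_le_J; exact: quant_stopping.
have icst : unif.-integrable setT (EFin \o cst (fine v)).
  by apply: finite_measure_integrable_cst.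
have : ae_eq unif setT (EFin \o (j \- cst (fine v))) (cst 0%E).
  apply/ae_eq_integral_abs => //.
    by apply/measurable_EFinP; exact: measurable_funB.
  transitivity (\int[unif]_z ((j z)%:E - (fine v)%:E))%E.
    by apply: eq_integral => z _ /=; rewrite ger0_norm// subr_ge0.
  rewrite (integralB_EFin _ ij icst)//.
  rewrite (_ : \int[unif]_z (j z)%:E = v)%E; last first.
    by rewrite [RHS]v_int; apply: eq_integral => z _; rewrite jE.
  rewrite [X in (_ - X)%E](_ : _ = v) ?subee//.
  rewrite (eq_integral (cst (fine v)%:E))// integral_cst//.
  rewrite [X in (_ * X)%E](_ : _ = 1%E) ?mule1 ?fineK//.
  exact: (probability_setT unif).
apply: filterS => z /(_ Logic.I)[] /eqP; rewrite subr_eq0 => /eqP jvz.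
by rewrite -jE jvz fineK.
Qed.

Variables V pa ph : R -> Omega -> R.
Hypothesis oV : optional T G V.
Hypothesis hV : forall theta, stopping_time T G theta ->
  is_ess_inf P (cond_payoffs P G a b h rho theta) (fun w => V (theta w) w).
Hypotheses
  (hpa : is_optional_projection T P G (fun t w => a t w * (1 - rho w t)) pa)
  (hph : is_optional_projection T P G (fun t w => h t w * jump (rho w) t) ph).

Let Y t w := V t w - pa t w - ph t w.

Let oY : optional T G Y.
Proof.
have [opa _] := hpa; have [oph _] := hph.
by apply: optionalB => //; exact: optionalB.
Qed.

Lemma value_le_projection :
  {ae P, forall w, forall t, 0 <= t <= T -> V t w - pa t w - ph t w <= 0}.
Proof.
apply: (optional_le0 hT hG oY) => tau st.
have [_ /(_ tau st) cpa] := hpa; have [_ /(_ tau st) cph] := hph.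
have vi := hV st.
have := value_le_now hT hF hG GF ha hh aa ah arho mZ2 FZ2 st cpa cph vi.
by apply: filterS => w; rewrite /Y -addrA -opprD subr_le0.
Qed.

Let Y_quant : {ae unif, forall z : measurableTypeR R, {ae P, forall w, Y (quant (xi w) z) w = 0}}.
Proof.
apply: negligibleS Jz_eq_v => z /= nY Jzv; apply: nY; have st := quant_stopping z.
have [_ /(_ _ st) cpa] := hpa; have [_ /(_ _ st) cph] := hph.
have vi := hV st.
have mini tau : stopping_time T G tau -> (Jz z <= J tau)%E.
  by move=> st'; rewrite Jzv; exact: v_le_J.
have := value_eq_now hT hF hG GF ha hb hh aa ab ah arho mZ2 FZ2 st cpa cph vi mini.
by apply: filterS => w E; rewrite /Y E -addrA -opprD subrr.
Qed.

Lemma value_eq_projection : {ae P, forall w, stieltjes (xi w)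
  (`[0, T] `&` [set t | V t w - pa t w - ph t w != 0]) = 0%E}.
Proof.
pose g (p : measurableTypeR R * Omega) := Y (quant (xi p.2) p.1) p.2.
have mg : measurable_fun setT g.
  apply: (measurable_comp (F := `[0, T] `*` setT) (f := fun p => Y p.1 p.2)
    (g := fun p : measurableTypeR R * Omega => (quant (xi p.2) p.1, p.2))).
  - exact: measurableX.
  - move=> _ [p _ <-]; split => //=; rewrite ?in_itv/=; exact: quant_itv.
  - exact: (optional_measurable hT hG oY).
  - apply: measurable_fun_pair => //.
    apply: (measurable_quant hT (p := snd) (z := fst)) => // t tT.
    apply: (measurableT_comp (f := fun w => xi w t)) => //.
    exact: (adapted_measurable hF axi tT).
pose N := [set p | g p != 0].
have mN : measurable N.
  rewrite (_ : N = g @^-1` ~` [set 0]).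
    by rewrite -[X in measurable X]setTI; apply: mg => //; exact: measurableC.
  by apply/seteqP; split => p /=; [move/eqP|move/eqP].
pose iN (p : measurableTypeR R * Omega) : \bar R := (\1_N p)%:E.
have mf : measurable_fun setT iN by apply/measurable_EFinP.
have f0 p : (0 <= iN p)%E by rewrite lee_fin indicE.
(* One iterated integral vanishes by [Y_quant]. The inner integral of the other, at fixed [w], is
   the uniform mass of the [z] with [Y] nonzero at [quant (xi w) z], that is, the Stieltjes mass
   sought. *)
have := @fubini_tonelli _ _ _ _ _ unif P iN mf f0.
rewrite [LHS](_ : _ = 0%E); last first.
  rewrite (ae_eq_integral (cst 0%E)) ?integral0//.
    exact: measurable_fun_fubini_tonelli_F.
  apply: (negligibleS _ Y_quant) => z /= nY Yz; apply: nY => _.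
  rewrite (ae_eq_integral (cst 0%E)) ?integral0//.
    by apply: (measurableT_comp mf); exact: measurable_pair1.
  apply: filterS Yz => w Yzw _; rewrite /iN indicE memNset//= /N/= /g Yzw.
  by rewrite eqxx.
move=> /esym N0.
have : ae_eq P setT (fun w => \int[unif]_z iN (z, w))%E (cst 0%E).
  apply/ae_eq_integral_abs => //; first exact: measurable_fun_fubini_tonelli_G.
  rewrite -N0; apply: eq_integral => w _; rewrite gee0_abs//.
  by apply: integral_ge0 => z _.
apply: filterS => w /(_ Logic.I) /= Nw.
have mD : measurable (`[0, T] `&` [set t | Y t w != 0]).
  have mY := optional_measurable_path hT hG w oY.
  rewrite (_ : [set t | _] = (Y ^~ w) @^-1` ~` [set 0]).
    by apply: mY => //; exact: measurableC.
  by apply/seteqP; split => t /=; [move/eqP|move/eqP].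
rewrite -[LHS]/(stieltjes (xi w) (`[0, T] `&` [set t | Y t w != 0])) stieltjesE//.
rewrite -Nw (_ : (fun z => (\1_N (z, w))%:E) = fun z => (\1_(ysection N w) z)%:E).
  rewrite integral_indic ?setIT; [|by []|exact: measurable_ysection].
  congr (unif _); apply/seteqP; split => z /=; rewrite /ysection/= ?inE.
    by move=> [_].
  by move=> Nz; split => //; exact: quant_itv.
by apply/funext => z; rewrite !indicE mem_ysection.
Qed.

End equilibrium_half.

Lemma integralN_fin_num {d} {T : measurableType d} {R : realType}
    (mu : {measure set T -> \bar R}) (D : set T) (f : T -> \bar R) :
  (\int[mu]_(x in D) f x)%E \is a fin_num ->
  (\int[mu]_(x in D) - f x = - \int[mu]_(x in D) f x)%E.
Proof.
move=> If; have /andP[fp fn] :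
    (\int[mu]_(x in D) f^\+ x \is a fin_num)%E && (\int[mu]_(x in D) f^\- x \is a fin_num)%E.
  by rewrite -fin_numB -integralE.
by apply: integralN; apply: fin_num_adde_defl; rewrite fin_numN.
Qed.

(** No integrability is assumed: if neither integral is finite, both [fine] values are 0. *)
Lemma RintegralN {d} {T : measurableType d} {R : realType}
    (mu : {measure set T -> \bar R}) (D : set T) (f : T -> R) :
  \int[mu]_(x in D) (- f x) = - \int[mu]_(x in D) f x.
Proof.
pose I g := (\int[mu]_(x in D) (g x)%:E)%E.
have IN g : I g \is a fin_num -> I (\- g) = (- I g)%E.
  by move=> /integralN_fin_num <-; apply: eq_integral => x _; rewrite EFinN.
have Ifin g : fine (I (\- g)) = - fine (I g).
  have [fg|nfg] := boolP (I g \is a fin_num); first by rewrite IN// fineN.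
  have [fg|nfg'] := boolP (I (\- g) \is a fin_num).
    have := IN _ fg; rewrite (_ : \- (\- g) = g); last first.
      by apply/funext => x; rewrite /= opprK.
    by move=> ->; rewrite fineN opprK.
  have fine0 (y : \bar R) : y \isn't a fin_num -> fine y = 0 by case: y.
  by rewrite !fine0// oppr0.
exact: (Ifin f).
Qed.

Lemma integral_negligible_support {d} {T : measurableType d} {R : realType}
    (mu : {measure set T -> \bar R}) (D : set T) (f : T -> \bar R) :
  measurable D -> measurable_fun D f ->
  mu.-negligible (D `&` [set x | f x != 0%E]) -> (\int[mu]_(x in D) f x = 0)%E.
Proof.
move=> mD mf f0; rewrite (ae_eq_integral (cst 0%E)) ?integral0//.
apply: negligibleS f0 => x /= /not_implyP[Dx fx]; split => //.
by apply/eqP.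
Qed.

(** * The sign change that exchanges the players *)

Section opposite.
Context {R : realType} (T : R) {d : measure_display}
  {Omega : measurableType d} (P : probability Omega R).
Implicit Types (G : R -> set_system Omega) (X : R -> Omega -> R).

Definition opp_process X t w := - X t w.

Lemma adaptedN G X : adapted T G X -> adapted T G (opp_process X).
Proof.
move=> aX t tT B mB.
rewrite (_ : _ @^-1` B = X t @^-1` (-%R @^-1` B))//; apply: aX => //.
by rewrite -[X in measurable X]setTI; exact: oppr_measurable.
Qed.

Lemma LbN X : Lb T P X -> Lb T P (opp_process X).
Proof.
move=> [cX mX iX]; split.
- by move=> w; exact: cadlag_pathN.
- exact: measurable_funN.
- apply: le_lt_trans iX; rewrite le_eqVlt; apply/orP; left; apply/eqP.
  apply: eq_integral => w _; congr ereal_sup.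
  by apply: eq_imagel => t _; rewrite normrN.
Qed.

Lemma is_cond_expN S (X Y : Omega -> R) : S `<=` measurable ->
  is_cond_exp P S X Y -> is_cond_exp P S (\- X) (\- Y).
Proof.
move=> Ssub [mY iY EY]; split.
- move=> B mB; rewrite (_ : _ @^-1` B = Y @^-1` (-%R @^-1` B))//; apply: mY.
  by rewrite -[X in measurable X]setTI; exact: oppr_measurable.
- apply: (eq_integrable measurableT (\- (EFin \o Y))%E) => //.
  exact: integrableN.
- move=> A SA; have mA := Ssub _ SA.
  have fY : (\int[P]_(w in A) (Y w)%:E)%E \is a fin_num.
    by apply: integrable_fin_num => //; exact: integrableS iY.
  transitivity (\int[P]_(w in A) - (Y w)%:E)%E; first by apply: eq_integral.
  rewrite integralN_fin_num// EY// -integralN_fin_num -?EY//.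
Qed.

Lemma is_optional_projectionN G X oX : 0 < T -> filtration T P G ->
  is_optional_projection T P G X oX ->
  is_optional_projection T P G (opp_process X) (opp_process oX).
Proof.
move=> hT hG [oX0 EX]; split; first exact: optionalN.
move=> tau st; apply: (is_cond_expN _ (EX tau st)).
exact: (stopped_sigma_sub hT hG st).
Qed.

Lemma is_ess_infN C (V : Omega -> R) : is_ess_sup P C V ->
  is_ess_inf P [set X | C (\- X)] (\- V).
Proof.
move=> [mV Vge Vmin]; split; first exact: measurable_funN.
- by move=> X /Vge; apply: filterS => w /=; rewrite lerNl.
- move=> W mW WX.
  have : {ae P, forall w, V w <= (\- W) w}.
    apply: Vmin; first exact: measurable_funN.
    move=> X CX; have := WX (\- X); rewrite /= (_ : \- (\- X) = X); last first.
      by apply/funext => w /=; rewrite opprK.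
    by move=> /(_ CX); apply: filterS => w /=; rewrite lerNr.
  by apply: filterS => w /=; rewrite lerNr.
Qed.

Lemma stop_payoffN (a b h : R -> Omega -> R) (rho : Omega -> gen_path T) theta tau :
  stop_payoff (opp_process a) (opp_process b) (opp_process h) rho theta tau =
  \- stop_payoff a b h rho theta tau.
Proof.
by apply/funext => w; rewrite /stop_payoff/= /opp_process RintegralN !mulNr !opprD.
Qed.

Lemma game_payoffN (f g h : R -> Omega -> R) tau sigma w :
  game_payoff (opp_process g) (opp_process f) (opp_process h) sigma tau w =
  - game_payoff f g h tau sigma w.
Proof.
rewrite /game_payoff /opp_process.
by case: (ltgtP (tau w) (sigma w)) => // ->.
Qed.

End opposite.

(** Each of the three integrands vanishes wherever [y] does. *)
Lemma stieltjes_integral_support {R : realType} (T : R) (x : gen_path T) (y : R -> R) :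
  measurable_fun `[0, T] y ->
  stieltjes x (`[0, T] `&` [set t | y t != 0]) = 0%E ->
  [/\ (\int[stieltjes x]_(t in `[0%R, T]) (y t)%:E = 0)%E,
      (\int[stieltjes x]_(t in `[0%R, T]) (\1_[set s | (y s < 0)%R] t)%:E = 0)%E &
      (\int[stieltjes x]_(t in `[0%R, T]) (\1_[set s | (0 < y s)%R] t)%:E = 0)%E].
Proof.
move=> my y0.
have mT : measurable `[0, T] by exact: measurable_itv.
have my0 (B : set R) : measurable B -> measurable (`[0, T] `&` y @^-1` B).
  by move=> mB; exact: my.
have ny : (stieltjes x).-negligible (`[0, T] `&` [set t | y t != 0]).
  apply/negligibleP => //.
  rewrite (_ : [set t | _] = y @^-1` ~` [set 0]).
    by apply: my0; exact: measurableC.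
  by apply/seteqP; split => t /=; [move/eqP|move/eqP].
have ind (B : set R) : measurable B -> ~ B 0 ->
    (\int[stieltjes x]_(t in `[0%R, T]) (\1_(y @^-1` B) t)%:E = 0)%E.
  move=> mB B0; apply: integral_negligible_support => //.
    apply/measurable_EFinP.
    apply: (eq_measurable_fun (\1_(`[0, T] `&` y @^-1` B) : _ -> R)).
      by move=> t tT; rewrite !indicE in_setI tT.
    by apply: measurable_indic; exact: my0.
  apply: negligibleS ny => t [/= tT]; rewrite indicE.
  case: (boolP (t \in y @^-1` B)) => [|_]; last by rewrite eqxx.
  by rewrite inE/= => Bt _; split => //; apply/eqP => yt; rewrite yt in Bt.
split.
- apply: integral_negligible_support => //; first exact/measurable_EFinP.
- rewrite (_ : [set s | _] = y @^-1` `]-oo, 0[).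
    by apply: ind; [exact: measurable_itv|rewrite /= in_itv/= ltxx].
  by apply/seteqP; split => s /=; rewrite in_itv.
- rewrite (_ : [set s | _] = y @^-1` `]0, +oo[).
    by apply: ind; [exact: measurable_itv|rewrite /= in_itv/= ltxx].
  by apply/seteqP; split => s /=; rewrite in_itv/= andbT.
Qed.

Theorem proposition3p17
  (R : realType) (T : R) (hT : 0 < T)
  (d : measure_display) (Omega : measurableType d) (P : probability Omega R)
  (hP : measure_is_complete P)
  (F F1 F2 : R -> set_system Omega)
  (hF : filtration T P F) (hF1 : filtration T P F1) (hF2 : filtration T P F2)
  (hFT : F T `<` measurable)
  (hF12 : forall t, 0 <= t <= T -> <<s F1 t `|` F2 t >> `<=` F t)
  (f g h : R -> Omega -> R)
  (hf : Lb T P f) (hg : Lb T P g) (hh : Lb T P h)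
  (haf : adapted T F f) (hag : adapted T F g) (hah : adapted T F h)
  (hfgh : {ae P, forall w, forall t, 0 <= t <= T ->
             g t w <= h t w /\ h t w <= f t w})
  (xi zeta : Omega -> gen_path T)
  (hopt : optimal_pair P F F1 F2 f g h xi zeta)
  (V1 V2 : R -> Omega -> R)
  (hV1 : ess_inf_value P F1 f g h zeta V1)
  (hV2 : ess_sup_value P F2 g f h xi V2)
  (pf ph1 pg ph2 : R -> Omega -> R)
  (hpf : is_optional_projection T P F1
           (fun t w => f t w * (1 - zeta w t)) pf)
  (hph1 : is_optional_projection T P F1
            (fun t w => h t w * jump (zeta w) t) ph1)
  (hpg : is_optional_projection T P F2
           (fun t w => g t w * (1 - xi w t)) pg)
  (hph2 : is_optional_projection T P F2
            (fun t w => h t w * jump (xi w) t) ph2) :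
  let Y1 t w := V1 t w - pf t w - ph1 t w in
  let Y2 t w := V2 t w - pg t w - ph2 t w in
  [/\ {ae P, forall w, forall t, 0 <= t <= T -> Y1 t w <= 0 /\ 0 <= Y2 t w},
      {ae P, forall w,
         (\int[stieltjes (xi w)]_(t in `[0%R, T]) (Y1 t w)%:E = 0)%E /\
         (\int[stieltjes (zeta w)]_(t in `[0%R, T]) (Y2 t w)%:E = 0)%E} &
      {ae P, forall w,
         (\int[stieltjes (xi w)]_(t in `[0%R, T])
            (\1_[set s | (Y1 s w < 0)%R] t)%:E = 0)%E /\
         (\int[stieltjes (zeta w)]_(t in `[0%R, T])
            (\1_[set s | (0 < Y2 s w)%R] t)%:E = 0)%E}].
Proof.
move=> Y1 Y2.
have [gxi gzeta [Z1 [Z2 [dev sad2 sad1]]]] := hopt.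
have F1F t : 0 <= t <= T -> F1 t `<=` F t.
  by move=> tT A F1A; apply: hF12 => //; apply: sub_sigma_algebra; left.
have F2F t : 0 <= t <= T -> F2 t `<=` F t.
  by move=> tT A F2A; apply: hF12 => //; apply: sub_sigma_algebra; right.
have axi : adapted T F (fun t w => xi w t).
  by move=> t tT B mB; apply: F1F => //; exact: gxi.
have azeta : adapted T F (fun t w => zeta w t).
  by move=> t tT B mB; apply: F2F => //; exact: gzeta.
have dev' : devices (F T) Z2 Z1.
  have [u1 u2 ind] := dev; split=> // A B2 B1 FA mB2 mB1.
  by rewrite setIAC ind// -!muleA; congr (_ * _)%E; rewrite muleC.
have [[oV1 _] iV1] := hV1; have [[oV2 _] sV2] := hV2.
have oY1 : optional T F1 Y1.
  have [opf _] := hpf; have [oph _] := hph1.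
  by apply: optionalB => //; exact: optionalB.
have oY2 : optional T F2 Y2.
  have [opg _] := hpg; have [oph _] := hph2.
  by apply: optionalB => //; exact: optionalB.
have le1 : {ae P, forall w, forall t, 0 <= t <= T -> Y1 t w <= 0}.
  exact: (value_le_projection hT hF hF1 F1F hf hh haf hah azeta dev oV1 iV1 hpf hph1).
have saddle1 tau : randomised_time T F1 Z1 tau ->
    ('E_P[game_payoff f g h (rand_time xi Z1) (rand_time zeta Z2)] <=
     'E_P[game_payoff f g h tau (rand_time zeta Z2)])%E by exact: sad1.
have eq1 := value_eq_projection hT hF hF1 F1F hf hg hh haf hag hah gxi azeta dev
  saddle1 oV1 iV1 hpf hph1.
(* Finiteness allows the sign to be pulled out of the expectations when the players are
   exchanged. *)
have game_fin (t s : Omega -> gen_path T) (Z Z' : {RV P >-> R}) :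
    adapted T F (fun u w => t w u) -> adapted T F (fun u w => s w u) ->
    ('E_P[game_payoff f g h (rand_time t Z) (rand_time s Z')])%E \is a fin_num.
  move=> at_ as_; rewrite unlock; apply: integrable_fin_num => //.
  have mrand (r : Omega -> gen_path T) (Y : {RV P >-> R}) :
      adapted T F (fun u w => r w u) -> measurable_fun setT (rand_time r Y).
    move=> ar; apply: (measurable_quant hT (p := id) (z := Y)); last exact: measurable_funP.
    by move=> u uT; exact: (adapted_measurable hF ar).
  have itv (r : Omega -> gen_path T) (Y : {RV P >-> R}) w : 0 <= rand_time r Y w <= T.
    exact: quant_itv.
  apply: (le_integrable _ _ _ (integrable_pay_bound hT hF hf hg hh haf hag hah)) => //.
    apply/measurable_EFinP.
    exact: (measurable_pay hT hF hf hg hh haf hag hah (mrand _ _ at_) (itv _ _)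
      (mrand _ _ as_) (itv _ _) (measurable_idT hT hF)).
  move=> w _ /=; rewrite lee_fin.
  by rewrite (le_trans (pay_bound hT hf hg hh w (itv _ _ _) (itv _ _ _)))// ler_norm.
have game_opp (t s : Omega -> gen_path T) (Z Z' : {RV P >-> R}) :
    adapted T F (fun u w => t w u) -> adapted T F (fun u w => s w u) ->
    ('E_P[game_payoff (opp_process g) (opp_process f) (opp_process h)
           (rand_time s Z') (rand_time t Z)] =
    - 'E_P[game_payoff f g h (rand_time t Z) (rand_time s Z')])%E.
  move=> at_ as_; have := game_fin t s Z Z' at_ as_; rewrite !unlock => Efin.
  rewrite -integralN_fin_num//; apply: eq_integral => w _.
  by rewrite game_payoffN EFinN.
have saddle2 sigma : randomised_time T F2 Z2 sigma ->
    ('E_P[game_payoff (opp_process g) (opp_process f) (opp_process h)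
            (rand_time zeta Z2) (rand_time xi Z1)] <=
     'E_P[game_payoff (opp_process g) (opp_process f) (opp_process h)
            sigma (rand_time xi Z1)])%E.
  move=> [s gs ->]; have as_ : adapted T F (fun u w => s w u).
    by move=> t tT B mB; apply: F2F => //; exact: gs.
  by rewrite !game_opp// leeN2; apply: (sad2 _ _ dev); exists s.
have iV2 theta : stopping_time T F2 theta ->
    is_ess_inf P (cond_payoffs P F2 (opp_process g) (opp_process f) (opp_process h)
      xi theta) (fun w => opp_process V2 (theta w) w).
  move=> st; have := is_ess_infN (sV2 theta st).
  rewrite (_ : [set X | _] = cond_payoffs P F2 (opp_process g) (opp_process f)
    (opp_process h) xi theta)//; have S2 := stopped_sigma_sub hT hF2 st.
  (* A variable is a version for the negated payoffs exactly when its opposite is one for the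
     original payoffs. *)
  apply/seteqP; split => X /= [tau tau_st cX]; exists tau => //.
    by rewrite stop_payoffN -[X](_ : \- (\- X) = X);
      [exact: is_cond_expN|apply/funext => w /=; rewrite opprK].
  have := is_cond_expN S2 cX; rewrite stop_payoffN.
  by congr is_cond_exp; apply/funext => w /=; rewrite opprK.
have opV2 : optional T F2 (opp_process V2) by exact: optionalN.
have hpg' : is_optional_projection T P F2
    (fun t w => opp_process g t w * (1 - xi w t)) (opp_process pg).
  have := is_optional_projectionN hT hF2 hpg; congr is_optional_projection.
  by apply/funext => t; apply/funext => w; rewrite /opp_process mulNr.
have hph2' : is_optional_projection T P F2
    (fun t w => opp_process h t w * jump (xi w) t) (opp_process ph2).
  have := is_optional_projectionN hT hF2 hph2; congr is_optional_projection.
  by apply/funext => t; apply/funext => w; rewrite /opp_process mulNr.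
have le2 := value_le_projection hT hF hF2 F2F (LbN hg) (LbN hh) (adaptedN hag)
  (adaptedN hah) axi dev' opV2 iV2 hpg' hph2'.
have eq2 := value_eq_projection hT hF hF2 F2F (LbN hg) (LbN hf) (LbN hh) (adaptedN hag)
  (adaptedN haf) (adaptedN hah) gzeta axi dev' saddle2 opV2 iV2 hpg' hph2'.
have Y2E t w : opp_process V2 t w - opp_process pg t w - opp_process ph2 t w = - Y2 t w.
  by rewrite /opp_process /Y2 !opprB !opprK; lra.
have {}eq2 : {ae P, forall w,
    stieltjes (zeta w) (`[0, T] `&` [set t | Y2 t w != 0]) = 0%E}.
  apply: filterS eq2 => w; congr (stieltjes _ (_ `&` _) = _).
  by apply/seteqP; split => t /=; rewrite Y2E oppr_eq0.
have supp1 w : stieltjes (xi w) (`[0, T] `&` [set t | Y1 t w != 0]) = 0%E -> _ :=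
  stieltjes_integral_support (optional_measurable_path hT hF1 w oY1).
have supp2 w : stieltjes (zeta w) (`[0, T] `&` [set t | Y2 t w != 0]) = 0%E -> _ :=
  stieltjes_integral_support (optional_measurable_path hT hF2 w oY2).
split.
- apply: filterS2 le1 le2 => w Y1w Y2w t tT; split; first exact: Y1w.
  by have := Y2w t tT; rewrite Y2E oppr_le0.
- by apply: filterS2 eq1 eq2 => w /supp1[I1 _ _] /supp2[I2 _ _].
- by apply: filterS2 eq1 eq2 => w /supp1[_ I1 _] /supp2[_ _ I2].
Qed.
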